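(* Let $n\ge 1$ and let $A$ be an expansive real $n\times n$ matrix. Suppose that the transpose $A^{*}$ has a real eigenvalue $\lambda\in\mathbb{R}$ with an associated eigenvector $v\in\mathbb{R}^n\setminus\{0\}$. Let $\psi$ be a radial function on $\mathbb{R}^n$ satisfying the standing hypothesis with respect to $A$ (see context), with $\widehat{\psi}$ supported in $\mathcal{A}(r,R)=\{\xi\in\mathbb{R}^n : r\le|\xi|\le R\}$, $0<r<R$, and suppose $|\lambda|>R/r$. Then the frame operator $U_{\psi,\psi}$ does not coincide with the identity on $H^p_A(\mathbb{R}^n)$ for any $p\in(0,1]$. The conclusion is uniform in $p$: the deviation $\|U_{\psi,\psi}-\mathrm{Id}\|_{H^p_A\to H^p_A}$ is bounded below by the same constant $1$ for every $p\in(0,1]$.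
   Context: Fourier transform: $\hat f(\xi)=\int_{\mathbb{R}^n} f(x)e^{-2\pi i x\cdot\xi}\,dx$. $\mathcal{S}(\mathbb{R}^n)$ and $\mathcal{S}'(\mathbb{R}^n)$ denote Schwartz functions and tempered distributions; $|\cdot|$ is the Euclidean norm on $\mathbb{R}^n$. A real $n\times n$ matrix $A$ is expansive if every eigenvalue $\mu$ of $A$ satisfies $|\mu|>1$. Put $b:=|\det A|>1$, and let $|\lambda_-|$ be the smallest modulus of an eigenvalue of $A$. $A^*$ is the transpose of $A$. Step homogeneous quasi-norm (Bownik): there is an open ellipsoid $\Delta$ centred at $0$ with $|\Delta|=1$ and $\Delta\subset t\Delta\subset A\Delta$ for some $t>1$; fix one, put $B_k:=A^k\Delta$ ($k\in\mathbb{Z}$), and set $\rho_A(x)=b^k$ for $x\in B_{k+1}\setminus B_k$, $\rho_A(0)=0$. Then $\rho_A(Ax)=b\,\rho_A(x)$ and $\rho_A(x+y)\le C(\rho_A(x)+\rho_A(y))$. An anisotropic annulus is a set $\{\xi : r_A\le\rho_A(\xi)\le R_A\}$ with $0<r_A<R_A<\infty$. Standing hypothesis on $\psi$: $\psi\in\mathcal{S}(\mathbb{R}^n)$ (this is the meaning given to ''anisotropic decay adapted to $\rho_A$''); $\psi$ has vanishing moments $\int x^\alpha\psi(x)\,dx=0$ for $|\alpha|\le\mathcal{N}_p(A):=\lfloor(\tfrac1p-1)\tfrac{\ln b}{\ln|\lambda_-|}\rfloor$, for every $p\in(0,1]$; and $\hat\psi$ is supported in an anisotropic annulus contained in $[-1/2,1/2]^n\setminus\{0\}$.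 Affine system and frame operator: $\psi_{j,k}(x):=b^{j/2}\psi(A^jx-k)$ for $j\in\mathbb{Z}$, $k\in\mathbb{Z}^n$, and $U_{\psi,\psi}f:=\sum_{j\in\mathbb{Z}}\sum_{k\in\mathbb{Z}^n}\langle f,\psi_{j,k}\rangle\psi_{j,k}$. Anisotropic Hardy space: for $0<p\le1$, $H^p_A(\mathbb{R}^n)$ is the space of $f\in\mathcal{S}'(\mathbb{R}^n)$ with $\|f\|_{H^p_A}:=\|M_Nf\|_{L^p}<\infty$, where $M_N$ is the grand maximal function $M_Nf(x)=\sup_{\varphi\in\mathcal{S}_N}\sup_{k\in\mathbb{Z}}\sup_{y\in x+B_k}|f*\varphi_k(y)|$, $\varphi_k(x)=b^{-k}\varphi(A^{-k}x)$, $\mathcal{S}_N=\{\varphi\in\mathcal{S}(\mathbb{R}^n):\sup_x\sup_{|\alpha|\le N}\max(1,\rho_A(x)^N)|\partial^\alpha\varphi(x)|\le1\}$, and $N=N(p,A)$ is any fixed sufficiently large integer (different choices give equivalent quasi-norms). For an operator $T$, $\|T\|_{H^p_A\to H^p_A}=\sup\{\|Tf\|_{H^p_A}/\|f\|_{H^p_A}: 0\ne f\in H^p_A\}$. *)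

(* Defs.v *)
From HB Require Import structures.
From mathcomp Require Import all_boot all_order all_algebra finmap.
From mathcomp Require Import all_classical all_reals all_analysis.
From mathcomp.analysis.showcase Require Import summability.
From mathcomp.real_closed Require Import complex.

Set Implicit Arguments.
Unset Strict Implicit.
Unset Printing Implicit Defensive.

Import Order.TTheory GRing.Theory Num.Theory numFieldNormedType.Exports.

Local Open Scope classical_set_scope.
Local Open Scope ring_scope.
Local Open Scope complex_scope.

Local Notation cRe := complex.Re.
Local Notation cIm := complex.Im.

(* Lebesgue measure on R^n is built on n.-tuple R, which carries the
   sigma-algebra generated by the coordinates, as the n-fold product of the
   one-dimensional measure; functions on 'cV[R]_n are transported to it by
   [col_of_tuple]. *)
Section lebesgue_step.
Context (R : realType) (n : nat).
Variable m : {sigma_finite_measure set (n.-tuple (measurableTypeR R)) -> \bar R}.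

Definition tuple_cons (p : measurableTypeR R * n.-tuple (measurableTypeR R)) :
  n.+1.-tuple (measurableTypeR R) := [tuple of p.1 :: p.2].

Lemma measurable_tuple_cons : measurable_fun [set: _] tuple_cons.
Proof.
exact: (measurable_cons (@measurable_fst _ _ _ _) (@measurable_snd _ _ _ _)).
Qed.

Definition leb_succ : set (n.+1.-tuple (measurableTypeR R)) -> \bar R :=
  pushforward (@lebesgue_measure R \x m)%E tuple_cons.

Let leb_succ0 : leb_succ set0 = 0%E.
Proof. by rewrite /leb_succ /pushforward preimage_set0 measure0. Qed.

Let leb_succ_ge0 B : (0 <= leb_succ B)%E.
Proof. by rewrite /leb_succ /pushforward. Qed.

Let leb_succ_additive : semi_sigma_additive leb_succ.
Proof.
move=> F mF tF mUF; rewrite /leb_succ /pushforward preimage_bigcup.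
apply: measure_semi_sigma_additive.
- by move=> k; rewrite -[X in measurable X]setTI; exact: measurable_tuple_cons.
- apply/trivIsetP => i j _ _ ij; rewrite -preimage_setI.
  by move/trivIsetP : tF => /(_ _ _ _ _ ij) ->//; rewrite preimage_set0.
- rewrite -preimage_bigcup -[X in measurable X]setTI.
  exact: measurable_tuple_cons.
Qed.

HB.instance Definition _ := isMeasure.Build _ _ _ leb_succ
  leb_succ0 leb_succ_ge0 leb_succ_additive.

Let leb_succ_sigma_finite : sigma_finite setT leb_succ.
Proof.
have /sigma_finiteP[F [TF ndF Foo]] := sigma_finiteT (@lebesgue_measure R).
have /sigma_finiteP[G [TG ndG Goo]] := sigma_finiteT m.
pose un (t : n.+1.-tuple (measurableTypeR R)) :
  measurableTypeR R * n.-tuple (measurableTypeR R) :=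
  (thead t, [tuple of behead t]).
have unK : cancel tuple_cons un.
  by move=> [x t]; rewrite /un /tuple_cons /= theadE; congr pair; exact/val_inj.
have mun : measurable_fun [set: _] un.
  apply/measurable_fun_pairP; split.
    exact: measurable_tnth.
  exact: measurable_behead.
exists (fun k => un @^-1` (F k `*` G k)).
  rewrite -preimage_bigcup; apply/esym; rewrite -subTset => t _ /=.
  have [i _ Fi] : (\bigcup_k F k) (un t).1 by rewrite -TF.
  have [j _ Gj] : (\bigcup_k G k) (un t).2 by rewrite -TG.
  exists (maxn i j) => //; split.
    by move: Fi; exact/subsetPset/ndF/leq_maxl.
  by move: Gj; exact/subsetPset/ndG/leq_maxr.
move=> k; have [mFk Fk] := Foo k; have [mGk Gk] := Goo k; split.
  by rewrite -[X in measurable X]setTI; apply: mun => //; exact: measurableX.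
rewrite /leb_succ /pushforward -comp_preimage (_ : un \o tuple_cons = id).
  by rewrite preimage_id product_measure1E// lte_mul_pinfty// ge0_fin_numE.
by apply/funext => x /=; rewrite unK.
Qed.

HB.instance Definition _ := Measure_isSigmaFinite.Build _ _ _ leb_succ
  leb_succ_sigma_finite.

End lebesgue_step.

Fixpoint leb (R : realType) (n : nat) :
  {sigma_finite_measure set (n.-tuple (measurableTypeR R)) -> \bar R} :=
  match n with
  | 0 => \d_ ([tuple] : 0.-tuple (measurableTypeR R))
  | n'.+1 => leb_succ (leb R n')
  end.

Section analysis.
Context (R : realType) (n : nat).
Local Notation C := R[i].
Local Notation V := 'cV[R]_n.
Local Notation cabs := (@ComplexField.Normc.normc R).

Definition col_of_tuple (t : n.-tuple R) : V := \col_i tnth t i.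

(* Meaningful only when the real and imaginary parts of f are integrable. *)
Definition cintegral (f : V -> C) : C :=
  (\int[leb R n]_t cRe (f (col_of_tuple t))) +i*
  (\int[leb R n]_t cIm (f (col_of_tuple t))).

Definition volume (D : set V) : \bar R := leb R n (col_of_tuple @^-1` D).

Definition dotv (x y : V) : R := \sum_i x i 0 * y i 0.
Definition enorm (x : V) : R := Num.sqrt (dotv x x).

Definition multi_index := {ffun 'I_n -> nat}.
Definition mi_deg (a : multi_index) : nat := \sum_i a i.
Definition monomial (a : multi_index) (x : V) : R := \prod_i x i 0 ^+ a i.

Definition partial (i : 'I_n) (f : V -> R) : V -> R :=
  fun x => 'D_(delta_mx i 0) f x.

Definition smooth (f : V -> R) : Prop :=
  forall s : seq 'I_n, let g := foldr partial f s in
    continuous g /\ forall i x, derivable g x (delta_mx i 0).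

Definition real_deriv (a : multi_index) (f : V -> R) : V -> R :=
  foldr (fun i g => iter (a i) (partial i) g) f (enum 'I_n).
Definition cderiv (a : multi_index) (f : V -> C) : V -> C := fun x =>
  real_deriv a (fun y => cRe (f y)) x +i* real_deriv a (fun y => cIm (f y)) x.

Definition seminorm (a b : multi_index) (f : V -> C) : \bar R :=
  ereal_sup (range (fun x => (cabs ((monomial a x)%:C * cderiv b f x))%:E)).

Definition schwartz (f : V -> C) : Prop :=
  [/\ smooth (fun x => cRe (f x)), smooth (fun x => cIm (f x)) &
      forall a b, (seminorm a b f < +oo)%E].

Definition fourier (f : V -> C) (xi : V) : C :=
  cintegral (fun x => let t := - (2 * pi * dotv x xi) in
    f x * (cos t +i* sin t)).

(* Only the values on Schwartz functions are meaningful, so distributions are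
   compared with [distr_eq] and not with Leibniz equality. *)
Definition distribution := (V -> C) -> C.

Definition distr_eq (f g : distribution) : Prop :=
  forall phi, schwartz phi -> f phi = g phi.

Definition tempered (f : distribution) : Prop :=
  (forall (c : C) phi chi, schwartz phi -> schwartz chi ->
     f (fun x => c * phi x + chi x) = c * f phi + f chi) /\
  exists (K : R) (m : nat), forall phi, schwartz phi ->
    ((cabs (f phi))%:E <=
     K%:E * \sum_(a : {ffun 'I_n -> 'I_m.+1}) \sum_(b : {ffun 'I_n -> 'I_m.+1})
       seminorm [ffun i => nat_of_ord (a i)] [ffun i => nat_of_ord (b i)] phi)%E.

(* Unconditional convergence: limit along the finite subsets of the index set. *)
Definition has_sum {I : choiceType} (c : I -> C) (s : C) : Prop :=
  (fun F : {fset I} => cabs (partial_sum c F - s)) @ totally --> (0 : R).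

End analysis.

Section anisotropic.
Context (R : realType) (n : nat).
Local Notation C := R[i].
Local Notation V := 'cV[R]_n.+1.
Local Notation cabs := (@ComplexField.Normc.normc R).
Implicit Types (A : 'M[R]_n.+1) (D : set V).

(* [eigenvalue] is about row eigenvectors; the spectrum is the same. *)
Definition complex_eigenvalue A (mu : C) : Prop :=
  eigenvalue (map_mx (real_complex R) A) mu.

Definition expansive A : Prop :=
  forall mu, complex_eigenvalue A mu -> 1 < cabs mu.

Definition bdet A : R := `|\det A|.

Definition lambda_minus A : R := inf [set cabs mu | mu in complex_eigenvalue A].

Definition ellipsoid D : Prop :=
  exists2 P : 'M[R]_n.+1, P \in unitmx & D = [set x | enorm (P *m x) < 1].

Definition adapted_ellipsoid A D : Prop :=
  [/\ ellipsoid D, volume D = 1%E &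
      exists2 t : R, 1 < t &
        D `<=` [set t *: x | x in D] /\
        [set t *: x | x in D] `<=` [set A *m x | x in D]].

Definition dilate A D (k : int) : set V := [set (A ^ k) *m x | x in D].

(* For x != 0 exactly one k satisfies the condition, so the default value of
   [xget] is irrelevant when A is expansive and D is adapted to A. *)
Definition rho A D (x : V) : R :=
  if x == 0 then 0
  else bdet A ^ xget 0 [set k : int | (dilate A D (k + 1) `\` dilate A D k) x].

Definition annulus A D (r s : R) : set V := [set xi | r <= rho A D xi <= s].

Definition euclidean_annulus (r s : R) : set V := [set xi | r <= enorm xi <= s].

Definition fourier_support (psi : V -> C) : set V :=
  closure [set xi | fourier psi xi != 0].

Definition moment_order A (p : R) : int :=
  Num.floor ((p^-1 - 1) * (ln (bdet A) / ln (lambda_minus A))).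

Definition standing_hypothesis A D (psi : V -> C) : Prop :=
  [/\ schwartz psi,
      forall p : R, 0 < p <= 1 -> forall a : multi_index n.+1,
        (mi_deg a)%:Z <= moment_order A p ->
        cintegral (fun x => (monomial a x)%:C * psi x) = 0 &
      exists r s : R,
        [/\ 0 < r < s,
            annulus A D r s `<=`
              [set xi | (forall i, `|xi i 0| <= 2^-1) /\ xi != 0] &
            fourier_support psi `<=` annulus A D r s]].

Definition radial (psi : V -> C) : Prop :=
  forall x y, enorm x = enorm y -> psi x = psi y.

Definition test_class A D (N : nat) (phi : V -> C) : Prop :=
  schwartz phi /\
  forall x (a : multi_index n.+1), (mi_deg a <= N)%N ->
    Num.max 1 (rho A D x ^+ N) * cabs (cderiv a phi x) <= 1.

Definition dilate_fun A (k : int) (phi : V -> C) : V -> C :=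
  fun x => (bdet A ^ (- k))%:C * phi ((A ^ (- k)) *m x).

Definition convolve (f : distribution R n.+1) (phi : V -> C) (y : V) : C :=
  f (fun z => phi (y - z)).

Definition grand_maximal A D (N : nat) (f : distribution R n.+1) (x : V) : \bar R :=
  ereal_sup [set e | exists phi k y,
    [/\ test_class A D N phi, dilate A D k (y - x) &
        e = (cabs (convolve f (dilate_fun A k phi) y))%:E]].

Definition hardy_norm A D (N : nat) (p : R) (f : distribution R n.+1) : \bar R :=
  'N[leb R n.+1]_(p%:E)[grand_maximal A D N f \o @col_of_tuple R n.+1].

Definition hardy A D (N : nat) (p : R) (f : distribution R n.+1) : Prop :=
  tempered f /\ (hardy_norm A D N p f < +oo)%E.

Definition affine A (psi : V -> C) (jk : int * 'cV[int]_n.+1) : V -> C :=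
  fun x => (bdet A `^ (jk.1%:~R / 2))%:C *
           psi ((A ^ jk.1) *m x - map_mx intr jk.2).

(* The pairing is sesquilinear: it extends <f, g> = \int f(x) conj(g(x)) dx. *)
Definition pairing (f : distribution R n.+1) (g : V -> C) : C :=
  f (fun x => (g x)^*%C).

Definition distr_of (g : V -> C) : distribution R n.+1 :=
  fun phi => cintegral (fun x => g x * phi x).

(* [frame_op A psi f g] means U f = g: the series defining U f converges
   unconditionally to g in the weak-* topology of tempered distributions.
   Such a g is unique up to [distr_eq]. *)
Definition frame_op A (psi : V -> C) (f g : distribution R n.+1) : Prop :=
  tempered g /\
  forall phi, schwartz phi ->
    has_sum (fun jk => pairing f (affine A psi jk) * distr_of (affine A psi jk) phi)
            (g phi).

Definition frame_deviation A (psi : V -> C) (f g : distribution R n.+1) : Prop :=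
  exists2 h, frame_op A psi f h & g = (fun phi => h phi - f phi).

(* Operator quasi-norm of an operator given by its graph [T]. *)
Definition hardy_op_norm A D (N : nat) (p : R)
    (T : distribution R n.+1 -> distribution R n.+1 -> Prop) : \bar R :=
  ereal_sup [set e | exists f g,
    [/\ hardy A D N p f, ~ distr_eq f (fun=> 0), T f g &
        e = (hardy_norm A D N p g / hardy_norm A D N p f)%E]].

End anisotropic.

(* Main.v *)
(* Pick xi0 on the line spanned by v with s < |xi0| < |lambda| r. The powers of
   A^T multiply it by powers of lambda, so its orbit jumps over the annulus
   [r, s]; as A is expansive, the same holds for all points of a small box
   around xi0. Let f be a product of sinc functions modulated at the frequency
   xi0: its spectrum lies in that box, hence f is orthogonal to every psi_{j,k},
   so that U f = 0 and U f - f = - f has the same quasi-norm as f.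

   To have f in H^p, the modulated kernel is replaced by its m-fold difference
   in a direction u: moved onto the test function, the m differences gain the
   power of the dilation that the maximal function needs at large scales. With
   u . xi0 = 1/2 the translation by u flips the sign of the modulation, so the
   differences add up instead of cancelling, and testing against a modulated
   Gaussian shows that f is not zero. *)
Require Import Defs.
From HB Require Import structures.
From mathcomp Require Import all_boot all_order all_algebra.
From mathcomp Require Import all_classical all_reals all_analysis.
From mathcomp Require Import measurable_realfun.
From mathcomp Require Import ring lra.
From mathcomp.analysis.showcase Require Import summability.
From mathcomp.real_closed Require Import complex.

Set Implicit Arguments.
Unset Strict Implicit.
Unset Printing Implicit Defensive.
Import Order.TTheory GRing.Theory Num.Theory numFieldNormedType.Exports.
Local Open Scope classical_set_scope.
Local Open Scope ring_scope.

(** * Lebesgue measure under affine maps *)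

(** The spectrum of [f] is never computed. The Fourier transform of [psi] is traded once for real
    integrals against [cos (phase xi x + a)] with a free phase [a], and a sinc factor in one
    coordinate averages such integrals over a segment of frequencies. Finite powers of sinc thus
    replace a smooth bump and its inverse transform; the price is that [f] decays only polynomially,
    so that the exponents have to be tuned. The dilations are compared with the norm [q] of the
    ellipsoid, which [A] expands by a factor between [t] and [Lam]. [L0] makes the [p]-th power of
    [wt P L0] integrable. At scale [l >= 0] each difference gains [(t ^+ l)^-1] while the weight
    spreads by [(Lam ^+ l) ^+ L0], whence [Lam ^+ L0 <= t ^+ m]. [N] grants the test functions [m]
    derivatives and enough decay, and [L] gives the kernel its decay. The width [e] comes last,
    since the spectrum of the kernel widens with [L]. None of [L0], [m], [N] depends on [psi] or on
    the eigenvector. *)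

Section lebesgue_affine.
Context {R : realType}.
Local Notation mu := (@lebesgue_measure R).
Local Open Scope ereal_scope.

Let aff (a c : R) : measurableTypeR R -> measurableTypeR R := fun x => (a * x + c)%R.

Let measurable_aff a c : measurable_fun setT (aff a c).
Proof. by apply: measurable_funD => //; apply: measurable_funM. Qed.

HB.instance Definition _ a c := isMeasurableFun.Build _ _ _ _ _ (measurable_aff a c).

(** Lebesgue measure is determined by its values on the intervals []u, v]]. A negative [a] makes the
    preimage closed on the left instead, which has the same length. *)
Lemma lebesgue_measure_affine (a c : R) (B : set R) : a != 0%R -> measurable B ->
  mu B = (`|a|%:E * pushforward mu (aff a c) B).
Proof.
move=> a0 mB.
pose s : {nonneg R} := NngNum (normr_ge0 a).
rewrite (_ : _ * _ = mscale s (pushforward mu (aff a c)) B); last by [].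
apply: lebesgue_measure_unique => //= _ [[u v]] _ <-.
rewrite /mscale/= /pushforward/=.
have [an|ap|/eqP] := ltrgtP a 0%R; last by rewrite (negbTE a0).
- have -> : aff a c @^-1` `]u, v]%classic = `[((v - c) / a)%R, ((u - c) / a)%R[%classic.
    apply/seteqP; split => x /=; rewrite !in_itv/= /aff ler_ndivrMr// ltr_ndivlMr//.
      by move=> /andP[h1 h2]; apply/andP; split; lra.
    by move=> /andP[h1 h2]; apply/andP; split; lra.
  rewrite !lebesgue_measure_itv/= !lte_fin ltr_ndivlMr// divfK// ltrD2r.
  rewrite -!EFinB; case: ifPn => _; last by rewrite mule0.
  by rewrite -EFinM ltr0_norm//; congr EFin; field.
- have -> : aff a c @^-1` `]u, v]%classic = `]((u - c) / a)%R, ((v - c) / a)%R]%classic.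
    apply/seteqP; split => x /=; rewrite !in_itv/= /aff ltr_pdivrMr// ler_pdivlMr//.
      by move=> /andP[h1 h2]; apply/andP; split; lra.
    by move=> /andP[h1 h2]; apply/andP; split; lra.
  rewrite !lebesgue_measure_itv/= !lte_fin ltr_pdivlMr// divfK// ltrD2r.
  rewrite -!EFinB; case: ifPn => _; last by rewrite mule0.
  by rewrite -EFinM gtr0_norm//; congr EFin; field.
Qed.

Lemma ge0_integral_affine (a c : R) (F : R -> \bar R) : a != 0%R ->
  measurable_fun [set: R] F -> (forall x, 0 <= F x) ->
  \int[mu]_x F (a * x + c)%R = `|a|^-1%:E * \int[mu]_x F x.
Proof.
move=> a0 mF F0.
pose s : {nonneg R} := NngNum (normr_ge0 a).
have mE : \int[mu]_x F x = \int[mscale s (pushforward mu (aff a c))]_x F x.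
  by move=> m; apply: eq_measure_integral => B mB _; exact: lebesgue_measure_affine.
rewrite (mE (measurable_aff a c)) ge0_integral_mscale//= muleA -EFinM mulVf ?normr_eq0// mul1e.
by rewrite ge0_integral_pushforward// => y _; exact: F0.
Qed.

End lebesgue_affine.

(** * Affine change of variables in several dimensions *)

Section leb_affine.
Context {R : realType}.
Local Notation mu := (@lebesgue_measure R).
Local Notation mT := (measurableTypeR R).
Local Notation col := (@col_of_tuple R _).

Definition tuple_of_col n (x : 'cV[R]_n) : n.-tuple mT := [tuple x i 0 | i < n].

Lemma tuple_of_colK n : cancel (@tuple_of_col n) (@col_of_tuple R n).
Proof. by move=> x; apply/matrixP => i j; rewrite mxE tnth_mktuple ord1. Qed.

Lemma measurable_coord n (i : 'I_n) :
  measurable_fun [set: n.-tuple mT] (fun t => (col t) i 0 : R).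
Proof.
rewrite (_ : (fun _ => _) = @tnth n mT ^~ i); first exact: measurable_tnth.
by apply/funext => t; rewrite mxE.
Qed.

(* ['cV[R]_n] carries no sigma-algebra: measurability of [F] is read off [F \o col]. *)
Lemma measurable_comp_col d (T : measurableType d) d' (T' : measurableType d') n
    (F : 'cV[R]_n -> T') (phi : T -> 'cV[R]_n) :
  measurable_fun setT (F \o @col_of_tuple R n) ->
  (forall i, measurable_fun setT (fun t => phi t i 0 : R)) ->
  measurable_fun setT (F \o phi).
Proof.
move=> mF mphi.
rewrite (_ : F \o phi = (F \o @col_of_tuple R n) \o (@tuple_of_col n \o phi)); last first.
  by apply/funext => t /=; rewrite tuple_of_colK.
apply: measurableT_comp => //; apply/measurable_fun_tnthP => i.
rewrite (_ : _ \o _ = fun t => phi t i 0)//.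
by apply/funext => t /=; rewrite tnth_mktuple.
Qed.

Lemma measurable_affine_coord d (T : measurableType d) m n (A : 'M[R]_(m, n))
    (c : 'cV[R]_m) (phi : T -> 'cV[R]_n) :
  (forall i, measurable_fun setT (fun t => phi t i 0 : R)) ->
  forall i, measurable_fun setT (fun t => (A *m phi t + c) i 0 : R).
Proof.
move=> mphi i.
rewrite (_ : (fun _ => _) = fun t => \sum_j A i j * phi t j 0 + c i 0); last first.
  by apply/funext => t; rewrite !mxE.
apply: measurable_funD => //; apply: measurable_sum => j.
exact: measurable_funM.
Qed.

Lemma col_cons n (x : R) (t : n.-tuple mT) :
  col (tuple_cons (x, t)) = col_mx x%:M (col t) :> 'cV[R]_(1 + n).
Proof.
apply/matrixP => i j; rewrite [LHS]mxE; case: (split_ordP i) => k ->.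
  by rewrite col_mxEu ord1 mxE eq_sym (ord1 j) eqxx (tnth_nth 0).
by rewrite col_mxEd mxE !(tnth_nth 0).
Qed.

Lemma measurable_col_cons n d (T : measurableType d) (f : T -> R) (phi : T -> 'cV[R]_n) :
  measurable_fun setT f -> (forall i, measurable_fun setT (fun t => phi t i 0 : R)) ->
  forall i : 'I_(1 + n), measurable_fun setT (fun t => (col_mx (f t)%:M (phi t)) i 0 : R).
Proof.
move=> mf mphi i; case: (split_ordP i) => k ->.
  rewrite (_ : (fun _ => _) = f)//; apply/funext => t.
  by rewrite col_mxEu ord1 mxE.
rewrite (_ : (fun _ => _) = fun t => phi t k 0)//; apply/funext => t.
by rewrite col_mxEd.
Qed.

Local Open Scope ereal_scope.

Lemma ge0_integral_leb_succ n (F : n.+1.-tuple mT -> \bar R) :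
  measurable_fun setT F -> (forall t, 0 <= F t) ->
  \int[leb R n.+1]_t F t = \int[mu]_x \int[leb R n]_t F (tuple_cons (x, t)).
Proof.
move=> mF F0; rewrite [LHS]/=.
rewrite (_ : \int[_]_t F t =
  \int[pushforward (mu \x leb R n) (@tuple_cons R n)]_t F t)//.
have mt := @measurable_tuple_cons R n.
rewrite ge0_integral_pushforward//=.
rewrite preimage_setT fubini_tonelli1//.
exact: measurableT_comp.
Qed.

Lemma ge0_integral_leb_succ_swap n (F : n.+1.-tuple mT -> \bar R) :
  measurable_fun setT F -> (forall t, 0 <= F t) ->
  \int[leb R n.+1]_t F t = \int[leb R n]_t \int[mu]_x F (tuple_cons (x, t)).
Proof.
move=> mF F0; rewrite ge0_integral_leb_succ//.
rewrite (fubini_tonelli (F \o @tuple_cons R n))//.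
  by apply: measurableT_comp => //; exact: measurable_tuple_cons.
by move=> z; exact: F0.
Qed.

Let affine_prop n (A : 'M[R]_n) := forall (c : 'cV[R]_n) (F : 'cV[R]_n -> \bar R),
  measurable_fun setT (F \o @col_of_tuple R n) -> (forall x, 0 <= F x) ->
  \int[leb R n]_t F (A *m col t + c)%R = `|\det A|^-1%:E * \int[leb R n]_t F (col t).

(** Gaussian elimination on the corner entry: [A] is a unipotent lower block matrix times
    [block_mx a%:M b 0 D'], with [D'] the Schur complement. For fixed [y] the substitution in the
    first variable is one-dimensional; for a fixed first variable the induction hypothesis applies
    to [D']. *)
Let affine_step n (A : 'M[R]_(1 + n)) :
  (forall B : 'M[R]_n, B \in unitmx -> affine_prop B) ->
  A \in unitmx -> A 0%R 0%R != 0%R -> @affine_prop (1 + n)%N A.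
Proof.
move=> IH uA a0 c F mF F0.
set a := A 0%R 0%R in a0.
pose b := ursubmx A; pose d := dlsubmx A; pose D := drsubmx A.
have ulA : ulsubmx A = a%:M.
  by apply/matrixP => i j; rewrite !mxE !ord1 /= mulr1n; congr (A _ _); apply/val_inj.
pose D' := (D - a^-1 *: (d *m b))%R.
have AE : A = (block_mx 1%:M 0 (a^-1 *: d) 1%:M *m block_mx a%:M b 0 D')%R.
  rewrite mulmx_block !mul1mx !mul0mx !addr0.
  rewrite -scalemxAl mul_mx_scalar scalerA mulVf// scale1r.
  rewrite -scalemxAl /D' addrC subrK -ulA.
  by rewrite -[LHS](@submxK _ 1 n 1 n).
have detA : \det A = (a * \det D')%R.
  rewrite AE det_mulmx det_lblock det_ublock !det1 det_scalar1.
  by rewrite !mul1r.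
have uD : D' \in unitmx.
  by move: uA; rewrite !unitmxE detA unitrM => /andP[].
pose c0 := (usubmx c) 0%R 0%R; pose c1 := dsubmx c.
have cE : c = col_mx c0%:M c1.
  rewrite -[LHS]vsubmxK; congr col_mx; apply/matrixP => i j.
  by rewrite (ord1 i) (ord1 j) [RHS]mxE eqxx mulr1n.
pose G (x : R) (y : 'cV[R]_n) := F (col_mx x%:M y).
pose by_ (y : 'cV[R]_n) : R := (b *m y) 0%R 0%R.
(* With [x'] the new first coordinate, the lower block depends on [x] only through [x']; this is
   what the factorisation provides. *)
have FE x y : F (A *m col_mx x%:M y + c)%R =
    G (a * x + (by_ y + c0))%R ((a * x + (by_ y + c0)) *: (a^-1 *: d) + (D' *m y + (c1 - c0 *: (a^-1 *: d))))%R.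
  rewrite /G; congr F.
  rewrite [in LHS]cE -[A](@submxK _ 1 n 1 n) mul_block_col add_col_mx ulA; congr col_mx.
    apply/matrixP => i j; rewrite (ord1 i) (ord1 j) mul_scalar_mx !mxE eqxx /by_ !mxE /=.
    by rewrite !mulr1n addrA.
  rewrite -/d -/D /D' mul_mx_scalar scalerA mulrDl mulrAC divff// mul1r.
  rewrite [in RHS]scalerDl mulmxBl -scalemxAl -mulmxA.
  have -> : (b *m y = (by_ y)%:M)%R.
    by apply/matrixP => i j; rewrite (ord1 i) (ord1 j) [RHS]mxE eqxx mulr1n.
  rewrite mul_mx_scalar scalerA mulrDl scalerDl scalerA [(a^-1 * _)%R]mulrC.
  move: (D *m y)%R => P; apply/matrixP => i j; rewrite !mxE; ring.
have mG dd (T : measurableType dd) (f : T -> R) (phi : T -> 'cV[R]_n) :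
  measurable_fun setT f -> (forall i, measurable_fun setT (fun t => phi t i 0%R : R)) ->
  measurable_fun setT (fun t => G (f t) (phi t)).
  move=> mf mphi; apply: (@measurable_comp_col _ _ _ _ _ F (fun t => col_mx (f t)%:M (phi t))) => //.
  exact: measurable_col_cons.
have mtot : measurable_fun setT (fun t : (1 + n)%N.-tuple mT => F (A *m col t + c)%R).
  apply: (@measurable_comp_col _ _ _ _ _ F) => //.
  by apply: measurable_affine_coord => i; exact: measurable_coord.
rewrite (@ge0_integral_leb_succ_swap n)//.
under eq_integral do under eq_integral do rewrite col_cons FE.
pose K (y : 'cV[R]_n) (x : R) : \bar R :=
  G x (x *: (a^-1 *: d) + (D' *m y + (c1 - c0 *: (a^-1 *: d))))%R.
have mK dd (T : measurableType dd) (f : T -> R) (phi : T -> 'cV[R]_n) :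
  measurable_fun setT f -> (forall i, measurable_fun setT (fun t => phi t i 0%R : R)) ->
  measurable_fun setT (fun t => K (phi t) (f t)).
  move=> mf mphi; apply: mG => // i.
  rewrite (_ : (fun _ => _) = (fun t => f t * (a^-1 *: d) i 0%R +
     (D' *m phi t + (c1 - c0 *: (a^-1 *: d))) i 0%R)%R); last first.
    by apply/funext => t; rewrite ![in LHS]mxE ![in RHS]mxE.
  apply: measurable_funD; first exact: measurable_funM.
  exact: measurable_affine_coord.
under eq_integral => t _.
  rewrite (ge0_integral_affine (by_ (col t) + c0)%R (F := K (col t)))//; last 2 first.
  - by apply: mK => //; move=> i; exact: measurable_cst.
  - by move=> x; exact: F0.
  over.
rewrite ge0_integralZl//; last 2 first.
- have := @measurable_fun_fubini_tonelli_G _ _ _ _ _ mu (fun z : mT * n.-tuple mT => K (col z.2) z.1).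
  apply; last by move=> z; exact: F0.
  apply: mK => //; move=> i.
  apply: (@measurableT_comp _ _ _ _ _ _ (fun t : n.-tuple mT => (col t) i 0%R)) => //.
  exact: measurable_coord.
- by move=> t _; apply: integral_ge0 => x _; exact: F0.
rewrite -(@fubini_tonelli _ _ _ _ _ mu (leb R n) (fun z : mT * n.-tuple mT => K (col z.2) z.1))//; last 2 first.
- apply: mK => //; move=> i.
  apply: (@measurableT_comp _ _ _ _ _ _ (fun t : n.-tuple mT => (col t) i 0%R)) => //.
  exact: measurable_coord.
- by move=> z; exact: F0.
(* After the exchange of integrals the first coordinate is frozen, and the terms in [x] become part
   of the translation in [y]. *)
have KE x t : K (col t) x =
   G x (D' *m col t + (x *: (a^-1 *: d) + (c1 - c0 *: (a^-1 *: d))))%R.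
  by rewrite /K addrCA.
under eq_integral => x _.
  rewrite /=.
  under eq_integral do rewrite KE.
  rewrite (IH D' uD _ (G x))//; last 2 first.
  - by apply: mG => // i; exact: measurable_coord.
  - by move=> y; exact: F0.
  over.
rewrite ge0_integralZl//; last 2 first.
- apply: (@measurable_fun_fubini_tonelli_F _ _ _ _ _ (leb R n) (fun z : mT * n.-tuple mT => G z.1 (col z.2))).
    apply: mG => // i.
    apply: (@measurableT_comp _ _ _ _ _ _ (fun t : n.-tuple mT => (col t) i 0%R)) => //.
    exact: measurable_coord.
  by move=> z; exact: F0.
- by move=> x _; apply: integral_ge0 => t _; exact: F0.
rewrite [in RHS](@ge0_integral_leb_succ n)//.
under [X in _ = _ * X]eq_integral do under eq_integral do rewrite col_cons.
by rewrite muleA -EFinM -invfM -normrM detA.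
Qed.

(** If the corner of [A] vanishes, a transvection adding to row 0 a row [i] with [A i 0 != 0]
    repairs it. The inverse transvection has a nonzero corner too, so [affine_step] handles both
    factors. *)
Lemma ge0_integral_leb_affine n (A : 'M[R]_n) (c : 'cV[R]_n) (F : 'cV[R]_n -> \bar R) :
  A \in unitmx ->
  measurable_fun setT (F \o @col_of_tuple R n) -> (forall x, 0 <= F x) ->
  \int[leb R n]_t F (A *m col t + c)%R = `|\det A|^-1%:E * \int[leb R n]_t F (col t).
Proof.
elim: n A c F => [|n IHn] A c F uA mF F0.
  rewrite det_mx00 normr1 invr1 mul1e; apply: eq_integral => t _; congr F.
  by apply/matrixP => -[].
have IH (B : 'M[R]_n) : B \in unitmx -> affine_prop B.
  by move=> uB c' F' mF' F'0; exact: IHn.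
have step (B : 'M[R]_n.+1) : B \in unitmx -> B 0%R 0%R != 0%R -> affine_prop B.
  exact: (@affine_step n B IH).
have [a0|a0] := eqVneq (A 0%R 0%R) 0%R; last exact: step.
have [i i0] : exists i, A i 0%R != 0%R.
  apply: contrapT => /forallNP h.
  have /negP[] : ~~ (A \in unitmx); last by [].
  rewrite unitmxE (expand_det_col _ 0%R) big1 ?unitr0// => j _.
  by have /negP/negPn/eqP -> := h j; rewrite mul0r.
have in0 : i != 0%R by apply: contra_neq i0 => ->.
pose T (s : R) : 'M[R]_n.+1 := (1%:M + s *: delta_mx 0 i)%R.
have TT (s : R) : (T s *m T (- s) = 1%:M)%R.
  have EE : (delta_mx 0 i *m delta_mx 0 i = 0 :> 'M[R]_n.+1)%R.
    by rewrite mul_delta_mx_cond (negbTE in0) mulr0n.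
  rewrite /T mulmxDl !mulmxDr !mul1mx !mulmx1 -scalemxAl -scalemxAr EE !scaler0.
  by rewrite addr0 -addrA -scalerDl addNr scale0r addr0.
have TA (s : R) (x : 'cV[R]_n.+1) : (T s *m (T (- s) *m x) = x)%R.
  by rewrite mulmxA TT mul1mx.
have uT s : T s \in unitmx by have /mulmx1_unit[] := TT s.
have T00 s : T s 0%R 0%R != 0%R.
  by rewrite !mxE eqxx mulr1n /= [(0%R == i)]eq_sym (negbTE in0) mulr0 addr0 oner_neq0.
have TA00 : (T 1 *m A)%R 0%R 0%R != 0%R.
  rewrite mulmxDl mul1mx mxE a0 add0r scale1r mxE (bigD1 i)//= big1 ?addr0.
    by rewrite mxE !eqxx mul1r.
  by move=> j ji; rewrite mxE (negbTE ji) andbF mul0r.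
pose F' x := F (T (- 1) *m x)%R.
have mF' : measurable_fun setT (F' \o @col_of_tuple R n.+1).
  apply: (@measurable_comp_col _ _ _ _ _ F (fun t => T (- 1) *m col t)%R) => // j.
  have := @measurable_affine_coord _ _ _ _ (T (-1)%R) 0%R _ (@measurable_coord n.+1) j.
  by under eq_fun do rewrite addr0.
have -> : \int[leb R n.+1]_t F (A *m col t + c)%R =
   \int[leb R n.+1]_t F' ((T 1 *m A) *m col t + T 1 *m c)%R.
  apply: eq_integral => t _; rewrite /F' -mulmxA -mulmxDr mulmxA.
  by have := TT (- 1)%R; rewrite opprK => ->; rewrite mul1mx.
rewrite step//; last first.
  - by move=> x; exact: F0.
  - by rewrite unitmx_mul uT.
have -> : \int[leb R n.+1]_t F' (col t) = `|\det (T (- 1))|^-1%:E * \int[leb R n.+1]_t F (col t).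
  rewrite -(step _ _ _ 0%R)//.
  by apply: eq_integral => t _; rewrite addr0.
rewrite muleA -EFinM -invfM -normrM -det_mulmx.
by rewrite !det_mulmx mulrAC -det_mulmx TT det1 mul1r.
Qed.

End leb_affine.

(** * Integration of functions of a column vector *)

(** The grand maximal function is integrated without a measurability proof, so this form of
    monotonicity is read directly off the supremum over simple functions. *)
Lemma ge0_le_integralT d (T : measurableType d) (R : realType)
    (mu : {measure set T -> \bar R}) (f g : T -> \bar R) :
  (forall x, 0 <= f x)%E -> (forall x, f x <= g x)%E ->
  (\int[mu]_x f x <= \int[mu]_x g x)%E.
Proof.
move=> f0 fg.
have g0 x : (0 <= g x)%E by exact: le_trans (fg x).
rewrite !ge0_integralTE//; apply: ereal_sup_le => _ [h hf <-].
by exists h => // x; exact: le_trans (hf x) (fg x).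
Qed.

Section vector_integral.
Context {R : realType} {n : nat}.
Local Notation V := 'cV[R]_n.
Local Notation col := (@col_of_tuple R n).
Local Notation mT := (measurableTypeR R).

Definition vmeas (g : V -> R) :=
  measurable_fun [set: n.-tuple mT] (g \o @col_of_tuple R n : n.-tuple mT -> R).

Definition vintegrable (g : V -> R) :=
  (leb R n).-integrable setT (EFin \o (g \o @col_of_tuple R n)).

Definition vint (g : V -> R) : R := \int[leb R n]_t g (col t).

Lemma vintegrable_meas g : vintegrable g -> vmeas g.
Proof. by move=> /measurable_int /measurable_EFinP. Qed.

Lemma vintegrable_le (g h : V -> R) : vmeas g -> vintegrable h ->
  (forall x, `|g x| <= h x) -> vintegrable g.
Proof.
move=> mg ih gh; apply: (le_integrable _ _ _ ih) => //; first exact/measurable_EFinP.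
by move=> t _ /=; rewrite lee_fin (le_trans (gh _))// ler_norm.
Qed.

Lemma vintegrableD (g h : V -> R) : vintegrable g -> vintegrable h ->
  vintegrable (fun x => g x + h x).
Proof. by move=> ig ih; exact: (integrableD _ ig ih). Qed.

Lemma vintegrableB (g h : V -> R) : vintegrable g -> vintegrable h ->
  vintegrable (fun x => g x - h x).
Proof. by move=> ig ih; exact: (integrableB _ ig ih). Qed.

Lemma vintegrableZ (k : R) (g : V -> R) : vintegrable g -> vintegrable (fun x => k * g x).
Proof. by move=> ig; exact: (integrableZl _ k ig). Qed.

Lemma eq_vint (g h : V -> R) : g =1 h -> vint g = vint h.
Proof. by move=> gh; apply: eq_Rintegral => t _; rewrite gh. Qed.

Lemma vintD (g h : V -> R) : vintegrable g -> vintegrable h ->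
  vint (fun x => g x + h x) = vint g + vint h.
Proof. by move=> ig ih; exact: RintegralD. Qed.

Lemma vintB (g h : V -> R) : vintegrable g -> vintegrable h ->
  vint (fun x => g x - h x) = vint g - vint h.
Proof. by move=> ig ih; exact: RintegralB. Qed.

Lemma vintZ (k : R) (g : V -> R) : vintegrable g -> vint (fun x => k * g x) = k * vint g.
Proof. by move=> ig; exact: RintegralZl. Qed.

Lemma vint_le (g h : V -> R) : vintegrable g -> vintegrable h ->
  (forall x, `|g x| <= h x) -> `|vint g| <= vint h.
Proof.
move=> ig ih gh; apply: (le_trans (le_normr_Rintegral _ ig)) => //.
apply: le_Rintegral => //; last by move=> t _; exact: gh.
by have := integrable_norm ig.
Qed.

Lemma vint_ge0 (g : V -> R) : (forall x, 0 <= g x) -> 0 <= vint g.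
Proof. by move=> g0; apply: Rintegral_ge0 => t _; exact: g0. Qed.

Lemma vmeas_cst c : vmeas (fun=> c).
Proof. exact: measurable_cst. Qed.

Lemma vmeas_coord i : vmeas (fun x => x i 0).
Proof. exact: measurable_coord. Qed.

Lemma vmeasD g h : vmeas g -> vmeas h -> vmeas (fun x => g x + h x).
Proof. exact: measurable_funD. Qed.

Lemma vmeasB g h : vmeas g -> vmeas h -> vmeas (fun x => g x - h x).
Proof. exact: measurable_funB. Qed.

Lemma vmeasM g h : vmeas g -> vmeas h -> vmeas (fun x => g x * h x).
Proof. exact: measurable_funM. Qed.

Lemma vmeas_comp (f : R -> R) g : measurable_fun setT f -> vmeas g ->
  vmeas (fun x => f (g x)).
Proof. by move=> mf mg; apply: (measurableT_comp mf mg). Qed.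

Lemma vmeas_sum I (s : seq I) (g : I -> V -> R) : (forall i, vmeas (g i)) ->
  vmeas (fun x => \sum_(i <- s) g i x).
Proof. by move=> mg; exact: measurable_sum. Qed.

Lemma vmeas_prod I (s : seq I) (g : I -> V -> R) : (forall i, vmeas (g i)) ->
  vmeas (fun x => \prod_(i <- s) g i x).
Proof.
move=> mg; elim: s => [|i s IHs].
  by under eq_fun do rewrite big_nil; exact: vmeas_cst.
by under eq_fun do rewrite big_cons; exact: vmeasM.
Qed.

Lemma vmeas_affine (A : 'M[R]_n) c g : vmeas g -> vmeas (fun x => g (A *m x + c)).
Proof.
move=> mg; apply: (@measurable_comp_col _ _ _ _ _ _ g (fun t => A *m col t + c)) => //.
by apply: measurable_affine_coord => i; exact: measurable_coord.
Qed.

Lemma vintegrable_affine (A : 'M[R]_n) c g : A \in unitmx -> vintegrable g ->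
  vintegrable (fun x => g (A *m x + c)).
Proof.
move=> uA ig; have mg := vintegrable_meas ig.
apply/integrableP; split; first by apply/measurable_EFinP; exact: vmeas_affine.
have /integrableP[_] := ig.
rewrite (@ge0_integral_leb_affine _ _ A c (fun x => `|g x|%:E))//=.
  by move=> foo; rewrite lte_mul_pinfty// lee_fin.
by apply/measurable_EFinP; apply: measurableT_comp.
Qed.

Lemma vint_affine (A : 'M[R]_n) c g : A \in unitmx -> vintegrable g ->
  vint (fun x => g (A *m x + c)) = `|\det A|^-1 * vint g.
Proof.
move=> uA ig; have mg := vintegrable_meas ig.
rewrite /vint /Rintegral integralE [in RHS]integralE.
pose gE := fun x : V => (g x)%:E.
have := @ge0_integral_leb_affine _ _ A c (gE^\+)%E uA.
have := @ge0_integral_leb_affine _ _ A c (gE^\-)%E uA.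
have mE : measurable_fun setT (gE \o @col_of_tuple R n) by apply/measurable_EFinP.
have -> : (gE^\+ \o col = (gE \o @col_of_tuple R n)^\+)%E by apply/funext => t; rewrite /= !funeposE.
have -> : (gE^\- \o col = (gE \o @col_of_tuple R n)^\-)%E by apply/funext => t; rewrite /= !funenegE.
move=> /(_ (measurable_funeneg mE) (fun x => funeneg_ge0 _ x)) hn.
move=> /(_ (measurable_funepos mE) (fun x => funepos_ge0 _ x)) hp.
have -> : (\int[leb R n]_x (fun x0 => (g (A *m col x0 + c))%:E)^\+ x =
  \int[leb R n]_t (gE^\+ (A *m col t + c)%R))%E by apply: eq_integral => t _; rewrite !funeposE.
have -> : (\int[leb R n]_x (fun x0 => (g (A *m col x0 + c))%:E)^\- x =
  \int[leb R n]_t (gE^\- (A *m col t + c)%R))%E by apply: eq_integral => t _; rewrite !funenegE.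
have -> : (\int[leb R n]_x (fun x0 => (g (col x0))%:E)^\+ x =
  \int[leb R n]_t (gE^\+ (col t)))%E by apply: eq_integral => t _; rewrite !funeposE.
have -> : (\int[leb R n]_x (fun x0 => (g (col x0))%:E)^\- x =
  \int[leb R n]_t (gE^\- (col t)))%E by apply: eq_integral => t _; rewrite !funenegE.
have fP : (\int[leb R n]_t (gE^\+ (col t)))%E \is a fin_num.
  have := integrable_pos_fin_num measurableT ig; congr (_ \is a fin_num).
  by apply: eq_integral => t _; rewrite !funeposE.
have fN : (\int[leb R n]_t (gE^\- (col t)))%E \is a fin_num.
  have := integrable_neg_fin_num measurableT ig; congr (_ \is a fin_num).
  by apply: eq_integral => t _; rewrite !funenegE.
rewrite hp hn.
by rewrite -(fineK fP) -(fineK fN) -!EFinM -!EFinB /= -mulrBr.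
Qed.

End vector_integral.

(** * Measurability of open sets and continuous functions of a column vector *)

Section vector_topology.
Context {R : realType} {n : nat}.
Local Notation V := 'cV[R]_n.
Local Notation col := (@col_of_tuple R n).
Local Notation mT := (measurableTypeR R).

Lemma coord_le_norm (x : V) i : `|x i 0| <= `|x|.
Proof.
rewrite [leRHS]/Num.norm/= mx_normrE.
by apply/bigmax_geP; right; exists (i, 0).
Qed.

Lemma norm_le_coord (x : V) (c : R) : 0 <= c -> (forall i, `|x i 0| <= c) -> `|x| <= c.
Proof.
move=> c0 xc; rewrite [leLHS]/Num.norm/= mx_normrE.
by apply/bigmax_leP; split => // -[i j] _ /=; rewrite ord1.
Qed.

(** An open set is the union of the sup-norm cubes with rational centre and radius [k.+1%:R^-1] that
    it contains. There are countably many, and each is a finite intersection of coordinate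
    conditions. *)
Lemma open_measurable_col (U : set V) : open U -> measurable (col @^-1` U).
Proof.
move=> oU.
pose box (z : n.-tuple rat * nat) : set V :=
  [set x | forall i, `|x i 0 - ratr (tnth z.1 i)| < z.2.+1%:R^-1].
pose B z : set (n.-tuple mT) :=
  if `[< box z `<=` U >] then col @^-1` (box z) else set0.
have -> : col @^-1` U = \bigcup_z B z.
  apply/seteqP; split => [t Ut|t [z _]]; last first.
    by rewrite /B; case: ifPn => // /asboolP; exact.
  have : nbhs (col t) U by apply: open_nbhs_nbhs.
  move=> /nbhs_ballP[e /= e0]; rewrite mx_norm_ball /ball_ => eU.
  (* Both [col t] and any other point of the cube are within [k.+1%:R^-1] of the centre, hence the
     half. *)
  have [k ke] : exists k : nat, k.+1%:R^-1 < e / 2.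
    have e20 : 0 < e / 2 by rewrite divr_gt0.
    exists (Num.truncn (e / 2)^-1).
    rewrite invf_plt ?posrE//; exact: truncnS_gt.
  have rP i : exists r : rat, `|col t i 0 - ratr r| < k.+1%:R^-1.
    have lt1 : col t i 0 - k.+1%:R^-1 < col t i 0 + k.+1%:R^-1.
      by rewrite ltrBlDr -addrA ltrDl addr_gt0.
    have [r] := rat_in_itvoo lt1.
    by rewrite in_itv/= => r12; exists r; rewrite distrC ltr_distl.
  have [r rt] := choice rP.
  exists ([tuple r i | i < n], k) => //.
  have tb : box ([tuple r i | i < n], k) (col t).
    by move=> i /=; rewrite tnth_mktuple.
  rewrite /B ifT//; apply/asboolP => y yb; apply: eU => /=.
  apply: (@le_lt_trans _ _ (k.+1%:R^-1 + k.+1%:R^-1)); last first.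
    by rewrite [ltRHS](splitr e) ltrD.
  apply: norm_le_coord; first by rewrite addr_ge0.
  move=> i; rewrite !mxE; have := tb i; have := yb i => /=.
  rewrite tnth_mktuple !mxE => h1 h2.
  have -> : tnth t i - y i 0 = (tnth t i - ratr (r i)) - (y i 0 - ratr (r i)) by ring.
  by rewrite (le_trans (ler_normB _ _))// lerD// ltW.
apply: countable_bigcupT_measurable; first exact: countableP.
move=> z; rewrite /B; case: ifPn => // _.
have -> : col @^-1` (box z) =
    \bigcap_(i in [set: 'I_n]) (fun t => `|col t i 0 - ratr (tnth z.1 i)|) @^-1` `]-oo, z.2.+1%:R^-1[.
  apply/seteqP; split => t /=.
    by move=> h i _ /=; rewrite in_itv/=; exact: h.
  by move=> h i; have := h i I; rewrite /= in_itv.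
apply: fin_bigcap_measurable => // i _.
rewrite -[X in measurable X]setTI.
have mf : measurable_fun setT (fun t : n.-tuple mT => `|col t i 0 - ratr (tnth z.1 i)|).
  by apply: measurableT_comp => //; apply: measurable_funB => //; exact: measurable_coord.
by apply: mf.
Qed.

Lemma continuous_vmeas (g : V -> R) : continuous g -> vmeas g.
Proof.
move=> /continuousP cg; apply: (measurability _ (RGenOpens.measurableE R)).
move=> _ [_ [a [b ->] <-]]; rewrite setTI.
apply: (@open_measurable_col (g @^-1` `]a, b[%classic)).
exact/cg/interval_open.
Qed.

End vector_topology.

(** * Euclidean and ellipsoidal norms *)

Section euclidean_norm.
Context {R : realType} {n : nat}.
Local Notation V := 'cV[R]_n.
Implicit Types x y z : V.

Lemma dotvC x y : dotv x y = dotv y x.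
Proof. by apply: eq_bigr => i _; rewrite mulrC. Qed.

Lemma dotvDl x y z : dotv (x + y) z = dotv x z + dotv y z.
Proof. by rewrite -big_split; apply: eq_bigr => i _; rewrite mxE mulrDl. Qed.

Lemma dotvDr x y z : dotv z (x + y) = dotv z x + dotv z y.
Proof. by rewrite dotvC dotvDl !(dotvC z). Qed.

Lemma dotvZl a x y : dotv (a *: x) y = a * dotv x y.
Proof. by rewrite /dotv mulr_sumr; apply: eq_bigr => i _; rewrite mxE mulrA. Qed.

Lemma dotvZr a x y : dotv x (a *: y) = a * dotv x y.
Proof. by rewrite dotvC dotvZl dotvC. Qed.

Lemma dotvNl x y : dotv (- x) y = - dotv x y.
Proof. by rewrite -scaleN1r dotvZl mulN1r. Qed.

Lemma dotvNr x y : dotv x (- y) = - dotv x y.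
Proof. by rewrite dotvC dotvNl dotvC. Qed.

Lemma dotv_delta x i : dotv x (delta_mx i 0) = x i 0.
Proof.
rewrite /dotv (bigD1 i)//= mxE !eqxx mulr1 big1 ?addr0// => j ji.
by rewrite mxE (negbTE ji) mulr0.
Qed.

Lemma dotv_mulmx (A : 'M[R]_n) x y : dotv (A *m x) y = dotv x (A^T *m y).
Proof.
rewrite /dotv; under eq_bigr do rewrite mxE mulr_suml.
rewrite exchange_big /=; apply: eq_bigr => j _.
rewrite mxE mulr_sumr; apply: eq_bigr => i _; rewrite mxE; ring.
Qed.

Lemma dotvv_ge0 x : 0 <= dotv x x.
Proof. by apply: sumr_ge0 => i _; rewrite -expr2 sqr_ge0. Qed.

Lemma dotvv_eq0 x : dotv x x = 0 -> x = 0.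
Proof.
move=> /eqP; rewrite psumr_eq0 => [/allP h|i _]; last by rewrite -expr2 sqr_ge0.
apply/matrixP => i j; rewrite ord1 mxE; apply/eqP.
by have := h i (mem_index_enum i); rewrite -expr2 sqrf_eq0.
Qed.

Lemma sqr_enorm x : enorm x ^+ 2 = dotv x x.
Proof. by rewrite /enorm sqr_sqrtr// dotvv_ge0. Qed.

Lemma enorm_ge0 x : 0 <= enorm x. Proof. exact: sqrtr_ge0. Qed.

Lemma enorm_eq0 x : enorm x = 0 -> x = 0.
Proof. by move=> x0; apply: dotvv_eq0; rewrite -sqr_enorm x0 expr0n. Qed.

Lemma dotv_CauchySchwarz x y : dotv x y ^+ 2 <= dotv x x * dotv y y.
Proof.
have [/dotvv_eq0 ->|y0] := eqVneq (dotv y y) 0.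
  by rewrite -(scale0r 0) !dotvZr !mul0r mulr0 expr0n.
have yy : 0 < dotv y y by rewrite lt_neqAle eq_sym y0 dotvv_ge0.
(* The squared length of this vector is [dotv y y] times the difference of the two sides. *)
have := dotvv_ge0 (dotv y y *: x - dotv x y *: y).
rewrite !(dotvDl, dotvDr, dotvNl, dotvNr, dotvZl, dotvZr) (dotvC y x).
set a := dotv x x; set b := dotv x y; move: yy; set c := dotv y y => c0 h.
rewrite -(ler_pM2l c0) -subr_ge0; apply: le_trans h _; rewrite le_eqVlt; apply/orP; left.
by apply/eqP; ring.
Qed.

Lemma dotv_le_enorm x y : `|dotv x y| <= enorm x * enorm y.
Proof.
rewrite -ler_sqr ?nnegrE ?mulr_ge0 ?enorm_ge0//.
by rewrite real_normK ?num_real// exprMn !sqr_enorm dotv_CauchySchwarz.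
Qed.

Lemma enormD x y : enorm (x + y) <= enorm x + enorm y.
Proof.
rewrite -ler_sqr ?nnegrE ?addr_ge0 ?enorm_ge0// sqrrD !sqr_enorm.
rewrite dotvDl !dotvDr (dotvC y x).
have := dotv_le_enorm x y; have := ler_norm (dotv x y); move: (enorm x * enorm y) => c.
rewrite mulr2n; lra.
Qed.

Lemma enormZ a x : enorm (a *: x) = `|a| * enorm x.
Proof. by rewrite /enorm dotvZl dotvZr mulrA -expr2 sqrtrM ?sqr_ge0// sqrtr_sqr. Qed.

Lemma enormN x : enorm (- x) = enorm x.
Proof. by rewrite -scaleN1r enormZ normrN1 mul1r. Qed.

Lemma norm_le_enorm x : `|x| <= enorm x.
Proof.
apply: norm_le_coord => [|i]; first exact: enorm_ge0.
rewrite -ler_sqr ?nnegrE ?enorm_ge0// real_normK ?num_real// sqr_enorm.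
rewrite /dotv (bigD1 i)//= -expr2 lerDl; apply: sumr_ge0 => j _.
by rewrite -expr2 sqr_ge0.
Qed.

Lemma enorm_le_norm x : enorm x <= n%:R * `|x|.
Proof.
rewrite -ler_sqr ?nnegrE ?enorm_ge0 ?mulr_ge0// sqr_enorm.
apply: (@le_trans _ _ (\sum_(i < n) `|x| ^+ 2)).
  apply: ler_sum => i _; rewrite -expr2 -real_normK ?num_real//.
  by rewrite lerXn2r ?nnegrE// coord_le_norm.
rewrite sumr_const card_ord exprMn -[leLHS]mulr_natl ler_wpM2r ?sqr_ge0//.
by case: n => [|m]; rewrite ?expr0n// expr2 ler_peMr// ler1n.
Qed.

(** A crude bound for the operator norm with respect to the sup norm. *)
Definition mx_bound m (A : 'M[R]_(m, n)) : R := \sum_i \sum_j `|A i j|.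

Lemma mx_bound_ge0 m (A : 'M[R]_(m, n)) : 0 <= mx_bound A.
Proof. by apply: sumr_ge0 => i _; apply: sumr_ge0. Qed.

End euclidean_norm.

Lemma norm_mulmx_le {R : realType} {m n : nat} (A : 'M[R]_(m, n)) (x : 'cV[R]_n) :
  `|A *m x| <= mx_bound A * `|x|.
Proof.
apply: norm_le_coord => [|i]; first by rewrite mulr_ge0// mx_bound_ge0.
rewrite mxE (le_trans (ler_norm_sum _ _ _))// /mx_bound (bigD1 i)//= mulrDl.
rewrite -[leLHS]addr0 lerD//; last first.
  by rewrite mulr_ge0//; apply: sumr_ge0 => k _; apply: sumr_ge0.
rewrite mulr_suml; apply: ler_sum => j _; rewrite normrM ler_wpM2l//.
exact: coord_le_norm.
Qed.

(** * The norm of an ellipsoid and its polynomial weights *)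

Section pnorm.
Context {R : realType} {n : nat}.
Variable P : 'M[R]_n.
Hypothesis uP : P \in unitmx.
Local Notation V := 'cV[R]_n.
Implicit Types x y : V.

(** The norm whose open unit ball is the ellipsoid: inclusions between dilates of the ellipsoid
    become inequalities. *)
Definition pnorm (x : V) : R := enorm (P *m x).
Local Notation q := pnorm.

Lemma pnorm_ge0 x : 0 <= q x. Proof. exact: enorm_ge0. Qed.

Lemma pnormD x y : q (x + y) <= q x + q y.
Proof. by rewrite /q mulmxDr enormD. Qed.

Lemma pnormZ a x : q (a *: x) = `|a| * q x.
Proof. by rewrite /q -scalemxAr enormZ. Qed.

Lemma pnormN x : q (- x) = q x.
Proof. by rewrite /q mulmxN enormN. Qed.

Lemma pnorm_le_norm : exists2 c : R, 0 < c & forall x, q x <= c * `|x|.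
Proof.
exists (n%:R * mx_bound P + 1).
  by rewrite ltr_wpDl// mulr_ge0// mx_bound_ge0.
move=> x; rewrite (le_trans (enorm_le_norm _))//.
rewrite mulrDl mul1r -[leLHS]addr0 lerD// -mulrA ler_wpM2l//.
exact: norm_mulmx_le.
Qed.

Lemma norm_le_pnorm : exists2 c : R, 0 < c & forall x, `|x| <= c * q x.
Proof.
exists (mx_bound (invmx P) + 1); first by rewrite ltr_wpDl// mx_bound_ge0.
move=> x; rewrite -[x in `|x|](mulKmx uP) (le_trans (norm_mulmx_le _ _))//.
rewrite mulrDl mul1r -[leLHS]addr0 lerD// ?enorm_ge0// ler_wpM2l// ?mx_bound_ge0//.
exact: norm_le_enorm.
Qed.

(** The constant is kept at least 1 so that its powers grow with the exponent. *)
Lemma pnorm_mulmx_le (A : 'M[R]_n) : exists2 c : R, 1 <= c & forall x, q (A *m x) <= c * q x.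
Proof.
have [c c0 hc] := pnorm_le_norm; have [d d0 hd] := norm_le_pnorm.
have h0 : 0 <= c * (mx_bound A * d) by rewrite !mulr_ge0 ?mx_bound_ge0 ?ltW.
exists (c * (mx_bound A * d) + 1); first by rewrite lerDr.
move=> x; rewrite (le_trans (hc _))// mulrDl mul1r -[leLHS]addr0 lerD// ?pnorm_ge0//.
rewrite -mulrA ler_wpM2l ?(ltW c0)// (le_trans (norm_mulmx_le _ _))//.
by rewrite -mulrA ler_wpM2l// mx_bound_ge0.
Qed.

Lemma vmeas_pnorm : vmeas q.
Proof.
apply: vmeas_comp.
  by apply: continuous_measurable_fun; exact: sqrt_continuous.
have mc i : vmeas (fun x => (P *m x) i 0).
  rewrite (_ : (fun x => _) = fun x : V => \sum_j P i j * x j 0).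
    by apply: vmeas_sum => j; apply: vmeasM; [exact: vmeas_cst|exact: vmeas_coord].
  by apply/funext => x; rewrite mxE.
by apply: vmeas_sum => i; apply: vmeasM.
Qed.

(** The common scale on which the decay of kernels, test functions and maximal functions is
    measured. *)
Definition wt (K : nat) x : R := (1 + q x) ^- K.

Lemma pnorm1_gt0 x : 0 < 1 + q x.
Proof. by rewrite ltr_pwDl// pnorm_ge0. Qed.

Lemma pnorm1_ge1 x : 1 <= 1 + q x.
Proof. by rewrite lerDl pnorm_ge0. Qed.

Lemma wt_gt0 K x : 0 < wt K x.
Proof. by rewrite invr_gt0 exprn_gt0// pnorm1_gt0. Qed.

Lemma wt_le1 K x : wt K x <= 1.
Proof. by rewrite invf_le1 ?exprn_gt0 ?pnorm1_gt0// exprn_ege1// pnorm1_ge1. Qed.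

Lemma wtD K L x : wt (K + L) x = wt K x * wt L x.
Proof. by rewrite /wt exprD invfM. Qed.

Lemma wt_anti K L x : (K <= L)%N -> wt L x <= wt K x.
Proof.
by move=> /subnK <-; rewrite wtD ler_piMl ?wt_le1 ?(ltW (wt_gt0 _ _)).
Qed.

(** Peetre's inequality: a weight follows a translation at the price of a polynomial factor in the
    shift. *)
Lemma wt_shift K x y : wt K (x + y) <= (1 + q y) ^+ K * wt K x.
Proof.
rewrite /wt ler_pdivlMr ?exprn_gt0 ?pnorm1_gt0// mulrC ler_pdivrMr ?exprn_gt0 ?pnorm1_gt0//.
rewrite -exprMn lerXn2r ?nnegrE ?mulr_ge0 ?(ltW (pnorm1_gt0 _))//.
have := pnormD (x + y) (- y); rewrite addrK pnormN => h.
rewrite mulrDl mul1r mulrDr mulr1 -addrA lerD2l.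
have := mulr_ge0 (pnorm_ge0 y) (pnorm_ge0 (x + y)).
lra.
Qed.

Lemma vmeas_wt K : vmeas (wt K).
Proof.
rewrite (_ : wt K = fun x => (fun r => r `^ (- K%:R)) (1 + q x)).
  apply: (@vmeas_comp _ _ (fun r => r `^ (- K%:R)) (fun x => 1 + q x)).
    exact: measurable_powR.
  by apply: vmeasD; [exact: vmeas_cst|exact: vmeas_pnorm].
by apply/funext => x; rewrite powRN powR_mulrn// ltW// pnorm1_gt0.
Qed.

End pnorm.

(** * Integrability of the weights *)

Section weight_integrable.
Context {R : realType}.
Local Notation mT := (measurableTypeR R).
Local Open Scope ereal_scope.

Let cauchy_dens (x : R) : R := ((oneDsqr x)^-1)%R.

Let cauchy_dens_ge0 x : (0 <= cauchy_dens x)%R.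
Proof. by rewrite invr_ge0. Qed.

Let measurable_cauchy_dens : measurable_fun setT cauchy_dens.
Proof. by apply: continuous_measurable_fun; exact: continuous_oneDsqrV. Qed.

Let integral_cauchy_dens : \int[@lebesgue_measure R]_x (cauchy_dens x)%:E < +oo.
Proof.
rewrite -(set_itvNyy R) (itv_bndbnd_setU (x := BLeft 0%R))//.
rewrite ge0_integral_setU//=; last 3 first.
- by apply/measurable_EFinP; exact: measurable_funTS.
- by move=> x _; rewrite lee_fin.
- rewrite disj_set2E; apply/eqP; rewrite -subset0 => x []/=.
  by rewrite !in_itv/= andbT ltNge => /negP.
have h : \int[@lebesgue_measure R]_(x in `[0%R, +oo[) (cauchy_dens x)%:E < +oo.
  by rewrite integral0y_oneDsqr ltry.
rewrite lte_add_pinfty//.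
rewrite (le_lt_trans _ h)//.
(* The density is even, so the negative half-line is reflected onto the positive one. *)
rewrite ge0_integration_by_substitution0//; last exact/measurable_EFinP.
have cN x : cauchy_dens (- x)%R = cauchy_dens x by rewrite /cauchy_dens /oneDsqr sqrrN.
under [leRHS]eq_integral do rewrite cN.
apply: ge0_subset_integral => //=.
- by apply/measurable_EFinP; exact: measurable_funTS.
- by move=> x _; rewrite lee_fin.
- by move=> x /=; rewrite !in_itv/=; exact: ltW.
Qed.

Lemma integral_prod_oneDsqrV_lty n :
  \int[leb R n]_t (\prod_(i < n) (oneDsqr (col_of_tuple t i 0%R))^-1)%:E < +oo.
Proof.
elim: n => [|n IHn].
  under eq_integral do rewrite big_ord0.
  rewrite [ltLHS](_ : _ = \int[\d_ ([tuple] : 0.-tuple mT)]_t 1%:E)//.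
  by rewrite integral_dirac//= diracT mul1e ltry.
have mp m : measurable_fun [set: m.-tuple mT]
    (fun t => (\prod_(i < m) (oneDsqr (col_of_tuple t i 0%R))^-1)%:E).
  apply/measurable_EFinP.
  apply: (@vmeas_prod _ _ _ _ (fun i (x : 'cV[R]_m) => ((oneDsqr (x i 0))^-1)%R)) => i.
  exact: (vmeas_comp measurable_cauchy_dens (vmeas_coord i)).
have p0 m (t : m.-tuple mT) : 0 <= (\prod_(i < m) (oneDsqr (col_of_tuple t i 0%R))^-1)%:E.
  by rewrite lee_fin; apply: prodr_ge0 => i _; exact: cauchy_dens_ge0.
rewrite ge0_integral_leb_succ//.
have -> : \int[@lebesgue_measure R]_x \int[leb R n]_t
    (\prod_(i < n.+1) (oneDsqr (col_of_tuple (tuple_cons (x, t)) i 0%R))^-1)%:E =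
  \int[@lebesgue_measure R]_x ((cauchy_dens x)%:E *
     \int[leb R n]_t (\prod_(i < n) (oneDsqr (col_of_tuple t i 0%R))^-1)%:E).
  apply: eq_integral => x _; rewrite -ge0_integralZl//.
    apply: eq_integral => t _; rewrite big_ord_recl -EFinM; congr (_ * _)%:E.
      by rewrite mxE.
    by apply: eq_bigr => i _; rewrite !mxE tnthS.
  - exact: mp.
  - by rewrite lee_fin.
have I0 : 0 <= \int[leb R n]_t (\prod_(i < n) (oneDsqr (col_of_tuple t i 0%R))^-1)%:E.
  by apply: integral_ge0.
rewrite -(fineK (x := \int[leb R n]_t _))//; last by rewrite ge0_fin_numE.
rewrite ge0_integralZr//.
- rewrite lte_mul_pinfty//; last by rewrite ltry.
    by apply: integral_ge0 => x _; rewrite lee_fin.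
  by rewrite ge0_fin_numE//; apply: integral_ge0 => x _; rewrite lee_fin.
- by apply/measurable_EFinP.
- by move=> x _; rewrite lee_fin.
- by rewrite lee_fin fine_ge0.
Qed.

Lemma vintegrable_prod_oneDsqrV n :
  vintegrable (fun x : 'cV[R]_n => \prod_(i < n) (oneDsqr (x i 0))^-1)%R.
Proof.
apply/integrableP; split.
  apply/measurable_EFinP; apply: vmeas_prod => i.
  exact: (vmeas_comp measurable_cauchy_dens (vmeas_coord i)).
rewrite (le_lt_trans _ (integral_prod_oneDsqrV_lty n))// le_eqVlt; apply/orP; left.
apply/eqP/eq_integral => t _ /=; rewrite ger0_norm//.
by apply: prodr_ge0 => i _; exact: cauchy_dens_ge0.
Qed.

Local Close Scope ereal_scope.

(** Comparison with a product of one-dimensional Cauchy densities: each factor costs two powers of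
    [1 + pnorm P x], which is where [2 * n] comes from. *)
Lemma vintegrable_wt n (P : 'M[R]_n) K : P \in unitmx -> (2 * n <= K)%N ->
  vintegrable (wt P K).
Proof.
move=> uP nK; have [c c0 hc] := norm_le_pnorm uP.
apply: vintegrable_le (vintegrableZ ((1 + c) ^+ (2 * n)) (vintegrable_prod_oneDsqrV n)) _.
  exact: vmeas_wt.
move=> x; rewrite ger0_norm ?(ltW (wt_gt0 _ _ _))// (le_trans (wt_anti _ _ nK))//.
have oneDsqr_gt0 (y : R) : 0 < oneDsqr y by rewrite (lt_le_trans ltr01)// oneDsqr_ge1.
rewrite prodfV ler_pdivlMr; last by apply: prodr_gt0 => i _; exact: oneDsqr_gt0.
rewrite mulrC ler_pdivrMr ?exprn_gt0 ?pnorm1_gt0// -exprMn exprM.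
apply: (@le_trans _ _ (\prod_(i < n) ((1 + c) * (1 + pnorm P x)) ^+ 2)); last first.
  by rewrite prodr_const card_ord.
apply: ler_prod => i _; rewrite ltW ?oneDsqr_gt0//= /oneDsqr.
have h1 : `|x i 0| <= c * pnorm P x by rewrite (le_trans (coord_le_norm _ _)).
apply: (@le_trans _ _ ((1 + `|x i 0|) ^+ 2)).
  rewrite sqrrD expr1n real_normK ?num_real// mul1r lerD2r lerDl.
  by rewrite mulrn_wge0.
have c1 : 0 <= 1 + c by rewrite addr_ge0// ltW.
rewrite lerXn2r ?nnegrE ?addr_ge0 ?mulr_ge0 ?c1 ?(ltW (pnorm1_gt0 _ _))//.
have := pnorm_ge0 P x; move: h1; set y := `|_|; set z := pnorm P x => h1 z0.
rewrite mulrDl !mul1r mulrDr mulr1; lra.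
Qed.

End weight_integrable.

(** * The sinc kernel *)

Section sinc.
Context {R : realType}.
Local Notation mu := (@lebesgue_measure R).
Implicit Types a y e t : R.

(* The value of the integral of [cos (t * y)] over [-e <= t <= e]. *)
Definition sinc e y : R := if y == 0 then 2 * e else 2 * sin (e * y) / y.

Let derive_sin_affine a y t : is_derive t 1 (fun t => sin (a + t * y)) (cos (a + t * y) * y).
Proof.
have -> : (fun t => sin (a + t * y)) = sin \o (fun t => a + t * y) by [].
apply: is_derive1_comp.
have h : is_derive t 1 (cst a + y \*: @id R) (0 + y *: 1).
  by apply: is_deriveD; apply: is_deriveZ.
move: h; rewrite add0r /GRing.scale/= mulr1; congr is_derive.
by apply/funext => x; rewrite /= mulrC.
Qed.

Lemma continuous_cos_affine a y : continuous (fun t : R => cos (a + t * y)).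
Proof.
move=> t; apply: (@continuous_comp _ _ _ (fun t => a + t * y) cos); last exact: continuous_cos.
by apply: cvgD; [exact: cvg_cst|apply: cvgM; [exact: cvg_id|exact: cvg_cst]].
Qed.

(** On a symmetric segment the odd part of [cos (a + t * y)] integrates to 0, which leaves [cos a]
    as a factor. *)
Lemma integral_cos_affine e a y : 0 < e ->
  (\int[mu]_(t in `[(- e)%R, e%R]) (cos (a + t * y))%:E = (cos a * sinc e y)%:E)%E.
Proof.
move=> e0; have ee : - e < e by rewrite gtrN.
rewrite /sinc; have [->|y0] := eqVneq y 0.
  under eq_integral do rewrite mulr0 addr0.
  rewrite integral_cst//= lebesgue_measure_itv/= lte_fin ee -EFinB -EFinM opprK.
  by congr EFin; ring.
have cF (t : R) : {for t, continuous (fun t => sin (a + t * y) / y)}.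
  apply: cvgM; last exact: cvg_cst.
  apply: (@continuous_comp _ _ _ (fun t => a + t * y) sin); last exact: continuous_sin.
  by apply: cvgD; [exact: cvg_cst|apply: cvgM; [exact: cvg_id|exact: cvg_cst]].
rewrite (@continuous_FTC2 _ _ (fun t => sin (a + t * y) / y))//.
- rewrite -EFinB; congr EFin; rewrite mulNr !sinD sinN cosN; field.
  exact: y0.
- by apply: continuous_subspaceT; exact: continuous_cos_affine.
- split.
  + by move=> t _; apply: derivableM; [apply: ex_derive|exact: derivable_cst].
  + by apply: cvg_at_right_filter; exact: cF.
  + by apply: cvg_at_left_filter; exact: cF.
- move=> t _; rewrite derive1E deriveM//.
  rewrite derive_cst scaler0 add0r (@derive_val _ _ _ _ _ _ _ (derive_sin_affine a y t)).
  by rewrite /GRing.scale /= mulrC -mulrA divff// mulr1.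
Qed.

Lemma Rintegral_cos_affine e a y : 0 < e ->
  \int[mu]_(t in `[- e, e]) cos (a + t * y) = cos a * sinc e y.
Proof. by move=> e0; rewrite /Rintegral integral_cos_affine. Qed.

(** Read off the integral representation with [a = 0], which treats [y = 0] and [y != 0]
    together. *)
Lemma sinc_norm_le2e e y : 0 < e -> `|sinc e y| <= 2 * e.
Proof.
move=> e0; have ee : - e < e by rewrite gtrN.
have ic : mu.-integrable `[- e, e] (EFin \o (fun t => cos (0 + t * y))).
  apply: continuous_compact_integrable; first exact: segment_compact.
  by apply: continuous_subspaceT; exact: continuous_cos_affine.
have fin1 : mu.-integrable `[- e, e] (EFin \o (fun=> 1)).
  apply: continuous_compact_integrable; first exact: segment_compact.
  by apply: continuous_subspaceT => x; exact: cvg_cst.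
have -> : 2 * e = \int[mu]_(t in `[- e, e]) 1.
  rewrite Rintegral_cst//= lebesgue_measure_itv/= lte_fin ee -EFinB/= opprK; ring.
rewrite -[sinc e y]mul1r -[X in X * sinc _ _]cos0 -Rintegral_cos_affine//.
apply: (le_trans (le_normr_Rintegral _ ic)) => //.
apply: le_Rintegral => //; last by move=> t _; exact: cos_max.
by have := integrable_norm ic.
Qed.

(** The bound [2 * e] accounts for the summand 1, and [2] bounds the product with [|y|]. *)
Lemma sinc_decay e y : 0 < e -> `|sinc e y| * (1 + `|y|) <= 2 * e + 2.
Proof.
move=> e0; rewrite mulrDr mulr1 lerD ?sinc_norm_le2e//.
rewrite /sinc; have [->|y0] := eqVneq y 0; first by rewrite normr0 mulr0.
rewrite normrM normfV mulfVK ?normr_eq0// normrM ger0_norm// -[leRHS]mulr1.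
by rewrite ler_wpM2l// sin_max.
Qed.

Lemma sinc_gt0 e y : 0 < e -> `|e * y| < pi -> 0 < sinc e y.
Proof.
move=> e0; rewrite /sinc; have [-> _|y0 ey] := eqVneq y 0; first by rewrite mulr_gt0.
have [yn|yp|/eqP] := ltrgtP y 0; last by rewrite (negbTE y0).
  have -> : 2 * sin (e * y) / y = 2 * sin (e * - y) / - y.
    by rewrite mulrN sinN; field.
  rewrite divr_gt0 ?oppr_gt0// mulr_gt0// sin_gt0_pi// mulr_gt0 ?oppr_gt0//=.
  by move: ey; rewrite mulrN normrM gtr0_norm// ltr0_norm// mulrN.
rewrite divr_gt0// mulr_gt0// sin_gt0_pi// mulr_gt0//=.
by move: ey; rewrite normrM !gtr0_norm.
Qed.

(** Continuity fails only at 0, where the inverse is 0 by convention, so that point is treated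
    apart. *)
Lemma measurable_inv : measurable_fun setT (@GRing.inv R).
Proof.
have m0 : measurable [set 0 : R] by exact: measurable_set1.
rewrite -(setvU [set 0 : R]); apply/measurable_funU => //; first exact: measurableC.
split; last exact: measurable_fun_set1.
apply: open_continuous_measurable_fun; first exact/closed_openC/closed_eq.
by move=> x; rewrite inE => /eqP; exact: inv_continuous.
Qed.

Lemma measurable_sinc e : measurable_fun setT (sinc e).
Proof.
apply: measurable_fun_ifT.
- by apply: measurable_fun_eqr => //; exact: measurable_cst.
- exact: measurable_cst.
- apply: measurable_funM.
    apply: measurable_funM; first exact: measurable_cst.
    apply: (@measurableT_comp _ _ _ _ _ _ (@sin R)).
      by apply: continuous_measurable_fun; exact: continuous_sin.
    by apply: measurable_funM => //; exact: measurable_cst.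
  exact: measurable_inv.
Qed.

End sinc.

Section sinc_multiplier.
Context {R : realType} {n : nat}.
Local Notation V := 'cV[R]_n.
Local Notation col := (@col_of_tuple R n).
Local Notation mT := (measurableTypeR R).
Local Notation mu := (@lebesgue_measure R).

(* Fubini: the integral of [F * cos a * sinc e y] is the average over
   [-e <= t <= e] of the integrals of [F * cos (a + t * y)]. *)
Lemma vint_sinc_eq0 (F a y : V -> R) (e : R) : 0 < e -> vintegrable F ->
  vmeas a -> vmeas y ->
  (forall t, - e <= t <= e -> vint (fun x => F x * cos (a x + t * y x)) = 0) ->
  vint (fun x => F x * (cos (a x) * sinc e (y x))) = 0.
Proof.
move=> e0 iF ma my h.
pose I : set mT := `[- e, e]%classic.
pose f (z : mT * n.-tuple mT) : R :=
  \1_I z.1 * (F (col z.2) * cos (a (col z.2) + z.1 * y (col z.2))).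
have m1 : measurable_fun setT (fun z : mT * n.-tuple mT => z.1 : R) by exact: measurable_fst.
have m2 (g : V -> R) : vmeas g -> measurable_fun setT (fun z : mT * n.-tuple mT => g (col z.2)).
  by move=> mg; apply: (measurableT_comp mg).
have mcos : measurable_fun setT (@cos R).
  by apply: continuous_measurable_fun; exact: continuous_cos.
have mIs : measurable I by exact: measurable_itv.
have mI : measurable_fun setT (\1_I : mT -> R) by apply: measurable_indic; exact: measurable_itv.
have mf : measurable_fun setT f.
  apply: measurable_funM; first exact: (measurableT_comp mI m1).
  apply: measurable_funM; first by apply: m2; exact: vintegrable_meas iF.
  apply: (measurableT_comp mcos).
  by apply: measurable_funD; [exact: m2|apply: measurable_funM => //; exact: m2].
have iFabs : (\int[leb R n]_t `|F (col t)|%:E < +oo)%E by have /integrableP[] := iF.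
have iI : (\int[mu]_t (\1_I t)%:E < +oo)%E.
  rewrite integral_indic// setIT.
  have h1 : (lebesgue_measure (`[(- e)%R, e%R]%classic : set R) < +oo)%E.
    by rewrite lebesgue_measure_itv/=; case: ifP; rewrite ?ltry.
  exact: h1.
(* The integrand is dominated by the indicator of [I] times [|F|], a product of integrable functions
   of separate variables. *)
have if_ : (mu \x leb R n)%E.-integrable setT (EFin \o f).
  apply/integrable12ltyP; first exact/measurable_EFinP.
  apply: (@le_lt_trans _ _ (\int[mu]_t ((\1_I t)%:E * \int[leb R n]_x `|F (col x)|%:E))%E).
    apply: ge0_le_integralT => t.
      by apply: integral_ge0 => x _.
    rewrite -ge0_integralZl//; last first.
      by apply/measurable_EFinP; apply: measurableT_comp => //; exact: vintegrable_meas.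
    apply: ge0_le_integralT => x //.
    rewrite -EFinM lee_fin /f normrM ger0_norm ?ler_wpM2l//.
    by rewrite normrM ler_piMr// cos_max.
  have I0 : (0 <= \int[leb R n]_x `|F (col x)|%:E)%E by exact: integral_ge0.
  rewrite ge0_integralZr//; last exact/measurable_EFinP.
  have J0 : (0 <= \int[mu]_x (\1_I x)%:E)%E by apply: integral_ge0 => t _; rewrite lee_fin.
  by apply: lte_mul_pinfty => //; rewrite ge0_fin_numE.
have /= := Fubini if_.
have -> : (\int[mu]_x \int[leb R n]_y0 (f (x, y0))%:E = 0)%E.
  apply: integral0_eq => t _; rewrite /f /=.
  under eq_integral do rewrite EFinM.
  have icos : vintegrable (fun x => F x * cos (a x + t * y x)).
    apply: (vintegrable_le _ (_ : vintegrable (fun x => `|F x|))).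
    - apply: vmeasM; first exact: vintegrable_meas.
      apply: (vmeas_comp mcos); apply: vmeasD => //; apply: vmeasM => //; exact: vmeas_cst.
    - exact: (integrable_norm iF).
    - by move=> x; rewrite normrM ler_piMr// cos_max.
  rewrite integralZl//.
  have [tI|tI] := boolP (t \in I); last by rewrite indicE (negbTE tI) mul0e.
  have te : - e <= t <= e by move: tI; rewrite inE /I/= in_itv.
  have := h t te; rewrite /vint /Rintegral => h0.
  have := integrable_fin_num measurableT icos => /fineK <-.
  by rewrite [X in (_ * X%:E)%E](h0 : fine _ = 0) mule0.
move=> /esym hG.
rewrite /vint /Rintegral -[RHS]/(fine 0%E) -hG; congr fine.
apply: eq_integral => x _; rewrite /f/=.
transitivity ((F (col x))%:E * \int[mu]_(t in I) (cos (a (col x) + t * y (col x)))%:E)%E.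
  by rewrite integral_cos_affine// -EFinM.
rewrite -integralZl//; last first.
  apply: continuous_compact_integrable; first exact: segment_compact.
  by apply: continuous_subspaceT; exact: continuous_cos_affine.
rewrite integral_mkcond; apply: eq_integral => t _.
rewrite patchE indicE; case: ifP => _; last by rewrite mul0r.
by rewrite mul1r EFinM.
Qed.

End sinc_multiplier.

(** * Partial derivatives and finite differences *)

Lemma continuous_epsP {R : realType} {n : nat} (f : 'cV[R]_n -> R) :
  continuous f <-> forall x e, 0 < e -> exists2 d, 0 < d & forall y, `|x - y| < d -> `|f x - f y| < e.
Proof.
split=> [cf x e e0|h x].
  have cfx : f y @[y --> x] --> f x by exact: cf.
  have /nbhs_ballP[d /= d0 hd] : \forall y \near x, `|f x - f y| < e.
    exact: (@cvgr_dist_lt _ _ _ _ _ _ _ cfx).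
  exists d => // y xy; apply: hd; by rewrite mx_norm_ball.
have FF := @nbhs_filter _ x.
apply/(@cvgrPdist_lt _ _ _ _ FF) => e e0.
have [d d0 hd] := h x e e0.
by apply/nbhs_ballP; exists d => // y; rewrite mx_norm_ball; exact: hd.
Qed.

Section partial_derivatives.
Context {R : realType} {n : nat}.
Local Notation V := 'cV[R]_n.
Local Notation e_ i := (delta_mx i 0 : V).
Implicit Types (f g : V -> R) (x w : V) (i j : 'I_n) (s : seq 'I_n).

Lemma smooth_foldr f s : smooth f -> smooth (foldr (@partial R n) f s).
Proof. by move=> sf s' /=; rewrite -foldr_cat; exact: sf. Qed.

Lemma smooth_continuous f : smooth f -> continuous f.
Proof. by move=> /(_ [::])[]. Qed.

Lemma smooth_derivable f i x : smooth f -> derivable f x (e_ i).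
Proof. by move=> /(_ [::])[]. Qed.

Lemma is_derive_line f i x (t : R) : derivable f (x + t *: e_ i) (e_ i) ->
  is_derive t 1 (fun t : R => f (x + t *: e_ i)) (partial i f (x + t *: e_ i)).
Proof.
have E : (fun h : R => h^-1 *: (f (x + (h *: (1 : R) + t) *: e_ i) - f (x + t *: e_ i))) =
         (fun h : R => h^-1 *: (f (h *: e_ i + (x + t *: e_ i)) - f (x + t *: e_ i))).
  apply/funext => h; congr (_ *: (f _ - _)).
  by rewrite (_ : h *: (1 : R) = h) ?scalerDl 1?addrCA// /GRing.scale/= mulr1.
move=> df; apply: DeriveDef.
  by rewrite /derivable E.
by rewrite /partial /derive E.
Qed.

(** The one-dimensional theorem on a coordinate line, for [h] of either sign; it asks only for
    partial derivatives, which is the form in which [smooth] supplies differentiability. *)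
Lemma partial_MVT f i x (h : R) : (forall y, derivable f y (e_ i)) ->
  exists2 c, `|c| <= `|h| & f (x + h *: e_ i) - f x = h * partial i f (x + c *: e_ i).
Proof.
move=> df.
have dl (t : R) : is_derive t 1 (fun t : R => f (x + t *: e_ i)) (partial i f (x + t *: e_ i)).
  exact: is_derive_line.
have cl : continuous (fun t : R => f (x + t *: e_ i)).
  by move=> t; have [dt _] := dl t; apply/differentiable_continuous/derivable1_diffP.
have f0 : f x = f (x + 0 *: e_ i) by rewrite scale0r addr0.
have [h0|h0] := leP 0 h.
  have [c] := MVT_segment h0 (fun t _ => dl t) (continuous_subspaceT cl).
  rewrite in_itv/= subr0 => /andP[c0 ch] fE; exists c; first by rewrite !ger0_norm// (le_trans c0).
  by rewrite mulrC -fE f0.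
have [c] := MVT_segment (ltW h0) (fun t _ => dl t) (continuous_subspaceT cl).
rewrite in_itv/= sub0r => /andP[ch c0] fE; exists c.
  by rewrite !ler0_norm ?lerN2// ltW.
by rewrite mulrC -[RHS]opprK -mulrN -fE f0 opprB.
Qed.

Definition fdiff w f x : R := f (x + w) - f x.

Lemma derivable_shift f w i x : derivable f (x + w) (e_ i) ->
  derivable (fun x => f (x + w)) x (e_ i) /\
  partial i (fun x => f (x + w)) x = partial i f (x + w).
Proof.
have E : (fun h : R => h^-1 *: (f (h *: e_ i + x + w) - f (x + w))) =
         (fun h : R => h^-1 *: (f (h *: e_ i + (x + w)) - f (x + w))).
  by apply/funext => h; rewrite addrA.
by move=> df; rewrite /derivable /partial /derive E.
Qed.

Lemma derivable_fdiff f w i x : (forall y, derivable f y (e_ i)) ->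
  derivable (fdiff w f) x (e_ i) /\ partial i (fdiff w f) x = fdiff w (partial i f) x.
Proof.
move=> df; have [dfw pfw] := @derivable_shift f w i x (df _).
split; first exact: derivableB.
by rewrite /partial deriveB// -/(partial i (fun x => f (x + w)) x) pfw.
Qed.

Lemma foldr_partial_fdiff f w s : smooth f ->
  foldr (@partial R n) (fdiff w f) s = fdiff w (foldr (@partial R n) f s).
Proof.
move=> sf; elim: s => //= i s ->; apply/funext => x.
by have [] := @derivable_fdiff (foldr (@partial R n) f s) w i x (fun y => (sf s).2 i y).
Qed.

Lemma continuous_fdiff f w : continuous f -> continuous (fdiff w f).
Proof.
move=> /continuous_epsP cf; apply/continuous_epsP => x e e0.
have e2 : 0 < e / 2 by rewrite divr_gt0.
have [d d0 hd] := cf (x + w) _ e2; have [d' d'0 hd'] := cf x _ e2.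
exists (Num.min d d'); first by rewrite lt_min d0.
move=> y; rewrite lt_min => /andP[xy xy'].
rewrite (_ : _ - _ = (f (x + w) - f (y + w)) - (f x - f y)); last by rewrite /fdiff; ring.
rewrite (le_lt_trans (ler_normB _ _))// [ltRHS]splitr ltrD ?hd'// hd//.
by rewrite opprD addrACA subrr addr0.
Qed.

Lemma smooth_fdiff f w : smooth f -> smooth (fdiff w f).
Proof.
move=> sf s /=; rewrite foldr_partial_fdiff//; have [cf df] := sf s.
split=> [|i x]; first exact: continuous_fdiff.
by have [] := @derivable_fdiff (foldr (@partial R n) f s) w i x (df i).
Qed.

(** The mean value theorem is applied once in each direction. The left-hand side is symmetric in [i]
    and [j], which is what [partialC] exploits. *)
Let second_difference f i j x (h : R) : smooth f -> 0 < h ->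
  exists2 p, `|p - x| <= h + h &
    fdiff (h *: e_ j) f (x + h *: e_ i) - fdiff (h *: e_ j) f x =
    h * (h * partial j (partial i f) p).
Proof.
move=> sf h0.
have [c ch ->] := @partial_MVT (fdiff (h *: e_ j) f) i x h
  (fun y => smooth_derivable (smooth_fdiff (h *: e_ j) sf)).
have [_ ->] := @derivable_fdiff f (h *: e_ j) i (x + c *: e_ i) (fun y => smooth_derivable sf).
have [d dh] := @partial_MVT (partial i f) j (x + c *: e_ i) h
  (fun y => smooth_derivable (@smooth_foldr f [:: i] sf)).
rewrite /fdiff => ->.
exists (x + c *: e_ i + d *: e_ j) => //.
have -> : x + c *: e_ i + d *: e_ j - x = c *: e_ i + d *: e_ j.
  by rewrite addrC addrA addrA addNr add0r.
have e1 k : `|e_ k| <= 1.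
  apply: norm_le_coord => // l; rewrite mxE eqxx andbT.
  by case: eqP => _; rewrite ?normr1 ?normr0.
rewrite (le_trans (ler_normD _ _))// !normrZ lerD//.
  by rewrite -[leRHS]mulr1 ler_pM// (le_trans ch)// gtr0_norm.
by rewrite -[leRHS]mulr1 ler_pM// (le_trans dh)// gtr0_norm.
Qed.

(** If the mixed derivatives differed at [x], continuity would keep them apart nearby; but one
    second difference equals [h * h] times each of them at points close to [x]. *)
Lemma partialC f i j : smooth f -> partial i (partial j f) = partial j (partial i f).
Proof.
have tri (u v w : R) : `|u - v| <= `|v - w| + `|u - w|.
  by rewrite (distrC v) [leRHS]addrC; exact: ler_distD.
have third (e : R) : 0 < e -> e / 3 + e / 3 < e by move=> e0; lra.
move=> sf; apply/funext => x; apply/eqP; rewrite -subr_eq0; apply: contraT => ab0.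
set a := partial i (partial j f) x in ab0; set b := partial j (partial i f) x in ab0.
have e0 : 0 < `|a - b| / 2 by rewrite divr_gt0// normr_gt0.
have [ca _] := sf [:: i; j]; have [cb _] := sf [:: j; i].
have /continuous_epsP/(_ x _ e0)[ea ea0 ha] := ca.
have /continuous_epsP/(_ x _ e0)[eb eb0 hb] := cb.
(* Both intermediate points lie within [h + h] of [x], which therefore has to be below both moduli
   of continuity. *)
have [h h0 [hea heb]] : exists2 h, 0 < h & h + h < ea /\ h + h < eb.
  have m0 : 0 < Num.min ea eb by rewrite lt_min ea0.
  exists (Num.min ea eb / 3); first by rewrite divr_gt0.
  by split; apply: (lt_le_trans (third _ m0)); rewrite ge_min lexx ?orbT.
have [p ph Ep] := second_difference i j x sf h0.
have [p' ph' Ep'] := second_difference j i x sf h0.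
have E : partial j (partial i f) p = partial i (partial j f) p'.
  have hn : h != 0 by rewrite gt_eqF.
  apply: (mulfI hn); apply: (mulfI hn); apply: (etrans (esym Ep)); apply: (etrans _ Ep').
  by rewrite /fdiff [x + h *: e_ j + _]addrAC opprB addrACA [- f _ + _]addrC -addrACA opprB.
have h1 : `|b - partial j (partial i f) p| < `|a - b| / 2.
  by apply: hb; rewrite distrC (le_lt_trans ph).
have h2 : `|a - partial i (partial j f) p'| < `|a - b| / 2.
  by apply: ha; rewrite distrC (le_lt_trans ph').
have := ltrD h1 h2; rewrite -splitr => h3.
have : `|a - b| < `|a - b|.
  apply: le_lt_trans h3; rewrite -/a -/b E.
  exact: tri.
by rewrite ltxx.
Qed.

Lemma foldr_partial_cons f i s1 s2 : smooth f ->
  foldr (@partial R n) f (s1 ++ i :: s2) = foldr (@partial R n) f (i :: s1 ++ s2).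
Proof.
move=> sf; elim: s1 => //= j s1 ->; rewrite /= partialC//.
exact: smooth_foldr.
Qed.

(** [real_deriv] differentiates in the fixed order of [enum], while iterated differences produce
    derivatives in any order. *)
Lemma foldr_partial_perm f s t : smooth f -> perm_eq s t ->
  foldr (@partial R n) f s = foldr (@partial R n) f t.
Proof.
move=> sf; elim: s t => [|i s IHs] t.
  by move=> /perm_size /esym/size0nil ->.
move=> st; have it : i \in t by rewrite -(perm_mem st) mem_head.
move: st; case/splitPr: it => t1 t2 st.
rewrite foldr_partial_cons//= (IHs (t1 ++ t2))//.
by rewrite -(perm_cons i) (perm_trans st)// -cat1s perm_catCA.
Qed.

Definition mi_of_seq s : multi_index n := [ffun i => count_mem i s].

Lemma mi_deg_of_seq s : mi_deg (mi_of_seq s) = size s.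
Proof.
rewrite /mi_deg; under eq_bigr do rewrite ffunE.
elim: s => [|j s IHs] /=; first by rewrite big1.
rewrite big_split /= IHs -[RHS]add1n; congr addn.
by rewrite (bigD1 j)//= eqxx big1// => k kj; rewrite eq_sym (negbTE kj).
Qed.

Lemma real_derivE (a : multi_index n) f :
  real_deriv a f = foldr (@partial R n) f (flatten [seq nseq (a i) i | i <- enum 'I_n]).
Proof.
rewrite /real_deriv; elim: (enum 'I_n) => //= i s ->.
rewrite foldr_cat; elim: (a i) => //= k IHk.
by rewrite IHk.
Qed.

Lemma real_deriv_mi_of_seq f s : smooth f ->
  real_deriv (mi_of_seq s) f = foldr (@partial R n) f s.
Proof.
move=> sf; rewrite real_derivE; apply: foldr_partial_perm => //.
apply/allP => i _ /=; apply/eqP; rewrite count_flatten -map_comp.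
have E (t : seq 'I_n) : uniq t ->
    sumn (map (count_mem i \o (fun k => nseq (mi_of_seq s k) k)) t) = ((i \in t) * count_mem i s)%N.
  elim: t => //= k t IHt /andP[kt ut]; rewrite IHt// count_nseq ffunE in_cons /=.
  have [ki|ki] := eqVneq k i; first by rewrite -ki (negbTE kt) /= mul1n mul0n addn0.
  by rewrite mul0n.
by rewrite E ?enum_uniq// mem_enum mul1n.
Qed.

Section finite_difference_bound.
Variables (G : V -> R) (w : V) (kappa : R).
Hypothesis kappa_ge0 : 0 <= kappa.
Hypothesis G_shift : forall x (z : V), (forall i, `|z i 0| <= `|w|) -> G (x + z) <= kappa * G x.

(** Walk from [x] to [x + w] one coordinate at a time: [W s] is the part of [w] carried by [s], and
    [G_shift] compares [G] at the intermediate points with [G x]. *)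
Lemma fdiff_le f (M : R) x : (forall i y, derivable f y (e_ i)) -> 0 <= M ->
  (forall i y, `|partial i f y| <= M * G y) ->
  `|fdiff w f x| <= (n%:R * `|w| * kappa) * (M * G x).
Proof.
move=> df M0 hM.
pose W (s : seq 'I_n) : V := \col_i (if i \in s then w i 0 else 0).
have WE : w = W (enum 'I_n).
  by apply/matrixP => i j; rewrite mxE mem_enum ord1.
have H (s : seq 'I_n) : uniq s ->
    `|f (x + W s) - f x| <= ((size s)%:R * `|w| * kappa) * (M * G x).
  elim: s => [_|i s IHs /= /andP[is_ us]].
    have -> : W [::] = 0 by apply/matrixP => i j; rewrite !mxE.
    by rewrite addr0 subrr normr0 !mul0r.
  have WS : x + W (i :: s) = x + W s + w i 0 *: e_ i.
    rewrite -addrA; congr (_ + _); apply/matrixP => k l; rewrite !mxE in_cons (ord1 l) eqxx andbT.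
    have [->|ki] := eqVneq k i; first by rewrite (negbTE is_) add0r mulr1.
    by rewrite mulr0 addr0.
  have [c cw E] := @partial_MVT f i (x + W s) (w i 0) (df i).
  rewrite WS (_ : f _ - f x = (f (x + W s + w i 0 *: e_ i) - f (x + W s)) + (f (x + W s) - f x)); last by ring.
  rewrite -[(size s).+1]addn1 natrD 3!mulrDl [leRHS]addrC (le_trans (ler_normD _ _))// lerD ?IHs//.
  rewrite E normrM mul1r -!mulrA ler_pM// ?coord_le_norm//.
  rewrite (le_trans (hM _ _))// mulrCA ler_wpM2l// -addrA G_shift// => k.
  rewrite !mxE eqxx andbT; have [->|ki] := eqVneq k i.
    by rewrite (negbTE is_) add0r mulr1 (le_trans cw)// coord_le_norm.
  rewrite mulr0 addr0; case: ifP => _; first exact: coord_le_norm.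
  by rewrite normr0.
by have := H _ (enum_uniq 'I_n); rewrite -WE size_enum_ord.
Qed.

(** Differences commute with derivatives, so each difference trades one derivative for a factor
    proportional to [|w|]. *)
Lemma iter_fdiff_le m f (M : R) x : smooth f -> 0 <= M ->
  (forall s, size s = m -> forall y, `|foldr (@partial R n) f s y| <= M * G y) ->
  `|iter m (fdiff w) f x| <= (n%:R * `|w| * kappa) ^+ m * (M * G x).
Proof.
elim: m f M x => [|m IHm] f M x sf M0 hM.
  by rewrite expr0 mul1r; exact: (hM [::]).
have c0 : 0 <= n%:R * `|w| * kappa by rewrite !mulr_ge0.
set B := (n%:R * _ * _) in c0 *.
rewrite iterSr exprSr -mulrA (mulrA B); apply: IHm.
- exact: smooth_fdiff.
- by rewrite mulr_ge0.
move=> s sm y; rewrite foldr_partial_fdiff// -(mulrA B).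
apply: fdiff_le => //; first exact: (sf s).2.
by move=> i z; apply: (hM (i :: s)); rewrite /= sm.
Qed.

End finite_difference_bound.

End partial_derivatives.

(** * Anisotropic quasi-norm and test functions *)

Section powers.
Context {R : realType}.

Lemma expr_ge_bernoulli (t : R) l : 1 <= t -> 1 + l%:R * (t - 1) <= t ^+ l.
Proof.
move=> t1; elim: l => [|l IHl]; first by rewrite mul0r addr0 expr0.
rewrite exprS -[l.+1]addn1 natrD mulrDl mul1r.
apply: (@le_trans _ _ (t * (1 + l%:R * (t - 1)))); last by rewrite ler_pM2l// (lt_le_trans ltr01).
have : 0 <= l%:R * (t - 1) * (t - 1) by rewrite !mulr_ge0 ?subr_ge0.
move: (l%:R * (t - 1)) => c c0; rewrite -subr_ge0; apply: le_trans c0 _.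
by rewrite le_eqVlt; apply/orP; left; apply/eqP; ring.
Qed.

Lemma expr_unbounded (t c : R) : 1 < t -> exists l, c <= t ^+ l.
Proof.
move=> t1; have d0 : 0 < t - 1 by rewrite subr_gt0.
exists (Num.truncn (c / (t - 1))).+1.
apply: le_trans (expr_ge_bernoulli _ (ltW t1)).
rewrite ler_wpDl// -ler_pdivrMr// ltW//; exact: truncnS_gt.
Qed.

End powers.

Section anisotropic_geometry.
Context {R : realType} {n : nat}.
Local Notation V := 'cV[R]_n.+1.
Variables (A P : 'M[R]_n.+1) (t Lam : R).
Hypothesis uP : P \in unitmx.
Hypothesis uA : A \in unitmx.
Local Notation q := (pnorm P).
Hypothesis t1 : 1 < t.
Hypothesis qA : forall x, t * q x <= q (A *m x).
Hypothesis Lam1 : 1 <= Lam.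
Hypothesis qAle : forall x, q (A *m x) <= Lam * q x.

Lemma expz_mulK (k : int) (x : V) : A ^ (- k) *m (A ^ k *m x) = x.
Proof.
have uk : A ^ k \is a GRing.unit by rewrite unitrXz// unitmxE -unitmxE.
rewrite mulmxA -[X in X *m x]/(A ^ (- k) * A ^ k).
by rewrite -invr_expz mulVr// mul1mx.
Qed.

Lemma expz_mulKV (k : int) (x : V) : A ^ k *m (A ^ (- k) *m x) = x.
Proof. by rewrite -{1}(opprK k) expz_mulK. Qed.

Lemma unitmx_expz (k : int) : A ^ k \in unitmx.
Proof. exact: (unitrXz k (uA : A \is a GRing.unit)). Qed.

Lemma det_expz (k : int) : `|\det (A ^ k)| = `|\det A| ^ k.
Proof.
have h (l : nat) : \det (A ^+ l) = \det A ^+ l.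
  by elim: l => [|l IHl]; rewrite ?expr0 ?det1// !exprS det_mulmx IHl.
case: k => l; first by rewrite h normrX.
by rewrite NegzE -invr_expz [X in \det X]/(invmx _) det_inv h normfV normrX.
Qed.

Lemma pnorm_expn_ge (l : nat) x : t ^+ l * q x <= q (A ^ (l%:Z) *m x).
Proof.
elim: l => [|l IHl]; first by rewrite mul1r mul1mx.
have -> : A ^ (l.+1%:Z) = A *m A ^ (l%:Z) by exact: exprS.
rewrite -mulmxA exprS -mulrA (le_trans _ (qA _))// ler_pM2l//.
exact: lt_trans ltr01 t1.
Qed.

Lemma pnorm_expn_le (l : nat) x : q (A ^ (l%:Z) *m x) <= Lam ^+ l * q x.
Proof.
elim: l => [|l IHl]; first by rewrite mul1r mul1mx.
have -> : A ^ (l.+1%:Z) = A *m A ^ (l%:Z) by exact: exprS.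
rewrite -mulmxA exprS -mulrA (le_trans (qAle _))// ler_pM2l//.
exact: lt_le_trans ltr01 Lam1.
Qed.

Let tl0 (l : nat) : 0 < t ^+ l.
Proof. by rewrite exprn_gt0// (lt_trans ltr01). Qed.

Lemma pnorm_expNn_le (l : nat) x : q (A ^ (- l%:Z) *m x) <= (t ^+ l)^-1 * q x.
Proof.
rewrite ler_pdivlMl//; apply: (le_trans (pnorm_expn_ge _ _)).
by rewrite expz_mulKV.
Qed.

Lemma pnorm_expn_ge1 (l : nat) x : q x <= q (A ^ (l%:Z) *m x).
Proof.
apply: le_trans (pnorm_expn_ge l x); rewrite ler_peMl ?pnorm_ge0// exprn_ege1//.
exact: ltW.
Qed.

Lemma pnorm_le_expNn (l : nat) x : q x <= Lam ^+ l * q (A ^ (- l%:Z) *m x).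
Proof. by rewrite -{1}(expz_mulKV l%:Z x) pnorm_expn_le. Qed.

Local Notation Dl := [set x : V | enorm (P *m x) < 1].

Lemma dilateP (k : int) x : dilate A Dl k x <-> q (A ^ (- k) *m x) < 1.
Proof.
split=> [[y /= y1 <-]|x1]; first by rewrite expz_mulK.
by exists (A ^ (- k) *m x) => //; rewrite expz_mulKV.
Qed.

Lemma rho_index (x : V) : x != 0 ->
  exists2 k : int, rho A Dl x = bdet A ^ k &
    q (A ^ (- (k + 1)) *m x) < 1 /\ 1 <= q (A ^ (- k) *m x).
Proof.
move=> x0; rewrite /rho (negbTE x0).
set S := (X in xget _ X).
suff [k Sk] : exists k, S k.
  have [|h1 h2] := xgetPex 0 (P := S); first by exists k.
  exists (xget 0 S) => //; split; first exact/dilateP.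
  by rewrite leNgt; apply/negP => /dilateP.
have qx0 : 0 < q x.
  rewrite lt_neqAle pnorm_ge0 andbT eq_sym; apply: contra_neq x0 => /enorm_eq0 Px.
  by rewrite -(mulKmx uP x) Px mulmx0.
have [l tl] := expr_unbounded (q x)^-1 t1.
have [l' tl'] := expr_unbounded (q x + 1) t1.
(* [Q m] says that [x] lies in the dilate of index [m - l]. The offset [l] is large enough for [Q 0]
   to fail, so the least [m] is a successor and the dilate just below misses [x]. *)
pose Q (m : nat) := q (A ^ (- (m%:Z - l%:Z)) *m x) < 1.
have exQ : exists m, Q m.
  exists (l + l')%N; rewrite /Q PoszD addrC addKr.
  rewrite (le_lt_trans (pnorm_expNn_le _ _))// ltr_pdivrMl// mulr1.
  by rewrite (lt_le_trans _ tl')// ltrDl.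
case: (ex_minnP exQ) => -[|m] Qm minQ.
  move: Qm; rewrite /Q sub0r opprK => /(le_lt_trans (pnorm_expn_ge _ _)).
  by rewrite ltNge -ler_pdivrMr// mul1r tl.
exists (m%:Z - l%:Z); split; apply/dilateP.
  by rewrite (_ : m%:Z - l%:Z + 1 = m.+1%:Z - l%:Z)// -[in RHS]addn1 PoszD addrAC.
by move=> /minQ; rewrite ltnn.
Qed.

Variable b : R.
Hypothesis bE : b = bdet A.
Hypothesis b1 : 1 < b.

Let b0 : 0 < b. Proof. exact: lt_trans ltr01 b1. Qed.

(** On the shell of index [l >= 0], [q x <= Lam ^+ l.+1] while [rho] is [b ^ l]; the hypothesis
    compares the powers and the extra [Lam] goes into the constant. On shells of negative index
    [q x <= 1]. *)
Lemma pow_pnorm_le_rho K N : Lam ^+ K <= b ^+ N ->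
  forall x, (1 + q x) ^+ K <= (2 * Lam) ^+ K * Num.max 1 (rho A Dl x ^+ N).
Proof.
move=> LN x; have Lam0 : 0 < Lam by exact: lt_le_trans ltr01 Lam1.
have C1 : 2 ^+ K <= (2 * Lam) ^+ K.
  by rewrite lerXn2r ?nnegrE ?mulr_ge0 ?(ltW Lam0)// ler_peMr.
have small : q x <= 1 -> (1 + q x) ^+ K <= (2 * Lam) ^+ K * Num.max 1 (rho A Dl x ^+ N).
  move=> qx1; apply: (@le_trans _ _ (2 ^+ K)).
    by rewrite lerXn2r ?nnegrE// ?(ltW (pnorm1_gt0 _ _))//; lra.
  rewrite (le_trans C1)// ler_peMr ?exprn_ge0 ?mulr_ge0 ?(ltW Lam0)//.
  by rewrite le_max lexx.
have [x0|x0] := eqVneq x 0.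
  by apply: small; rewrite x0 /pnorm mulmx0 -(scale0r 0) enormZ normr0 mul0r.
have [k rk [k1 k2]] := rho_index x0.
case: k rk k1 k2 => l rk k1 k2.
  have qx : q x <= Lam ^+ l.+1.
    rewrite (le_trans (pnorm_le_expNn l.+1 x))// ler_piMr ?exprn_ge0 ?(ltW Lam0)//.
    by move: k1; rewrite (_ : l%:Z + 1 = l.+1%:Z) ?intS 1?addrC//; exact: ltW.
  apply: (@le_trans _ _ ((2 * Lam ^+ l.+1) ^+ K)).
    rewrite lerXn2r ?nnegrE ?mulr_ge0 ?exprn_ge0 ?(ltW Lam0) ?(ltW (pnorm1_gt0 _ _))//.
    have : 1 <= Lam ^+ l.+1 by rewrite exprn_ege1.
    move: (Lam ^+ l.+1) qx => y; lra.
  apply: (@le_trans _ _ ((2 * Lam) ^+ K * rho A Dl x ^+ N)); last first.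
    by rewrite ler_wpM2l ?exprn_ge0 ?mulr_ge0 ?(ltW Lam0)// le_max lexx orbT.
  rewrite exprS mulrA exprMn ler_wpM2l ?exprn_ge0 ?mulr_ge0 ?(ltW Lam0)//.
  rewrite rk -bE -[b ^ l]/(b ^+ l) -!exprM ![(l * _)%N]mulnC !exprM.
  by rewrite lerXn2r ?nnegrE ?exprn_ge0 ?(ltW Lam0) ?(ltW b0).
apply: small; apply: (le_trans (pnorm_expn_ge1 l x)).
rewrite ltW//; move: k1; rewrite NegzE.
by have -> : - (- l.+1%:Z + 1) = l%:Z by rewrite -addn1 PoszD opprD opprK addrK.
Qed.

(** The reverse comparison uses the lower growth rate [t]; it serves to place Gaussians in the test
    class. *)
Lemma rho_le_pow_pnorm K N : b ^+ N <= t ^+ K ->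
  forall x, Num.max 1 (rho A Dl x ^+ N) <= (1 + q x) ^+ K.
Proof.
move=> bt x; have h1 : 1 <= (1 + q x) ^+ K by rewrite exprn_ege1// pnorm1_ge1.
rewrite ge_max h1 /=.
have [x0|x0] := eqVneq x 0.
  apply: le_trans h1; rewrite /rho x0 eqxx.
  by case: N {bt} => [|N]; rewrite ?expr0// expr0n.
have [k rk [k1 k2]] := rho_index x0.
case: k rk k1 k2 => l rk k1 k2.
  have qx : t ^+ l <= q x.
    have := le_trans k2 (pnorm_expNn_le l x).
    by rewrite ler_pdivlMl// mulr1.
  rewrite rk -bE -[b ^ l]/(b ^+ l) -exprM mulnC exprM.
  apply: (@le_trans _ _ ((t ^+ K) ^+ l)).
    by rewrite lerXn2r ?nnegrE ?exprn_ge0 ?(ltW b0) ?(ltW (lt_trans ltr01 t1)).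
  rewrite -exprM mulnC exprM lerXn2r ?nnegrE ?(ltW (pnorm1_gt0 _ _)) ?(ltW (tl0 _))//.
  by rewrite (le_trans qx)// lerDr.
apply: le_trans h1; rewrite rk -bE NegzE.
have bl : b ^ (- l.+1%:Z) = (b ^+ l.+1)^-1 by rewrite -invr_expz.
rewrite bl exprVn invf_le1 ?exprn_gt0//.
by rewrite exprn_ege1// exprn_ege1// ltW.
Qed.

Lemma abs_Re_le (z : R[i]) : `|complex.Re z| <= ComplexField.Normc.normc z.
Proof.
case: z => u v /=; rewrite -sqrtr_sqr ler_sqrt ?addr_ge0 ?sqr_ge0//.
by rewrite lerDl sqr_ge0.
Qed.

Lemma abs_Im_le (z : R[i]) : `|complex.Im z| <= ComplexField.Normc.normc z.
Proof.
case: z => u v /=; rewrite -sqrtr_sqr ler_sqrt ?addr_ge0 ?sqr_ge0//.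
by rewrite lerDr sqr_ge0.
Qed.

Lemma normc_le (z : R[i]) : ComplexField.Normc.normc z <= `|complex.Re z| + `|complex.Im z|.
Proof.
case: z => u v /=; rewrite -ler_sqr ?nnegrE ?addr_ge0 ?sqrtr_ge0//.
rewrite sqr_sqrtr ?addr_ge0 ?sqr_ge0// sqrrD !real_normK ?num_real// -addrA lerD2l.
by rewrite lerDr mulrn_wge0// mulr_ge0.
Qed.

Definition decaying (m K : nat) (C : R) (g : V -> R) :=
  smooth g /\ forall s, (size s <= m)%N ->
    forall x, `|foldr (@partial R n.+1) g s x| <= C * wt P K x.

(** The constant does not depend on [phi], which makes the later bounds uniform over the test
    class. *)
Lemma test_class_decaying m K N (phi : V -> R[i]) : (m <= N)%N -> Lam ^+ K <= b ^+ N ->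
  test_class A Dl N phi ->
  decaying m K ((2 * Lam) ^+ K) (fun x => complex.Re (phi x)) /\
  decaying m K ((2 * Lam) ^+ K) (fun x => complex.Im (phi x)).
Proof.
move=> mN LN [[sRe sIm _] hphi].
have C0 : 0 < (2 * Lam) ^+ K by rewrite exprn_gt0// mulr_gt0// (lt_le_trans ltr01).
have key (y r : R) x : 0 <= y -> y <= r -> Num.max 1 (rho A Dl x ^+ N) * r <= 1 ->
    y <= (2 * Lam) ^+ K * wt P K x.
  move=> y0 yr h; rewrite /wt ler_pdivlMr ?exprn_gt0 ?pnorm1_gt0//.
  have m1 : 0 < Num.max 1 (rho A Dl x ^+ N) by rewrite lt_max ltr01.
  have H := pow_pnorm_le_rho LN x.
  rewrite (le_trans (ler_wpM2l y0 H))// mulrCA -[leRHS]mulr1 ler_pM2l//.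
  by rewrite mulrC (le_trans _ h)// ler_pM2l.
split; split=> // s sm x.
  apply: key (hphi x (mi_of_seq s) _) => //; last by rewrite mi_deg_of_seq (leq_trans sm).
  rewrite -real_deriv_mi_of_seq//; exact: (abs_Re_le (cderiv (mi_of_seq s) phi x)).
apply: key (hphi x (mi_of_seq s) _) => //; last by rewrite mi_deg_of_seq (leq_trans sm).
rewrite -real_deriv_mi_of_seq//; exact: (abs_Im_le (cderiv (mi_of_seq s) phi x)).
Qed.

End anisotropic_geometry.

(** * Maximal function of an iterated difference *)

Lemma wt_ratio {R : realType} {n : nat} (P : 'M[R]_n) (c : R) K x y : 0 <= c ->
  1 + pnorm P y <= c * (1 + pnorm P x) -> wt P K x <= c ^+ K * wt P K y.
Proof.
move=> c0 h; rewrite /wt ler_pdivlMr ?exprn_gt0 ?pnorm1_gt0// mulrC.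
rewrite ler_pdivrMr ?exprn_gt0 ?pnorm1_gt0// -exprMn.
by rewrite lerXn2r ?nnegrE ?mulr_ge0 ?(ltW (pnorm1_gt0 _ _)).
Qed.

Section maximal_bound.
Context {R : realType} {n : nat}.
Local Notation V := 'cV[R]_n.+1.
Variables (A P : 'M[R]_n.+1) (t Lam : R).
Hypothesis uP : P \in unitmx.
Hypothesis uA : A \in unitmx.
Local Notation q := (pnorm P).
Local Notation wt := (wt P).
Hypothesis t1 : 1 < t.
Hypothesis qA : forall x, t * q x <= q (A *m x).
Hypothesis Lam1 : 1 <= Lam.
Hypothesis qAle : forall x, q (A *m x) <= Lam * q x.
Hypothesis b1 : 1 < bdet A.
Local Notation b := (bdet A).
Local Notation d := (2 * n.+1)%N.

Lemma pow_mul_wt K L x : (1 + q x) ^+ K * wt (K + L) x = wt L x.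
Proof. by rewrite wtD mulrA mulfV ?mul1r// expf_neq0// gt_eqF// pnorm1_gt0. Qed.

Definition wt_bounded (L : nat) (h : V -> R) :=
  vmeas h /\ exists2 H, 0 <= H & forall x, `|h x| <= H * wt L x.

Lemma wt_bounded_integrable L h : (d <= L)%N -> wt_bounded L h -> vintegrable h.
Proof.
move=> dL [mh [H H0 hH]].
exact: vintegrable_le (vintegrableZ H (vintegrable_wt uP dL)) hH.
Qed.

(** Taken backward because, against the reflected argument [y - z], it becomes a forward difference
    of the test function with step [- u]. *)
Definition bdiff (u : V) (h : V -> R) (x : V) : R := h x - h (x - u).

Lemma vmeas_translate (h : V -> R) (c : V) : vmeas h -> vmeas (fun x => h (x + c)).
Proof.
move=> mh; have := vmeas_affine 1%:M c mh; congr vmeas.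
by apply/funext => x; rewrite mul1mx.
Qed.

Lemma wt_bounded_bdiff L u h : wt_bounded L h -> wt_bounded L (bdiff u h).
Proof.
move=> [mh [H H0 hH]]; split; first by apply: vmeasB => //; exact: vmeas_translate.
exists (H + H * (1 + q u) ^+ L).
  by rewrite addr_ge0// mulr_ge0// exprn_ge0// ltW// pnorm1_gt0.
move=> x; rewrite mulrDl (le_trans (ler_normB _ _))// lerD// (le_trans (hH _))//.
by rewrite -mulrA ler_wpM2l// (le_trans (wt_shift _ _ _ _))// pnormN.
Qed.

Lemma wt_bounded_iter_bdiff L u h m : wt_bounded L h -> wt_bounded L (iter m (bdiff u) h).
Proof. by move=> hb; elim: m => //= m; exact: wt_bounded_bdiff. Qed.

Definition bounded_meas (G : V -> R) := vmeas G /\ exists M, forall x, `|G x| <= M.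

Lemma bounded_meas_fdiff w G : bounded_meas G -> bounded_meas (fdiff w G).
Proof.
move=> [mG [M GM]]; split; first by apply: vmeasB => //; exact: vmeas_translate.
by exists (M + M) => x; rewrite (le_trans (ler_normB _ _))// lerD.
Qed.

Lemma vmeas_reflect (G : V -> R) y : vmeas G -> vmeas (fun z => G (y - z)).
Proof.
move=> mG; have := vmeas_affine (- 1%:M) y mG; congr vmeas.
by apply/funext => z; rewrite mulNmx mul1mx addrC.
Qed.

Lemma vintegrable_mul_bounded h G : vintegrable h -> bounded_meas G ->
  vintegrable (fun z => h z * G z).
Proof.
move=> ih [mG [M GM]].
have ih' : vintegrable (fun z => M * `|h z|) by apply: vintegrableZ; exact: (integrable_norm ih).
apply: vintegrable_le ih' _; first by apply: vmeasM => //; exact: vintegrable_meas.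
by move=> z; rewrite normrM mulrC ler_wpM2r.
Qed.

(** Summation by parts: translation invariance moves the shift from [h] to [G]. *)
Lemma vint_bdiff u h G y : vintegrable h -> bounded_meas G ->
  vint (fun z => bdiff u h z * G (y - z)) = - vint (fun z => h z * fdiff (- u) G (y - z)).
Proof.
move=> ih bG; have [mG [M GM]] := bG.
have bGy y' : bounded_meas (fun z => G (y' - z)).
  by split; [exact: vmeas_reflect|exists M => z; exact: GM].
have i1 := vintegrable_mul_bounded ih (bGy y).
have i2 := vintegrable_mul_bounded ih (bGy (y - u)).
have -> : vint (fun z => bdiff u h z * G (y - z)) =
    vint (fun z => h z * G (y - z)) - vint (fun z => h z * G (y - u - z)).
  have E := vint_affine (- u) (unitmx1 R n.+1) i2.
  rewrite det1 normr1 invr1 mul1r in E; rewrite -E -vintB//; last first.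
    exact: vintegrable_affine (unitmx1 R n.+1) i2.
  apply: eq_vint => z; rewrite /bdiff mulrBl mul1mx; congr (_ - _ * G _).
  by rewrite opprB addrA subrK.
rewrite -opprB -vintB//; congr (- _); apply: eq_vint => z.
by rewrite /fdiff mulrBr [y - u - z]addrAC.
Qed.

Lemma vint_iter_bdiff m u L h G y : (d <= L)%N -> wt_bounded L h -> bounded_meas G ->
  `|vint (fun z => iter m (bdiff u) h z * G (y - z))| =
  `|vint (fun z => h z * iter m (fdiff (- u)) G (y - z))|.
Proof.
move=> dL hb; elim: m G => [//|m IHm] G bG.
have ih := wt_bounded_integrable dL (wt_bounded_iter_bdiff u m hb).
rewrite [in LHS]iterS vint_bdiff// normrN IHm; last exact: bounded_meas_fdiff.
by congr `|_|; apply: eq_vint => z; rewrite -iterSr.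
Qed.

(** A dilation turns the step [u] into [B *m u]; for [B = A ^ (- l)] the step shrinks like
    [(t ^+ l)^-1], the source of the gain at large scales. *)
Lemma iter_fdiff_mulmx m (B : 'M[R]_n.+1) u g x :
  iter m (fdiff u) (fun x => g (B *m x)) x = iter m (fdiff (B *m u)) g (B *m x).
Proof.
elim: m x => //= m IHm x.
by rewrite /fdiff !IHm mulmxDr.
Qed.

Lemma pnormN_le (l : nat) x : q (A ^ (- l%:Z) *m x) <= q x.
Proof.
rewrite (le_trans (pnorm_expNn_le uA t1 qA l x))// ler_piMl ?pnorm_ge0//.
by rewrite invf_le1 ?exprn_gt0 ?(lt_trans ltr01 t1)// exprn_ege1// ltW.
Qed.

Lemma wt_near K x y : q (y - x) < 1 -> wt K y <= 2 ^+ K * wt K x.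
Proof.
move=> qyx; rewrite -[in X in X <= _](subrK x y) addrC (le_trans (wt_shift _ _ _ _))//.
rewrite ler_wpM2r ?(ltW (wt_gt0 _ _ _))// lerXn2r ?nnegrE ?(ltW (pnorm1_gt0 _ _))//.
lra.
Qed.

Variables (m L0 L : nat) (h : V -> R) (u : V).
Hypothesis L0L : (L0 + d <= L)%N.
Hypothesis hL : wt_bounded L h.
Hypothesis tm : Lam ^+ L0 <= t ^+ m.

Local Notation f := (iter m (bdiff u) h).
Local Notation K := (L0 + d)%N.
Local Notation I := (vint (wt d)).

Let I0 : 0 <= I. Proof. by apply: vint_ge0 => x; rewrite ltW// wt_gt0. Qed.
Let dL : (d <= L)%N. Proof. by rewrite (leq_trans _ L0L)// leq_addl. Qed.

Let le_d : vintegrable (wt d). Proof. exact: vintegrable_wt. Qed.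

Lemma decaying_bounded_meas m' K' C g : 0 <= C -> decaying P m' K' C g -> bounded_meas g.
Proof.
move=> C0 [sg hg]; split; first exact: continuous_vmeas (smooth_continuous sg).
exists C => x; rewrite (le_trans (hg [::] isT x))//.
by rewrite ler_piMr// wt_le1.
Qed.

Lemma bounded_meas_mulmx (B : 'M[R]_n.+1) (G : V -> R) : bounded_meas G ->
  bounded_meas (fun x => G (B *m x)).
Proof.
move=> [mG [M GM]]; split; last by exists M.
have := vmeas_affine B 0 mG; congr vmeas; apply/funext => x; by rewrite addr0.
Qed.

(** Here the dilated test function is concentrated and decay is enough. The weight of [f] at [z] is
    moved to [y], the test function absorbs the resulting factor [(1 + q a) ^+ L0], and what
    remains, [wt d a], has an integral that cancels the normalisation [b ^ l]. *)
Lemma maximal_bound_small C0 : 0 <= C0 -> exists2 C1, 0 <= C1 &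
  forall g (l : nat) x y, decaying P m K C0 g -> q (A ^ (l%:Z) *m (y - x)) < 1 ->
  `|vint (fun z => f z * (b ^ (l%:Z) * g (A ^ (l%:Z) *m (y - z))))| <= C1 * wt L0 x.
Proof.
move=> C00; have [mf [F F0 fF]] := wt_bounded_iter_bdiff u m hL.
exists (F * C0 * 2 ^+ L0 * I); first by rewrite !mulr_ge0.
move=> g l x y dg qyx; have [sg hg] := dg.
have bl0 : 0 < b ^ (l%:Z) by rewrite exprz_gt0// (lt_trans ltr01).
have bgA := bounded_meas_mulmx (A ^ (l%:Z)) (decaying_bounded_meas C00 dg).
have Ai : vintegrable (fun z => wt d ((- A ^ (l%:Z)) *m z + A ^ (l%:Z) *m y)).
  apply: vintegrable_affine => //.
  by rewrite -scaleN1r unitmxZ ?unitmx_expz// unitrN1.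
pose D := F * C0 * wt L0 y * b ^ (l%:Z).
have iD := vintegrableZ D Ai.
have ile z : `|f z * (b ^ (l%:Z) * g (A ^ (l%:Z) *m (y - z)))| <=
    D * wt d ((- A ^ (l%:Z)) *m z + A ^ (l%:Z) *m y).
  have -> : (- A ^ (l%:Z)) *m z + A ^ (l%:Z) *m y = A ^ (l%:Z) *m (y - z).
    by rewrite mulmxBr mulNmx addrC.
  rewrite normrM [in X in X <= _]normrM (gtr0_norm bl0).
  set a := A ^ _ *m _.
  have h1 : `|f z| <= F * ((1 + q a) ^+ L0 * wt L0 y).
    rewrite (le_trans (fF z))// ler_wpM2l//.
    rewrite (@le_trans _ _ (wt L0 z)) ?wt_anti ?(leq_trans _ L0L) ?leq_addr//.
    rewrite -[in wt L0 z](subKr y z) (le_trans (wt_shift _ _ _ _))//.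
    rewrite ler_wpM2r ?(ltW (wt_gt0 _ _ _))//.
    rewrite lerXn2r ?nnegrE ?(ltW (pnorm1_gt0 _ _))// lerD2l pnormN.
    exact: (pnorm_expn_ge1 t1 qA).
  have h2 : `|g a| <= C0 * wt (L0 + d) a by exact: (hg [::]).
  apply: (@le_trans _ _ ((F * ((1 + q a) ^+ L0 * wt L0 y)) * (b ^ (l%:Z) * (C0 * wt (L0 + d) a)))).
    by rewrite ler_pM ?mulr_ge0 ?(ltW bl0)// ler_wpM2l ?(ltW bl0).
  rewrite /D -(pow_mul_wt L0 d a) le_eqVlt; apply/orP; left; apply/eqP; ring.
have vm : vmeas (fun z => f z * (b ^ (l%:Z) * g (A ^ (l%:Z) *m (y - z)))).
  apply: vmeasM => //; apply: vmeasM; first exact: vmeas_cst.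
  exact: (vmeas_reflect y bgA.1).
apply: (le_trans (vint_le (vintegrable_le vm iD ile) iD ile)).
rewrite vintZ// vint_affine//; last first.
  by rewrite -scaleN1r unitmxZ ?unitmx_expz// unitrN1.
have -> : `|\det (- A ^ (l%:Z))| = b ^ (l%:Z).
  by rewrite -scaleN1r detZ normrM normrX normrN1 expr1n mul1r det_expz.
have -> : D * ((b ^ (l%:Z))^-1 * I) = F * C0 * I * wt L0 y.
  by rewrite /D; field; rewrite gt_eqF.
rewrite [leRHS](_ : _ = F * C0 * I * (2 ^+ L0 * wt L0 x)); last by ring.
rewrite ler_wpM2l ?mulr_ge0// wt_near//.
exact: le_lt_trans (pnorm_expn_ge1 t1 qA l _) qyx.
Qed.

(** Here the test function is spread out. The [m] differences fall on it and gain [(t ^+ l) ^- m],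
    while returning from [wt L0 (B *m y)] to [wt L0 x] costs [(Lam ^+ l) ^+ L0]; by [tm] the gain
    covers the cost. *)
Lemma maximal_bound_large C0 : 0 <= C0 -> exists2 C1, 0 <= C1 &
  forall g (l : nat) x y, decaying P m K C0 g -> q (A ^ (- l%:Z) *m (y - x)) < 1 ->
  `|vint (fun z => f z * (b ^ (- l%:Z) * g (A ^ (- l%:Z) *m (y - z))))| <= C1 * wt L0 x.
Proof.
move=> C00; have [mh [H H0 hH]] := hL.
have [c c0 hc] := norm_le_pnorm uP; have [c2 c20 hc2] := pnorm_le_norm P.
(* The growth of [wt K] under a shift of sup norm at most [c * q u], which bounds the step at every
   scale [l]. *)
pose kappa := (1 + c2 * (c * q u)) ^+ K.
have kappa0 : 0 <= kappa.
  by rewrite exprn_ge0// addr_ge0// !mulr_ge0 ?pnorm_ge0// ltW.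
pose E := (n.+1%:R * (c * q u) * kappa) ^+ m.
have E0 : 0 <= E by rewrite exprn_ge0// !mulr_ge0 ?pnorm_ge0// ltW.
exists (E * C0 * H * 2 ^+ L0 * I); first by rewrite !mulr_ge0.
move=> g l x y dg qyx; have [sg hg] := dg.
have b0 : 0 < b by exact: lt_trans ltr01 b1.
have bl : b ^ (- l%:Z) = (b ^+ l)^-1 by rewrite -invr_expz.
have t0 : 0 < t by exact: lt_trans ltr01 t1.
have tl0 : 0 < t ^+ l by rewrite exprn_gt0.
set B := A ^ (- l%:Z).
have bg := decaying_bounded_meas C00 dg.
have bgB := bounded_meas_mulmx B bg.
have -> : vint (fun z => f z * (b ^ (- l%:Z) * g (B *m (y - z)))) =
    b ^ (- l%:Z) * vint (fun z => f z * g (B *m (y - z))).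
  rewrite -vintZ; first by apply: eq_vint => z; rewrite mulrCA.
  apply: vintegrable_mul_bounded.
    exact: wt_bounded_integrable dL (wt_bounded_iter_bdiff u m hL).
  split; first exact: (vmeas_reflect y bgB.1).
  by have [_ [M GM]] := bgB; exists M => z; exact: GM.
rewrite normrM (vint_iter_bdiff m u y dL hL bgB).
pose w := B *m (- u).
have qw : q w <= (t ^+ l)^-1 * q u.
  by rewrite /w (le_trans (pnorm_expNn_le uA t1 qA l _))// pnormN.
have nw : `|w| <= c * q u * (t ^+ l)^-1.
  by rewrite (le_trans (hc _))// -mulrA ler_wpM2l ?(ltW c0)// mulrC.
have nw' : `|w| <= c * q u.
  rewrite (le_trans nw)// ler_piMr ?mulr_ge0 ?(ltW c0) ?pnorm_ge0//.
  by rewrite invf_le1// exprn_ege1// ltW.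
have shift (a z : V) : (forall i, `|z i 0| <= `|w|) -> wt K (a + z) <= kappa * wt K a.
  move=> zw; rewrite (le_trans (wt_shift _ _ _ _))// ler_wpM2r ?(ltW (wt_gt0 _ _ _))//.
  rewrite lerXn2r ?nnegrE ?addr_ge0 ?mulr_ge0 ?(ltW c20) ?(ltW c0) ?pnorm_ge0//.
  rewrite lerD2l (le_trans (hc2 _))// ler_wpM2l ?(ltW c20)// (le_trans _ nw')//.
  exact: norm_le_coord.
(* The gain of the [m] differences: a constant [E] independent of [l], times the power of the
   scale. *)
pose T := E * (t ^+ l) ^- m.
have T0 : 0 <= T by rewrite mulr_ge0// invr_ge0 exprn_ge0// ltW.
have gd a : `|iter m (fdiff w) g a| <= T * (C0 * wt K a).
  apply: (@le_trans _ _ ((n.+1%:R * `|w| * kappa) ^+ m * (C0 * wt K a))).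
    apply: iter_fdiff_le => //.
    by move=> s sm a'; apply: hg; rewrite sm.
  rewrite ler_wpM2r ?mulr_ge0 ?(ltW (wt_gt0 _ _ _))//.
  rewrite /T /E -exprVn -exprMn lerXn2r ?nnegrE ?mulr_ge0 ?pnorm_ge0 ?(ltW c0) ?invr_ge0 ?(ltW tl0)//.
  by rewrite [leRHS]mulrAC ler_wpM2r// -mulrA ler_wpM2l.
pose D := T * C0 * H * wt L0 (B *m y).
have iD := vintegrableZ D le_d.
have ile z : `|h z * iter m (fdiff (- u)) (fun x => g (B *m x)) (y - z)| <= D * wt d z.
  rewrite iter_fdiff_mulmx -/w normrM.
  have h1 : wt K (B *m (y - z)) <= (1 + q z) ^+ L0 * wt L0 (B *m y).
    rewrite (le_trans (wt_anti _ _ (leq_addr d L0)))// mulmxBr.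
    rewrite (le_trans (wt_shift _ _ _ _))// ler_wpM2r ?(ltW (wt_gt0 _ _ _))//.
    rewrite lerXn2r ?nnegrE ?(ltW (pnorm1_gt0 _ _))// lerD2l pnormN.
    exact: pnormN_le.
  apply: (@le_trans _ _ ((H * wt (L0 + d) z) * (T * (C0 * ((1 + q z) ^+ L0 * wt L0 (B *m y)))))).
    rewrite ler_pM//.
      by rewrite (le_trans (hH z))// ler_wpM2l// wt_anti.
    by rewrite (le_trans (gd _))// !ler_wpM2l.
  rewrite /D -(pow_mul_wt L0 d z) le_eqVlt; apply/orP; left; apply/eqP; ring.
have vm : vmeas (fun z => h z * iter m (fdiff (- u)) (fun x => g (B *m x)) (y - z)).
  apply: vmeasM => //.
  have bi : bounded_meas (iter m (fdiff (- u)) (fun x => g (B *m x))).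
    by elim: (m) => //= k; exact: bounded_meas_fdiff.
  exact: (vmeas_reflect y bi.1).
have := vint_le (vintegrable_le vm iD ile) iD ile; rewrite vintZ// => hle.
have bl1 : `|b ^ (- l%:Z)| <= 1.
  by rewrite bl gtr0_norm ?invr_gt0 ?exprn_gt0// invf_le1 ?exprn_gt0// exprn_ege1// ltW.
rewrite (le_trans (ler_wpM2r _ bl1))// mul1r (le_trans hle)//.
have wBy : wt L0 (B *m y) <= 2 ^+ L0 * ((t ^+ l) ^+ m * wt L0 x).
  rewrite (le_trans (wt_near L0 (x := B *m x) _)) -?mulmxBr//.
  rewrite ler_wpM2l//; apply: (@le_trans _ _ ((Lam ^+ l) ^+ L0 * wt L0 x)).
    apply: wt_ratio; first by rewrite exprn_ge0// (le_trans ler01 Lam1).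
    rewrite mulrDr mulr1 lerD ?exprn_ege1//.
    exact: (pnorm_le_expNn uA Lam1 qAle).
  rewrite ler_wpM2r ?(ltW (wt_gt0 _ _ _))//.
  rewrite -!exprM ![(l * _)%N]mulnC !exprM lerXn2r ?nnegrE ?exprn_ge0 ?(ltW t0)//.
  exact: le_trans ler01 Lam1.
rewrite /D.
have -> : E * C0 * H * 2 ^+ L0 * I * wt L0 x =
    T * C0 * H * (2 ^+ L0 * ((t ^+ l) ^+ m * wt L0 x)) * I.
  by rewrite /T; field; rewrite gt_eqF// exprn_gt0.
by rewrite ler_wpM2r// ler_wpM2l// (mulr_ge0 (mulr_ge0 T0 C00) H0).
Qed.

End maximal_bound.

(** * Gaussian test functions *)

Section gaussian_test_functions.
Context {R : realType} {n : nat}.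
Local Notation V := 'cV[R]_n.+1.
Local Notation e_ i := (delta_mx i 0 : V).
Implicit Types (f g : V -> R) (x eta : V) (i : 'I_n.+1).

(** A class containing the modulated Gaussians and stable under partial derivatives. The phase [c]
    is free because differentiating the cosine shifts it by [pi / 2]. *)
Inductive gaussian_class : (V -> R) -> Prop :=
| gaussian_cos eta c :
    gaussian_class (fun x => expR (- dotv x x) * cos (dotv x eta + c))
| gaussian_add f g : gaussian_class f -> gaussian_class g ->
    gaussian_class (fun x => f x + g x)
| gaussian_scale a f : gaussian_class f -> gaussian_class (fun x => a * f x)
| gaussian_coord i f : gaussian_class f -> gaussian_class (fun x => x i 0 * f x).

Lemma is_derive_of_line f i x (df : R) :
  is_derive (0 : R) 1 (fun t : R => f (x + t *: e_ i)) df -> is_derive x (e_ i) f df.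
Proof.
have E : (fun h : R => h^-1 *: (f (x + (h *: (1 : R) + 0) *: e_ i) - f (x + 0 *: e_ i))) =
         (fun h : R => h^-1 *: (f (h *: e_ i + x) - f x)).
  apply/funext => h; rewrite scale0r !addr0 [x + _]addrC.
  by rewrite (_ : h *: (1 : R) = h)// /GRing.scale/= mulr1.
by move=> [d1 d2]; apply: DeriveDef; [move: d1|move: d2]; rewrite /derivable /derive /= E.
Qed.

Lemma gaussian_class_partial f : gaussian_class f -> forall i,
  exists2 f', gaussian_class f' & forall x, is_derive x (e_ i) f (f' x).
Proof.
elim=> [eta c|{}f g _ IHf _ IHg|a {}f _ IHf|j {}f gf IHf] i.
- exists (fun x => -2 * (x i 0 * (expR (- dotv x x) * cos (dotv x eta + c))) +
      eta i 0 * (expR (- dotv x x) * cos (dotv x eta + (c + pi / 2)))).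
    apply: gaussian_add; apply: gaussian_scale; last exact: gaussian_cos.
    by apply: gaussian_coord; exact: gaussian_cos.
  move=> x; apply: is_derive_of_line.
  rewrite [X in is_derive _ _ X](_ : _ = (fun t : R => expR (- (dotv x x + t * (2 * x i 0) + t * t))) *
     (fun t : R => cos ((dotv x eta + c) + t * eta i 0))); last first.
    apply/funext => t /=; congr (expR (- _) * cos _).
      rewrite dotvDl !dotvDr !dotvZl !dotvZr (dotvC (e_ i) x) !dotv_delta mxE !eqxx /=; ring.
    by rewrite dotvDl dotvZl (dotvC (e_ i)) dotv_delta; ring.
  have h1 : is_derive (0 : R) 1 (fun t : R => - (dotv x x + t * (2 * x i 0) + t * t)) (- (2 * x i 0)).
    have h := is_deriveN (is_deriveD (is_deriveD (is_derive_cst (dotv x x) (0 : R) (1 : R))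
      (is_deriveZ (2 * x i 0) (is_derive_id (0 : R) 1)))
      (is_deriveM (is_derive_id (0 : R) 1) (is_derive_id (0 : R) 1))).
    move: h; rewrite /GRing.scale/= !mul0r !addr0 add0r mulr1; congr is_derive.
    by apply/funext => t; rewrite /= [t * (2 * _)]mulrC.
  have h2 : is_derive (0 : R) 1 (fun t : R => dotv x eta + c + t * eta i 0) (eta i 0).
    have h := is_deriveD (is_derive_cst (dotv x eta + c) (0 : R) (1 : R))
      (is_deriveZ (eta i 0) (is_derive_id (0 : R) 1)).
    move: h; rewrite /GRing.scale/= add0r mulr1; congr is_derive.
    by apply/funext => t; rewrite /= [t * _]mulrC.
  have h3 := is_deriveM (is_derive1_comp (is_derive_expR _) h1) (is_derive1_comp (is_derive_cos _) h2).
  move: h3; congr is_derive.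
  rewrite /= /GRing.scale/= !mul0r !addr0 addrA cosDpihalf; ring.
- have [f' gf' hf'] := IHf i; have [g' gg' hg'] := IHg i.
  exists (fun x => f' x + g' x); first exact: gaussian_add.
  by move=> x; exact: is_deriveD.
- have [f' gf' hf'] := IHf i.
  exists (fun x => a * f' x); first exact: gaussian_scale.
  by move=> x; exact: is_deriveZ.
- have [f' gf' hf'] := IHf i.
  exists (fun x => x j 0 * f' x + (j == i)%:R * f x).
    by apply: gaussian_add; [exact: gaussian_coord|exact: gaussian_scale].
  move=> x.
  have hj : is_derive x (e_ i) (fun x : V => x j 0) (j == i)%:R.
    apply: is_derive_of_line.
    have h := is_deriveD (is_derive_cst (x j 0) (0 : R) (1 : R))
      (is_deriveZ ((j == i)%:R : R) (is_derive_id (0 : R) 1)).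
    move: h; rewrite /GRing.scale/= add0r mulr1; congr is_derive.
    by apply/funext => t; rewrite /= !mxE eqxx andbT [t * _]mulrC.
  have := is_deriveM hj (hf' x); congr is_derive.
  by rewrite /GRing.scale/= [f x * _]mulrC.
Qed.

Lemma gaussian_class_decay f : gaussian_class f -> forall K,
  exists2 C, 0 <= C & forall x, `|f x| * (1 + enorm x) ^+ K <= C.
Proof.
elim=> [eta c|{}f g _ IHf _ IHg|a {}f _ IHf|j {}f gf IHf] K.
(* A Taylor term bounds [(1 + r) ^+ K.+1] by the factorial times [expR (1 + r)], and
   [- r ^+ 2 + (1 + r) <= 2]. *)
- exists (K.+1`!%:R * expR 2); first by rewrite mulr_ge0// expR_ge0.
  move=> x; have r0 := enorm_ge0 x; rewrite -sqr_enorm; move: (enorm x) r0 => r r0.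
  have r1 : 0 <= 1 + r by rewrite addr_ge0.
  have h1 : (1 + r) ^+ K <= K.+1`!%:R * expR (1 + r).
    rewrite (@le_trans _ _ ((1 + r) ^+ K.+1))//.
      by rewrite exprS ler_peMl ?exprn_ge0// lerDl.
    rewrite -ler_pdivrMl ?ltr0n ?fact_gt0// mulrC.
    by rewrite (le_trans _ (expR_ge1Dxn K r1))// lerDr.
  have h2 : expR (- r ^+ 2) * expR (1 + r) <= expR 2.
    rewrite -expRD ler_expR.
    have : 0 <= (r - 1) ^+ 2 by rewrite sqr_ge0.
    have : 0 <= r ^+ 2 by rewrite sqr_ge0.
    rewrite sqrrB expr1n mulr1 mulr2n; lra.
  rewrite normrM ger0_norm ?expR_ge0//.
  apply: (@le_trans _ _ (expR (- r ^+ 2) * (K.+1`!%:R * expR (1 + r)))).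
    by rewrite ler_pM ?mulr_ge0 ?expR_ge0 ?exprn_ge0// ler_piMr ?expR_ge0// cos_max.
  by rewrite mulrCA ler_wpM2l.
- have [C C0 hC] := IHf K; have [D D0 hD] := IHg K.
  exists (C + D); first exact: addr_ge0.
  move=> x; rewrite (le_trans _ (lerD (hC x) (hD x)))// -mulrDl ler_wpM2r ?ler_normD//.
  by rewrite exprn_ge0// addr_ge0// enorm_ge0.
- have [C C0 hC] := IHf K; exists (`|a| * C); first exact: mulr_ge0.
  by move=> x; rewrite normrM -mulrA ler_wpM2l.
(* One more power of [1 + enorm x] pays for the coordinate. *)
- have [C C0 hC] := IHf K.+1; exists C => // x; apply: le_trans (hC x).
  have e0 : 0 <= 1 + enorm x by rewrite addr_ge0// enorm_ge0.
  rewrite exprS normrM -mulrA mulrCA ler_wpM2l// ler_wpM2r ?exprn_ge0//.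
  rewrite (le_trans (coord_le_norm _ _))// (le_trans (norm_le_enorm _))//.
  by rewrite lerDr.
Qed.

Lemma gaussian_class_foldr f s : gaussian_class f ->
  gaussian_class (foldr (@partial R n.+1) f s).
Proof.
move=> gf; elim: s => //= i s gs.
have [g gg hg] := gaussian_class_partial gs i.
rewrite (_ : partial i _ = g)//; apply/funext => x.
by have [_ dv] := hg x; rewrite /partial dv.
Qed.

Lemma gaussian_class_derivable f i x : gaussian_class f -> derivable f x (e_ i).
Proof. by move=> gf; have [g _ hg] := gaussian_class_partial gf i; have [] := hg x. Qed.

Lemma gaussian_class_bounded f : gaussian_class f ->
  exists2 C, 0 <= C & forall x, `|f x| <= C.
Proof.
move=> gf; have [C C0 hC] := gaussian_class_decay gf 0.
by exists C => // x; have := hC x; rewrite expr0 mulr1.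
Qed.

(** The partial derivatives stay in the class and are bounded, so [fdiff_le] with constant weight
    makes [f] Lipschitz. *)
Lemma gaussian_class_continuous f : gaussian_class f -> continuous f.
Proof.
move=> gf; apply/continuous_epsP => x e e0.
have bp i : exists C, forall y, `|partial i f y| <= C.
  by have [C _ hC] := gaussian_class_bounded (@gaussian_class_foldr f [:: i] gf); exists C.
have [C hC] := choice bp.
pose M := \sum_i `|C i|.
have M0 : 0 <= M by apply: sumr_ge0.
have hM i y : `|partial i f y| <= M * 1.
  rewrite mulr1 (le_trans (hC i y))// (le_trans (ler_norm _))// /M (bigD1 i)//= lerDl.
  exact: sumr_ge0.
have N0 : 0 < n.+1%:R * M + 1 by rewrite ltr_wpDl// mulr_ge0.
exists (e / (n.+1%:R * M + 1)); first by rewrite divr_gt0.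
move=> y xy; rewrite distrC.
have -> : f y - f x = fdiff (y - x) f x by rewrite /fdiff [x + _]addrC subrK.
have h : `|fdiff (y - x) f x| <= n.+1%:R * `|y - x| * 1 * (M * 1).
  apply: (@fdiff_le _ _ (fun=> 1)) => //; first by move=> *; rewrite mul1r.
  by move=> i z; exact: gaussian_class_derivable.
rewrite (le_lt_trans h)// !mulr1 mulrAC.
apply: (@le_lt_trans _ _ ((n.+1%:R * M + 1) * `|y - x|)); first by rewrite ler_wpM2r// lerDl.
by rewrite mulrC -ltr_pdivlMr// distrC.
Qed.

Lemma gaussian_class_smooth f : gaussian_class f -> smooth f.
Proof.
move=> gf s /=; have gs := gaussian_class_foldr s gf.
split; first exact: gaussian_class_continuous.
by move=> i x; exact: gaussian_class_derivable.
Qed.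

Lemma foldr_partial_scale f k s : smooth f ->
  foldr (@partial R n.+1) (fun x => k * f x) s = fun x => k * foldr (@partial R n.+1) f s x.
Proof.
move=> sf; elim: s => //= i s ->; apply/funext => x.
exact: (deriveZ k ((sf s).2 i x)).
Qed.

Lemma gaussian_class0 : gaussian_class (fun=> 0).
Proof.
rewrite (_ : (fun=> 0) = fun x => 0 * (expR (- dotv x x) * cos (dotv x 0 + 0))).
  exact/gaussian_scale/gaussian_cos.
by apply/funext => x; rewrite mul0r.
Qed.

Lemma gaussian_class_monomial (a : multi_index n.+1) f : gaussian_class f ->
  gaussian_class (fun x => monomial a x * f x).
Proof.
move=> gf; rewrite /monomial; elim: (index_enum _) => [|i s IHs].
  by under eq_fun do rewrite big_nil mul1r.
under eq_fun do rewrite big_cons -mulrA.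
elim: (a i) => [|k IHk]; first by under eq_fun do rewrite expr0 mul1r.
under eq_fun do rewrite exprS -mulrA.
exact: gaussian_coord.
Qed.

Lemma gaussian_class_real_deriv (a : multi_index n.+1) f : gaussian_class f ->
  gaussian_class (real_deriv a f).
Proof. by move=> gf; rewrite real_derivE; exact: gaussian_class_foldr. Qed.

Lemma gaussian_class_schwartz f : gaussian_class f -> schwartz (fun x => (f x)%:C%C).
Proof.
move=> gf; split; [exact: gaussian_class_smooth| |].
  exact: (gaussian_class_smooth gaussian_class0).
move=> a c.
have [C C0 hC] := gaussian_class_bounded (gaussian_class_monomial a (gaussian_class_real_deriv c gf)).
have [D D0 hD] := gaussian_class_bounded (gaussian_class_monomial a (gaussian_class_real_deriv c gaussian_class0)).
apply: (@le_lt_trans _ _ (C + D)%:E); last exact: ltry.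
apply: ge_ereal_sup => _ [x _ <-]; rewrite lee_fin (le_trans (normc_le _))//=.
by rewrite !mul0r subr0 addr0 lerD.
Qed.

Lemma gaussian_class_test_class (A P : 'M[R]_n.+1) (t b : R) N f :
  P \in unitmx -> A \in unitmx -> 1 < t ->
  (forall x, t * pnorm P x <= pnorm P (A *m x)) -> b = bdet A -> 1 < b ->
  gaussian_class f ->
  exists2 c : R, 0 < c &
    test_class A [set x : V | enorm (P *m x) < 1] N (fun x => (c * f x)%:C%C).
Proof.
move=> uP uA t1 qA bE b1 gf.
have [K bK] := expr_unbounded (b ^+ N) t1.
have [B B1 hB] : exists2 B : R, 1 <= B & forall x : V, 1 + pnorm P x <= B * (1 + enorm x).
  have [c c0 hc] := pnorm_le_norm P.
  exists (1 + c); first by rewrite lerDl ltW.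
  move=> x; have h := le_trans (hc x) (ler_wpM2l (ltW c0) (norm_le_enorm x)).
  have := enorm_ge0 x; move: h; move: (pnorm P x) (enorm x) => y z h z0.
  have : 0 <= c * z by rewrite mulr_ge0// ltW.
  rewrite mulrDl !mulrDr !mul1r mulr1; lra.
have bound (a : multi_index n.+1) : exists C : R, 0 <= C /\
    forall x, (1 + pnorm P x) ^+ K * ComplexField.Normc.normc
      (cderiv a (fun x => (f x)%:C%C) x) <= C.
  have [C C0 hC] := gaussian_class_decay (gaussian_class_real_deriv a gf) K.
  have [D D0 hD] := gaussian_class_decay (gaussian_class_real_deriv a gaussian_class0) K.
  exists (B ^+ K * (C + D)); split.
    by rewrite mulr_ge0 ?addr_ge0// exprn_ge0// (le_trans ler01).
  move=> x; have e0 : 0 <= 1 + enorm x by rewrite addr_ge0// enorm_ge0.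
  have n0 : 0 <= ComplexField.Normc.normc (cderiv a (fun x => (f x)%:C%C) x).
    by case: (cderiv _ _ _) => u v /=; rewrite sqrtr_ge0.
  apply: (@le_trans _ _ ((B * (1 + enorm x)) ^+ K *
      (`|real_deriv a f x| + `|real_deriv a (fun=> 0) x|))).
    rewrite ler_pM ?exprn_ge0 ?(ltW (pnorm1_gt0 _ _))//.
      by rewrite lerXn2r ?nnegrE ?mulr_ge0 ?(ltW (pnorm1_gt0 _ _)) ?(le_trans ler01 B1).
    exact: (normc_le (cderiv a _ x)).
  rewrite exprMn -mulrA ler_wpM2l ?exprn_ge0 ?(le_trans ler01 B1)//.
  by rewrite mulrC mulrDl lerD.
have [C hC] := choice bound.
(* A multi-index of degree at most [N] has entries at most [N]; such indices form a finite type,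
   over which the bounds are summed into one normalising constant. *)
pose mi (a : {ffun 'I_n.+1 -> 'I_N.+1}) : multi_index n.+1 := [ffun i => nat_of_ord (a i)].
pose S := \sum_a C (mi a).
have S0 : 0 <= S by apply: sumr_ge0 => a _; exact: (hC _).1.
have S1 : 0 < S + 1 by rewrite ltr_wpDl.
exists (S + 1)^-1; first by rewrite invr_gt0.
split; first exact/gaussian_class_schwartz/gaussian_scale.
move=> x a aN.
have Da : cderiv a (fun x => ((S + 1)^-1 * f x)%:C%C) x =
    ((S + 1)^-1)%:C%C * cderiv a (fun x => (f x)%:C%C) x.
  rewrite /cderiv /= !real_derivE foldr_partial_scale; last exact: gaussian_class_smooth.
  set sq := flatten _; set k := (S + 1)^-1.
  have := foldr_partial_scale k sq (gaussian_class_smooth gaussian_class0).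
  under eq_fun do rewrite mulr0.
  move=> E0; congr (_ +i* _)%C; rewrite mul0r ?subr0 ?addr0//.
  exact: (congr1 (fun F => F x) E0).
have [h0 hb] := hC a.
have aE : a = mi [ffun i => inord (a i)].
  apply/ffunP => i; rewrite !ffunE inordK// ltnS (leq_trans _ aN)//.
  by rewrite /mi_deg (bigD1 i)//= leq_addr.
have CS : C a <= S.
  rewrite /S aE (bigD1 [ffun i => inord (a i)])//= lerDl.
  by apply: sumr_ge0 => a' _; exact: (hC _).1.
have k0 : 0 < (S + 1)^-1 by rewrite invr_gt0.
rewrite Da ComplexField.Normc.normcM.
have -> : ComplexField.Normc.normc ((S + 1)^-1)%:C%C = (S + 1)^-1.
  by rewrite /= expr0n addr0 sqrtr_sqr gtr0_norm.
rewrite mulrCA ler_pdivrMl// mulr1.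
have n0 : 0 <= ComplexField.Normc.normc (cderiv a (fun x => (f x)%:C%C) x).
  by case: (cderiv _ _ _) => u v /=; rewrite sqrtr_ge0.
apply: (le_trans (ler_wpM2r n0 (rho_le_pow_pnorm uP uA t1 qA bE b1 bK x))).
by rewrite (le_trans (hb x))// (le_trans CS)// lerDl.
Qed.

End gaussian_test_functions.

(** * Functions with a spectral gap *)

Section schwartz_integrable.
Context {R : realType} {n : nat}.
Local Notation V := 'cV[R]_n.+1.
Local Notation C := R[i].
Implicit Types (psi : V -> C) (x : V).
Local Notation cabs := (@ComplexField.Normc.normc R).

Lemma cderiv0 psi : cderiv [ffun=> 0%N] psi = psi.
Proof.
have E (f : V -> R) : real_deriv [ffun=> 0%N] f = f.
  by rewrite /real_deriv; elim: (enum _) => //= i s ->; rewrite ffunE.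
by apply/funext => x; rewrite /cderiv !E; case: (psi x).
Qed.

Lemma schwartz_seminorm_bound psi a b : schwartz psi ->
  exists2 M, 0 <= M & forall x, cabs ((monomial a x)%:C%C * cderiv b psi x) <= M.
Proof.
move=> [_ _ /(_ a b)]; rewrite /seminorm; set S := (X in ereal_sup X) => Soo.
have ub x : ((cabs ((monomial a x)%:C%C * cderiv b psi x))%:E <= ereal_sup S)%E.
  by apply: ereal_sup_ubound; exists x.
have n0 (z : C) : 0 <= cabs z by case: z => u v /=; rewrite sqrtr_ge0.
have Sfin : ereal_sup S \is a fin_num.
  rewrite fin_numElt Soo andbT (lt_le_trans _ (ub 0))//.
  exact: ltNyr.
exists (fine (ereal_sup S)).
  by rewrite -lee_fin fineK// (le_trans _ (ub 0))// lee_fin.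
by move=> x; rewrite -lee_fin fineK.
Qed.

Lemma monomial_single (i : 'I_n.+1) K x :
  monomial [ffun j => if j == i then K else 0%N] x = x i 0 ^+ K.
Proof.
rewrite /monomial (bigD1 i)//= ffunE eqxx big1 ?mulr1// => j ji.
by rewrite ffunE (negbTE ji) expr0.
Qed.

Lemma schwartz_bounded psi : schwartz psi -> exists2 M, 0 <= M & forall x, cabs (psi x) <= M.
Proof.
move=> spsi; have [M M0 hM] := schwartz_seminorm_bound [ffun=> 0%N] [ffun=> 0%N] spsi.
exists M => // x; have := hM x; rewrite cderiv0 /monomial big1 ?mul1r// => i _.
by rewrite ffunE expr0.
Qed.

Lemma schwartz_wt psi K : schwartz psi ->
  exists2 M, 0 <= M & forall x, cabs (psi x) <= M * wt 1%:M K x.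
Proof.
move=> spsi; have [M0 M00 hM0] := schwartz_bounded spsi.
have hi i : exists M, 0 <= M /\ forall x, `|x i 0| ^+ K * cabs (psi x) <= M.
  have [M Mge hM] := schwartz_seminorm_bound [ffun j => if j == i then K else 0%N] [ffun=> 0%N] spsi.
  exists M; split=> // x; have := hM x.
  rewrite cderiv0 monomial_single ComplexField.Normc.normcM.
  by rewrite [X in X * _ <= _ -> _]/= expr0n addr0 sqrtr_sqr normrX.
have [Mi hMi] := choice hi.
pose S := M0 + \sum_i Mi i.
have S0 : 0 <= S by rewrite addr_ge0//; apply: sumr_ge0 => i _; exact: (hMi i).1.
have N0 : 0 <= (n.+1%:R * 2 : R) ^+ K by rewrite exprn_ge0.
exists ((n.+1%:R * 2) ^+ K * S); first by rewrite mulr_ge0.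
move=> x; have c0 : 0 <= cabs (psi x) by case: (psi x) => u v /=; rewrite sqrtr_ge0.
rewrite /wt ler_pdivlMr ?exprn_gt0 ?pnorm1_gt0//.
have q1 : 1 + pnorm 1%:M x <= n.+1%:R * (1 + `|x|).
  rewrite /pnorm mul1mx mulrDr mulr1 lerD ?ler1n//.
  exact: enorm_le_norm.
have xK : `|x| ^+ K * cabs (psi x) <= S.
  have [/eqP|K0] := posnP K.
    move/eqP ->; rewrite expr0 mul1r (le_trans (hM0 _))// lerDl.
    by apply: sumr_ge0 => i _; exact: (hMi i).1.
  (* The sup norm is attained at a coordinate, whose pure power [K] is one of the Schwartz
     monomials. *)
  have [i xi] : exists i, `|x| = `|x i 0|.
    have [i _ hi'] := @Order.TotalTheory.arg_maxP _ _ _ (0 : 'I_n.+1) predT (fun i => `|x i 0|) isT.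
    exists i; apply/eqP; rewrite eq_le coord_le_norm andbT norm_le_coord// => j.
    exact: hi'.
  rewrite xi (le_trans ((hMi i).2 x))// /S (bigD1 i)//= addrCA lerDl addr_ge0//.
  by apply: sumr_ge0 => j _; exact: (hMi j).1.
have y1 : (1 + `|x|) ^+ K * cabs (psi x) <= 2 ^+ K * S.
  have [x1|x1] := leP `|x| 1.
    rewrite ler_pM ?exprn_ge0 ?addr_ge0//.
      by rewrite lerXn2r ?nnegrE ?addr_ge0//; lra.
    rewrite (le_trans (hM0 _))// lerDl.
    by apply: sumr_ge0 => i _; exact: (hMi i).1.
  apply: (@le_trans _ _ ((2 * `|x|) ^+ K * cabs (psi x))).
    rewrite ler_wpM2r// lerXn2r ?nnegrE ?addr_ge0 ?mulr_ge0//; lra.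
  by rewrite exprMn -mulrA ler_wpM2l ?exprn_ge0.
rewrite mulrC (@le_trans _ _ ((n.+1%:R * (1 + `|x|)) ^+ K * cabs (psi x)))//.
  rewrite ler_wpM2r// lerXn2r ?nnegrE ?(ltW (pnorm1_gt0 _ _))//.
by rewrite !exprMn -!mulrA ler_wpM2l ?exprn_ge0.
Qed.

Lemma schwartz_vmeas psi : schwartz psi ->
  vmeas (fun x => complex.Re (psi x)) /\ vmeas (fun x => complex.Im (psi x)).
Proof.
move=> [sR sI _]; split; apply: continuous_vmeas; exact: smooth_continuous.
Qed.

Lemma schwartz_vintegrable psi : schwartz psi ->
  vintegrable (fun x => complex.Re (psi x)) /\ vintegrable (fun x => complex.Im (psi x)).
Proof.
move=> spsi; have [M M0 hM] := schwartz_wt (2 * n.+1) spsi.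
have [mR mI] := schwartz_vmeas spsi.
have iw := vintegrableZ M (vintegrable_wt (unitmx1 R n.+1) (leqnn (2 * n.+1))).
split; apply: vintegrable_le iw _ => // x; apply: le_trans (hM x).
  exact: abs_Re_le.
exact: abs_Im_le.
Qed.

End schwartz_integrable.

(** * Vanishing frequencies and products of sinc *)

Section spectral_gap.
Context {R : realType} {n : nat}.
Local Notation V := 'cV[R]_n.+1.
Implicit Types (psi : V -> R[i]) (F : V -> R) (x xi eta c : V).

Lemma vmeas_dotv xi : vmeas (fun x => dotv x xi).
Proof.
by apply: vmeas_sum => i; apply: vmeasM; [exact: vmeas_coord|exact: vmeas_cst].
Qed.

Lemma bounded_meas_cos (th : V -> R) : vmeas th -> bounded_meas (fun x => cos (th x)).
Proof.
move=> mth; split; last by exists 1 => x; exact: cos_max.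
by apply: vmeas_comp => //; apply: continuous_measurable_fun; exact: continuous_cos.
Qed.

Lemma bounded_meas_sin (th : V -> R) : vmeas th -> bounded_meas (fun x => sin (th x)).
Proof.
move=> mth; split; last by exists 1 => x; exact: sin_max.
by apply: vmeas_comp => //; apply: continuous_measurable_fun; exact: continuous_sin.
Qed.

Definition phase xi x : R := 2 * pi * dotv x xi.

Lemma vmeas_phase xi : vmeas (phase xi).
Proof. by apply: vmeasM; [exact: vmeas_cst|exact: vmeas_dotv]. Qed.

(** For integrable real [F] this says that its Fourier transform vanishes at [xi]: the phases [0]
    and [- (pi / 2)] give the cosine and sine parts. The free phase makes the notion invariant under
    translations of [F]. *)
Definition null_frequency F xi :=
  forall a : R, vint (fun x => F x * cos (phase xi x + a)) = 0.

(** The transform of the real part of [psi] at [xi] mixes the values of [fourier psi] at [xi] and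
    [- xi], and so does that of the imaginary part. *)
Lemma fourier_null_frequency psi xi : schwartz psi ->
  fourier psi xi = 0 -> fourier psi (- xi) = 0 ->
  null_frequency (fun x => complex.Re (psi x)) xi /\
  null_frequency (fun x => complex.Im (psi x)) xi.
Proof.
move=> spsi f1 f2; have [iR iI] := schwartz_vintegrable spsi.
have bc := bounded_meas_cos (vmeas_phase xi).
have bs := bounded_meas_sin (vmeas_phase xi).
have iRc := vintegrable_mul_bounded iR bc; have iRs := vintegrable_mul_bounded iR bs.
have iIc := vintegrable_mul_bounded iI bc; have iIs := vintegrable_mul_bounded iI bs.
pose rc := vint (fun x => complex.Re (psi x) * cos (phase xi x)).
pose rs := vint (fun x => complex.Re (psi x) * sin (phase xi x)).
pose ic := vint (fun x => complex.Im (psi x) * cos (phase xi x)).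
pose js := vint (fun x => complex.Im (psi x) * sin (phase xi x)).
have ReE (z : R[i]) (c d : R) : complex.Re (z * (c +i* d)%C) = complex.Re z * c - complex.Im z * d.
  by case: z.
have ImE (z : R[i]) (c d : R) : complex.Im (z * (c +i* d)%C) = complex.Re z * d + complex.Im z * c.
  by case: z.
have [e1 e2] : rc + js = 0 /\ ic - rs = 0.
  rewrite -!(vintD, vintB)//; case: f1 => h1 h2; split.
    rewrite -[RHS]h1; apply: eq_Rintegral => x _; rewrite /phase ReE cosN sinN; ring.
  rewrite -[RHS]h2; apply: eq_Rintegral => x _; rewrite /phase ImE cosN sinN; ring.
have [e3 e4] : rc - js = 0 /\ ic + rs = 0.
  rewrite -!(vintD, vintB)//; case: f2 => h1 h2; split.
    by rewrite -[RHS]h1; apply: eq_Rintegral => x _; rewrite /phase ReE dotvNr !mulrN opprK.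
  by rewrite -[RHS]h2; apply: eq_Rintegral => x _; rewrite /phase ImE dotvNr !mulrN opprK addrC.
have [rc0 rs0 ic0 js0] : [/\ rc = 0, rs = 0, ic = 0 & js = 0].
  by clear -e1 e2 e3 e4; split; lra.
have split_cos F a : vintegrable (fun x => F x * cos (phase xi x)) ->
    vintegrable (fun x => F x * sin (phase xi x)) ->
    vint (fun x => F x * cos (phase xi x)) = 0 ->
    vint (fun x => F x * sin (phase xi x)) = 0 ->
    vint (fun x => F x * cos (phase xi x + a)) = 0.
  move=> i1 i2 z1 z2.
  rewrite (@eq_vint _ _ _ (fun x => cos a * (F x * cos (phase xi x)) - sin a * (F x * sin (phase xi x)))).
    by rewrite vintB ?vintZ ?z1 ?z2 ?mulr0 ?subr0//; exact: vintegrableZ.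
  by move=> x; rewrite cosD; ring.
by split=> a; apply: split_cos.
Qed.

(** The substitution moves the frequency by the inverse transpose, and the translation becomes a
    phase. *)
Lemma null_frequency_affine (A : 'M[R]_n.+1) c F xi : A \in unitmx -> vintegrable F ->
  null_frequency F ((invmx A)^T *m xi) -> null_frequency (fun x => F (A *m x + c)) xi.
Proof.
move=> uA iF nF a.
pose a' := a - phase xi (invmx A *m c).
have bcos := bounded_meas_cos (vmeasD (vmeas_phase ((invmx A)^T *m xi)) (vmeas_cst a')).
have := vint_affine c uA (vintegrable_mul_bounded iF bcos).
rewrite nF mulr0 => <-; apply: eq_vint => x; congr (_ * cos _).
rewrite /a' /phase -!dotv_mulmx mulmxDr mulKmx// dotvDl; ring.
Qed.

Variable e : R.
Hypothesis e0 : 0 < e.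

(** Indexed by a list with repetitions, so that factors can be added one at a time; each widens the
    spectrum by [e] along its axis. *)
Definition sinc_prod (s : seq 'I_n.+1) x : R := \prod_(i <- s) sinc e (2 * pi * x i 0).

Lemma vmeas_sinc_prod s : vmeas (sinc_prod s).
Proof.
apply: vmeas_prod => i; apply: vmeas_comp; first exact: measurable_sinc.
by apply: vmeasM; [exact: vmeas_cst|exact: vmeas_coord].
Qed.

Lemma bounded_meas_sinc_prod s c : bounded_meas (fun x => sinc_prod s (x - c)).
Proof.
split; first exact: (vmeas_translate (- c) (vmeas_sinc_prod s)).
exists ((2 * e) ^+ size s) => x; rewrite /sinc_prod normr_prod.
elim: s => [|i s IHs]; first by rewrite big_nil.
rewrite big_cons exprS ler_pM ?sinc_norm_le2e//.
by apply: prodr_ge0.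
Qed.

(** A factor in coordinate [i] averages over the frequencies [eta + t *: delta_mx i 0] with
    [|t| <= e], so [size s] factors stay in the sup-norm ball of radius [(size s)%:R * e]. *)
Lemma null_frequency_sinc_prod F s c eta :
  vintegrable F ->
  (forall xi, `|xi - eta| <= (size s)%:R * e -> null_frequency F xi) ->
  null_frequency (fun x => F x * sinc_prod s (x - c)) eta.
Proof.
move=> iF; elim: s eta => [|i s IHs] eta h a.
  have := h eta _ a; rewrite subrr normr0 mul0r lexx => /(_ isT) <-.
  by apply: eq_vint => x; rewrite /sinc_prod big_nil mulr1.
pose y x := 2 * pi * (x - c) i 0.
have my : vmeas y.
  apply: vmeasM; first exact: vmeas_cst.
  exact: (vmeas_translate (- c) (vmeas_coord i)).
have iFs := vintegrable_mul_bounded iF (bounded_meas_sinc_prod s c).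
have := vint_sinc_eq0 e0 iFs (vmeasD (vmeas_phase eta) (vmeas_cst a)) my.
have -> : vint (fun x => F x * sinc_prod s (x - c) * (cos (phase eta x + a) * sinc e (y x))) =
    vint (fun x => F x * sinc_prod (i :: s) (x - c) * cos (phase eta x + a)).
  apply: eq_vint => x; rewrite {2}/sinc_prod big_cons -/(sinc_prod s _) /y; ring.
apply=> t te.
have hs : null_frequency (fun x => F x * sinc_prod s (x - c)) (eta + t *: delta_mx i 0).
  apply: IHs => xi hxi; apply: h.
  rewrite -[_ - eta](subrKA (eta + t *: delta_mx i 0)) (le_trans (ler_normD _ _))//.
  rewrite -[(size (i :: s))]addn1 natrD mulrDl mul1r lerD// addrC addKr normrZ.
  rewrite -[leRHS]mulr1 ler_pM//; first by rewrite ler_norml.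
  apply: norm_le_coord => // k; rewrite mxE eqxx andbT.
  by case: eqP => _; rewrite ?normr1 ?normr0.
(* Centring the kernel at [c] contributes a phase independent of [x]. *)
rewrite -[RHS](hs (a - t * (2 * pi * c i 0))); apply: eq_vint => x; congr (_ * cos _).
rewrite /phase /y dotvDr dotvZr dotv_delta !mxE; ring.
Qed.

Definition full_seq (L : nat) : seq 'I_n.+1 := flatten (nseq L (enum 'I_n.+1)).

Lemma size_full_seq L : size (full_seq L) = (L * n.+1)%N.
Proof.
elim: L => //= L IHL; by rewrite /full_seq /= size_cat -/(full_seq L) IHL size_enum_ord mulSn.
Qed.

Lemma sinc_prod_full L x : sinc_prod (full_seq L) x = (\prod_i sinc e (2 * pi * x i 0)) ^+ L.
Proof.
elim: L => [|L IHL]; first by rewrite /sinc_prod big_nil expr0.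
rewrite exprS -IHL /sinc_prod /full_seq /= big_cat /=; congr (_ * _).
by rewrite big_enum.
Qed.

(** One round over the coordinates is bounded by a constant over the product of the
    [1 + |2 * pi * x i 0|], and this product is at least [1 + |x|]; [L] rounds give order [L]. *)
Lemma sinc_prod_wt (P : 'M[R]_n.+1) L : wt_bounded P L (sinc_prod (full_seq L)).
Proof.
split; first exact: vmeas_sinc_prod.
have [c c0 hc] := pnorm_le_norm P.
pose D := (1 + c) * (2 * e + 2) ^+ n.+1.
have e2 : 0 <= 2 * e + 2 by rewrite addr_ge0// mulr_ge0// ltW.
have D0 : 0 <= D by rewrite mulr_ge0 ?exprn_ge0// addr_ge0// ltW.
exists (D ^+ L); first exact: exprn_ge0.
move=> x; rewrite sinc_prod_full normrX /wt ler_pdivlMr ?exprn_gt0 ?pnorm1_gt0//.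
rewrite -exprMn lerXn2r ?nnegrE ?D0 ?(mulr_ge0 (normr_ge0 _) (ltW (pnorm1_gt0 _ _)))//.
have q1 : 1 + pnorm P x <= (1 + c) * (1 + `|x|).
  have := hc x; have := normr_ge0 x; move: (pnorm P x) (`|x|) => y z z0 h.
  rewrite mulrDl !mulrDr !mul1r mulr1; have : 0 < c by []; lra.
have p0 : 0 <= 2 * pi :> R by rewrite mulr_ge0// pi_ge0.
have p1 : 1 <= 2 * pi :> R by have := @pi_ge2 R; lra.
have x1 : 1 + `|x| <= \prod_(i < n.+1) (1 + `|2 * pi * x i 0|).
  have g1 (i : 'I_n.+1) : 1 <= 1 + `|2 * pi * x i 0| by rewrite lerDl.
  rewrite -lerBrDl; apply: norm_le_coord => [|i].
    by rewrite subr_ge0; apply: (big_ind (fun y => 1 <= y)) => // u v u1 v1; rewrite mulr_ege1.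
  rewrite lerBrDl (bigD1 i)//=.
  apply: (@le_trans _ _ (1 + `|2 * pi * x i 0|)).
    by rewrite lerD2l normrM ger0_norm// ler_peMl.
  rewrite ler_peMr ?addr_ge0//.
  by apply: (big_ind (fun y => 1 <= y)) => // u v u1 v1; rewrite mulr_ege1.
have c1 : 0 <= 1 + c by rewrite addr_ge0// ltW.
have q2 := le_trans q1 (ler_wpM2l c1 x1).
apply: (le_trans (ler_wpM2l (normr_ge0 _) q2)).
rewrite mulrCA ler_wpM2l// normr_prod -big_split /=.
rewrite -[X in _ <= _ ^+ X]card_ord -prodr_const; apply: ler_prod => i _.
by rewrite mulr_ge0 ?addr_ge0//= sinc_decay.
Qed.

Lemma sinc_prod_full_ge0 L x : ~~ odd L -> 0 <= sinc_prod (full_seq L) x.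
Proof. by move=> oL; rewrite sinc_prod_full; exact: exprn_even_ge0. Qed.

Lemma sinc_prod_full_gt0 L x : `|e * (2 * pi)| * `|x| < pi -> 0 < sinc_prod (full_seq L) x.
Proof.
move=> hx; rewrite sinc_prod_full exprn_gt0//; apply: prodr_gt0 => i _.
apply: sinc_gt0 => //; rewrite mulrA normrM (le_lt_trans _ hx)//.
by rewrite ler_wpM2l// coord_le_norm.
Qed.

End spectral_gap.

(** * The band-limited function and its orthogonality *)

Section band_limited.
Context {R : realType} {n : nat}.
Local Notation V := 'cV[R]_n.+1.
Implicit Types (F : V -> R) (x c : V).
Variables (e : R) (L m : nat) (xi0 u : V).
Hypothesis e0 : 0 < e.

Definition band_kernel x : R := sinc_prod e (full_seq L) x * cos (phase xi0 x).

Definition band_function : V -> R := iter m (bdiff u) band_kernel.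

Lemma bounded_meas_band_kernel : bounded_meas band_kernel.
Proof.
have [m1 [M1 h1]] := bounded_meas_cos (vmeas_phase xi0).
have [m2 [M2 h2]] := bounded_meas_sinc_prod e0 (full_seq L) (0 : V).
split; first by apply: vmeasM => //; exact: vmeas_sinc_prod.
exists (M2 * M1) => x; rewrite normrM ler_pM//.
by have := h2 x; rewrite subr0.
Qed.

Lemma wt_bounded_band_kernel (P : 'M[R]_n.+1) : wt_bounded P L band_kernel.
Proof.
have [mS [H H0 hH]] := sinc_prod_wt e0 P L.
split; first exact: bounded_meas_band_kernel.1.
exists H => // x; apply: le_trans (hH x); rewrite normrM ler_piMr//.
exact: cos_max.
Qed.

Lemma band_kernel_orthogonal F c : vintegrable F ->
  (forall xi, `|xi - xi0| <= (L * n.+1)%:R * e -> null_frequency F xi) ->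
  vint (fun x => band_kernel (x - c) * F x) = 0.
Proof.
move=> iF h; rewrite -size_full_seq in h.
have := null_frequency_sinc_prod e0 c iF h (- phase xi0 c) => <-.
apply: eq_vint => x; rewrite /band_kernel mulrC mulrA; congr (_ * cos _).
by rewrite /phase dotvDl dotvNl mulrDr mulrN.
Qed.

Lemma band_function_orthogonal F : vintegrable F ->
  (forall xi, `|xi - xi0| <= (L * n.+1)%:R * e -> null_frequency F xi) ->
  vint (fun x => band_function x * F x) = 0.
Proof.
move=> iF h.
(* The centre is generalised because one difference compares the kernels centred at [c] and at
   [c + u]. *)
suff H c : vint (fun x => band_function (x - c) * F x) = 0.
  by rewrite -[RHS](H 0); apply: eq_vint => x; rewrite subr0.
rewrite /band_function; elim: (m) c => [|k IHk] c; first exact: band_kernel_orthogonal.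
have bk : bounded_meas (iter k (bdiff u) band_kernel).
  elim: (k) => [|j [mj [M hM]]]; first exact: bounded_meas_band_kernel.
  split; first by apply: vmeasB => //; exact: vmeas_translate.
  by exists (M + M) => x; rewrite iterS /bdiff (le_trans (ler_normB _ _))// lerD.
have ib c' : vintegrable (fun x => iter k (bdiff u) band_kernel (x - c') * F x).
  have [mk [M hM]] := bk.
  have : vintegrable (fun x => F x * iter k (bdiff u) band_kernel (x - c')).
    apply: vintegrable_mul_bounded => //; split; first exact: vmeas_translate.
    by exists M => x; exact: hM.
  by congr vintegrable; apply/funext => x; rewrite mulrC.
have := vintB (ib c) (ib (c + u)); rewrite !IHk subr0 => <-.
by apply: eq_vint => x /=; rewrite /bdiff mulrBl opprD addrA.
Qed.

Hypothesis oL : ~~ odd L.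
Hypothesis u_half : dotv u xi0 = 2^-1.

(* Translation by u flips the sign of the cosine, so the alternating
   differences of the kernel add up the sinc products. *)
Lemma band_function_sign x : exists2 T, sinc_prod e (full_seq L) x <= T &
  band_function x = T * cos (phase xi0 x).
Proof.
rewrite /band_function; elim: (m) x => [|k IHk] x.
  by exists (sinc_prod e (full_seq L) x).
have [T hT ET] := IHk x; have [T' hT' ET'] := IHk (x - u).
exists (T + T').
  rewrite -[leLHS]addr0 lerD// (le_trans _ hT')//.
  exact: sinc_prod_full_ge0.
rewrite iterS /bdiff ET ET'.
have -> : phase xi0 (x - u) = phase xi0 x - pi.
  rewrite /phase dotvDl dotvNl u_half mulrDr mulrN -mulrA mulrCA.
  by congr (_ - _); field.
have -> : cos (phase xi0 x - pi) = - cos (phase xi0 x).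
  by have := cosDpi (phase xi0 x - pi); rewrite subrK => ->; rewrite opprK.
by rewrite mulrN opprK mulrDl.
Qed.

End band_limited.

(** * Frequencies whose orbit avoids the annulus *)

Section volume_scaling.
Context {R : realType} {n : nat}.
Local Notation V := 'cV[R]_n.
Local Notation col := (@col_of_tuple R n).

Lemma leb_affine_preimage (S : set V) (B : 'M[R]_n) (c : V) : B \in unitmx ->
  measurable (col @^-1` S) ->
  measurable (col @^-1` [set x | S (B *m x + c)%R]) /\
  (leb R n (col @^-1` [set x | S (B *m x + c)%R]) = `|\det B|^-1%:E * leb R n (col @^-1` S))%E.
Proof.
move=> uB mS.
have mI : measurable_fun setT ((fun x : V => (\1_S x : R)%:E) \o @col_of_tuple R n).
  apply/measurable_EFinP.
  exact: (measurable_indic mS).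
have mS' : measurable (col @^-1` [set x | S (B *m x + c)%R]).
  apply/(measurable_indicP R).
  exact: (@vmeas_affine R n B c (\1_S : V -> R) (measurable_indic mS)).
split=> //.
have := ge0_integral_leb_affine c uB mI (fun x => _).
have I0 (x : V) : (0 <= (\1_S x : R)%:E)%E by rewrite lee_fin.
move=> /(_ I0) h.
have E D : measurable (col @^-1` D) ->
    leb R n (col @^-1` D) = (\int[leb R n]_t (\1_D (col t) : R)%:E)%E.
  by move=> mD; rewrite -[in LHS](setIT (col @^-1` D)) -integral_indic.
by rewrite E// E.
Qed.

End volume_scaling.

Lemma measurable_unit_ellipsoid {R : realType} {n : nat} (P : 'M[R]_n) :
  measurable (@col_of_tuple R n @^-1` [set x | enorm (P *m x) < 1]).
Proof.
have := @vmeas_pnorm R _ P.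
move=> /(_ measurableT `]-oo, 1[%classic (measurable_itv _)); rewrite setTI.
by congr measurable; apply/seteqP; split=> x /=; rewrite in_itv.
Qed.

Section frequency_orbit.
Context {R : realType} {n : nat}.
Local Notation V := 'cV[R]_n.+1.
Variables (A P : 'M[R]_n.+1) (t Lam : R).
Hypothesis uP : P \in unitmx.
Hypothesis uA : A \in unitmx.
Local Notation q := (pnorm P).
Hypothesis t1 : 1 < t.
Hypothesis qA : forall x, t * q x <= q (A *m x).
Hypothesis Lam1 : 1 <= Lam.
Hypothesis qAle : forall x, q (A *m x) <= Lam * q x.

(** The [t]-multiple of the ellipsoid lies in its image under [A]; comparing volumes gives
    [t ^+ n.+1 <= bdet A]. *)
Lemma det_gt1 : volume [set x : V | enorm (P *m x) < 1] = 1%E -> 1 < bdet A.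
Proof.
move=> vol1; have t0 : 0 < t by exact: lt_trans ltr01 t1.
set S := [set x : V | enorm (P *m x) < 1] in vol1 *.
have mS := measurable_unit_ellipsoid P : measurable (@col_of_tuple R n.+1 @^-1` S).
have ut : ((t^-1)%:M : 'M[R]_n.+1) \in unitmx.
  by rewrite unitmxE det_scalar unitfE expf_neq0// invr_neq0// gt_eqF.
have [mt et] := leb_affine_preimage 0 ut mS.
have uA' : invmx A \in unitmx by rewrite unitmx_inv.
have [mA eA] := leb_affine_preimage 0 uA' mS.
move: et eA; rewrite -/(volume S) vol1 !mule1 det_scalar det_inv => et eA.
have : (`|t^-1 ^+ n.+1|^-1%:E <= `|(\det A)^-1|^-1%:E)%E.
  rewrite -et -eA; apply: le_measure; rewrite ?inE// => x /=.
  rewrite !addr0 mul_scalar_mx /S /= -/(pnorm P _) -/(pnorm P (invmx A *m _)) pnormZ gtr0_norm ?invr_gt0// => h.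
  apply: le_lt_trans h; rewrite ler_pdivlMl// (le_trans (qA _))// mulKVmx//.
rewrite lee_fin -!normfV !invrK -exprVn invrK gtr0_norm ?exprn_gt0//.
apply: lt_le_trans.
by rewrite exprS (lt_le_trans t1)// ler_peMr ?(ltW t0)// exprn_ege1// ltW.
Qed.

Lemma enorm_pnorm_equiv : exists2 c, 1 <= c &
  forall x : V, enorm x <= c * q x /\ q x <= c * enorm x.
Proof.
have [c c0 hc] := norm_le_pnorm uP; have [d d0 hd] := pnorm_le_norm P.
have h0 : 0 <= n.+1%:R * c by rewrite mulr_ge0// ltW.
exists (1 + n.+1%:R * c + d); first by rewrite -addrA lerDl addr_ge0// ltW.
move=> x; split.
  apply: (@le_trans _ _ (n.+1%:R * c * q x)).
    by rewrite -mulrA (le_trans (enorm_le_norm _))// ler_wpM2l.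
  by rewrite ler_wpM2r ?pnorm_ge0// addrAC lerDr addr_ge0// ltW.
apply: (@le_trans _ _ (d * enorm x)).
  by rewrite (le_trans (hd _))// ler_wpM2l ?(ltW d0)// norm_le_enorm.
by rewrite ler_wpM2r ?enorm_ge0// lerDr addr_ge0.
Qed.

(** A matrix and its transpose have the same Euclidean operator norm; passing between [enorm] and
    [q] in both directions costs [c ^+ 2]. *)
Lemma enorm_trmx_le (B : 'M[R]_n.+1) (k c : R) : 0 <= k -> 0 <= c ->
  (forall x : V, enorm x <= c * q x /\ q x <= c * enorm x) ->
  (forall x, q (B *m x) <= k * q x) ->
  forall eta, enorm (B^T *m eta) <= c ^+ 2 * k * enorm eta.
Proof.
move=> k0 c0 hc hB eta; set y := B^T *m eta.
have [->|ny] := eqVneq (enorm y) 0.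
  by rewrite !mulr_ge0 ?enorm_ge0// exprn_ge0.
have yp : 0 < enorm y by rewrite lt_neqAle eq_sym ny enorm_ge0.
rewrite -(ler_pM2l yp) -expr2 sqr_enorm {2}/y -dotv_mulmx.
rewrite (le_trans (ler_norm _))// (le_trans (dotv_le_enorm _ _))//.
rewrite mulrCA mulrA [leLHS]mulrC [leRHS]mulrC ler_wpM2l ?enorm_ge0//.
rewrite (le_trans (hc _).1)// expr2.
rewrite (@le_trans _ _ (c * (k * (c * enorm y))))//.
  by rewrite ler_wpM2l// (le_trans (hB _))// ler_wpM2l// (hc _).2.
by rewrite le_eqVlt; apply/orP; left; apply/eqP; ring.
Qed.

Lemma trmx_expzK (k : int) (x : V) : (A ^ (- k))^T *m ((A ^ k)^T *m x) = x.
Proof.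
rewrite mulmxA -trmx_mul -[X in X^T]/(A ^ k * A ^ (- k)).
by rewrite -invr_expz mulrV ?trmx1 ?mul1mx// unitrXz.
Qed.

Lemma trmx_expz_eigen (lambda : R) (v : V) : A^T *m v = lambda *: v -> lambda != 0 ->
  forall k : int, (A ^ k)^T *m v = lambda ^ k *: v.
Proof.
move=> Av l0.
have H (l : nat) : (A ^+ l)^T *m v = lambda ^+ l *: v.
  elim: l => [|l IHl]; first by rewrite trmx1 mul1mx scale1r.
  rewrite exprSr [X in X^T](_ : _ = A ^+ l *m A)// trmx_mul -mulmxA IHl.
  by rewrite -scalemxAr Av scalerA exprSr.
case=> l; first exact: H.
rewrite NegzE.
have l1 : lambda ^ l.+1%:Z != 0 by rewrite expf_neq0.
have := trmx_expzK l.+1%:Z v; rewrite H -scalemxAr => /(congr1 ( *:%R (lambda ^ (- l.+1%:Z)))).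
by rewrite scalerA -invr_expz mulVf// scale1r.
Qed.

(** The orbit of [xi0] has norms [L ^ k * tau], at least [tau > s] for [k >= 0] and at most
    [tau / L < r] for [k < 0]. The error made by replacing [xi0] with [xi] is under control for
    [k < J]; from [J] on it may grow, but there the expansion by itself carries [xi] beyond [s]. *)
Lemma frequency_escape (lambda : R) (v : V) (r s : R) :
  A^T *m v = lambda *: v -> v != 0 -> 0 < r < s -> s / r < `|lambda| ->
  exists (xi0 : V) (d : R), [/\ xi0 != 0, 0 < d & forall (k : int) (xi : V), `|xi - xi0| <= d ->
    ~~ (r <= enorm ((A ^ k)^T *m xi) <= s)].
Proof.
move=> Av v0 /andP[r0 rs] lrs.
have s0 : 0 < s by exact: lt_trans rs.
set L := `|lambda|; have L1 : 1 < L.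
  by apply: lt_trans lrs; rewrite ltr_pdivlMr// mul1r.
have L0 : 0 < L by exact: lt_trans ltr01 L1.
have l0 : lambda != 0 by rewrite -normr_gt0.
have slr : s < L * r by rewrite -ltr_pdivrMr.
have [tau taus taul] : exists2 tau, s < tau & tau < L * r.
  by exists ((s + L * r) / 2); lra.
have tau0 : 0 < tau by exact: lt_trans taus.
have nv0 : 0 < enorm v by rewrite lt0r enorm_ge0 andbT; apply: contra_neq v0 => /enorm_eq0.
pose xi0 : V := (tau / enorm v) *: v.
have nxi0 : enorm xi0 = tau.
  rewrite /xi0 enormZ gtr0_norm ?divr_gt0//.
  by rewrite divfK// gt_eqF.
have orb (k : int) : enorm ((A ^ k)^T *m xi0) = L ^ k * tau.
  rewrite /xi0 -scalemxAr (trmx_expz_eigen Av l0) scalerA mulrC -scalerA enormZ -/xi0 nxi0.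
  by congr *%R; case: k => j; rewrite ?normfV normrX.
have [c c1 hc] := enorm_pnorm_equiv.
have c0 : 0 <= c by rewrite (le_trans ler01).
have t0 : 0 < t by exact: lt_trans ltr01 t1.
have Lam0 : 0 <= Lam by exact: le_trans Lam1.
have K0 : 0 < c ^+ 2 by rewrite exprn_gt0// (lt_le_trans ltr01).
have neg (l : nat) (eta : V) :
    enorm ((A ^ (- l%:Z))^T *m eta) <= c ^+ 2 * (t ^+ l)^-1 * enorm eta.
  apply: enorm_trmx_le => //; first by rewrite invr_ge0 exprn_ge0// ltW.
  exact: (pnorm_expNn_le uA t1 qA).
have pos (l : nat) (eta : V) : enorm ((A ^ l%:Z)^T *m eta) <= c ^+ 2 * Lam ^+ l * enorm eta.
  apply: enorm_trmx_le => //; first by rewrite exprn_ge0.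
  exact: (pnorm_expn_le Lam1 qAle).
(* Makes [t ^+ J * (tau / 2)] exceed [c ^+ 2 * s]; the summand 1 gives the strict inequality. *)
have [J hJ] := expr_unbounded ((s + s) * c ^+ 2 / tau + 1) t1.
pose M := c ^+ 2 * Lam ^+ J.
have M0 : 0 < M by rewrite mulr_gt0// exprn_gt0// (lt_le_trans ltr01).
(* The admissible error: [tau / 2] keeps [xi] away from 0, and the other two are the gaps between
   the orbit and the annulus. *)
pose g := Num.min (tau / 2) (Num.min (tau - s) (r - tau / L)).
have g0 : 0 < g.
  by rewrite !lt_min divr_gt0// !subr_gt0 taus ltr_pdivrMr// mulrC.
have [g1 g2 g3] : [/\ g <= tau / 2, g <= tau - s & g <= r - tau / L].
  by rewrite /g; split; rewrite !ge_min lexx ?orbT.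
clearbody g.
(* [M] bounds the distortion by the powers below [J]; it also dominates [c ^+ 2], the bound for the
   negative powers. *)
pose e := g / 2 / M; have e0 : 0 < e by rewrite !divr_gt0.
have Me : M * e = g / 2 by rewrite /e mulrC divfK// gt_eqF.
have c21 : 1 <= c ^+ 2 by rewrite exprn_ege1.
have cM : c ^+ 2 <= M by rewrite ler_peMr ?exprn_ege1// ltW.
have ce : c ^+ 2 * e <= g / 2 by rewrite -Me ler_pM2r.
have ee : e <= g / 2 by rewrite (le_trans _ ce)// ler_peMl// ltW.
(* Dividing by the dimension puts the sup-norm ball inside the Euclidean ball of radius [e]. *)
exists xi0, (e / n.+1%:R); split.
- apply: contraTneq tau0 => x0.
  by rewrite -nxi0 x0 -(scale0r (0 : V)) enormZ normr0 mul0r ltxx.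
- by rewrite divr_gt0.
move=> k xi hxi.
have dxi : enorm (xi - xi0) <= e.
  by rewrite (le_trans (enorm_le_norm _))// mulrC -ler_pdivlMr.
have tri (B : 'M[R]_n.+1) (x y : V) : enorm (B *m x) <= enorm (B *m y) + enorm (B *m (x - y)).
  by rewrite (le_trans _ (enormD _ _))// -mulmxDr addrC subrK.
case: k => l.
  rewrite negb_and -!ltNge; apply/orP; right.
  have [Jl|lJ] := leqP J l.
    have := tri 1%:M xi0 xi; rewrite !mul1mx nxi0 -(enormN (xi0 - xi)) opprB => h.
    have h2 : tau / 2 <= enorm xi by lra.
    have := neg l ((A ^ l%:Z)^T *m xi); rewrite trmx_expzK => h3.
    have tl0 : 0 < t ^+ l by rewrite exprn_gt0.
    have h4 : t ^+ J <= t ^+ l by rewrite ler_weXn2l// ltW.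
    have h5 : t ^+ l * enorm xi <= c ^+ 2 * enorm ((A ^ l%:Z)^T *m xi).
      by move: h3; rewrite -mulrA mulrCA -ler_pdivrMl ?invr_gt0// invrK.
    have h6 : t ^+ l * (tau / 2) <= t ^+ l * enorm xi by rewrite ler_pM2l.
    have h7 : (s * c ^+ 2 / tau * 2 + 1) * (tau / 2) <= t ^+ l * (tau / 2).
      by rewrite ler_pM2r ?divr_gt0// (le_trans _ h4)// (le_trans _ hJ)//; lra.
    have h8 : (s * c ^+ 2 / tau * 2 + 1) * (tau / 2) = c ^+ 2 * s + tau / 2.
      by field; rewrite gt_eqF.
    rewrite -(ltr_pM2l K0); lra.
  have := tri ((A ^ l%:Z)^T) xi0 xi; rewrite -[xi0 - xi]opprB mulmxN enormN orb => h.
  have h2 := pos l (xi - xi0).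
  have h3 : c ^+ 2 * Lam ^+ l * enorm (xi - xi0) <= M * e.
    apply: ler_pM => //; rewrite ?enorm_ge0//.
      by rewrite mulr_ge0 ?exprn_ge0// ltW.
    by apply: ler_wpM2l; [exact: ltW|apply: ler_weXn2l => //; exact: ltnW].
  have h4 : tau <= L ^ l%:Z * tau by rewrite ler_peMl ?exprn_ege1// ltW.
  rewrite Me in h3; lra.
rewrite NegzE negb_and -!ltNge; apply/orP; left.
have := tri ((A ^ (- l.+1%:Z))^T) xi xi0; rewrite orb => h.
have h2 := neg l.+1 (xi - xi0).
have tl1 : (t ^+ l.+1)^-1 <= 1 by rewrite invf_le1 ?exprn_gt0// exprn_ege1// ltW.
have h3 : c ^+ 2 * (t ^+ l.+1)^-1 * enorm (xi - xi0) <= c ^+ 2 * e.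
  apply: ler_pM => //; rewrite ?enorm_ge0//.
    by rewrite mulr_ge0 ?invr_ge0 ?exprn_ge0// ltW.
  by rewrite ler_piMr// ltW.
have h4 : L ^ (- l.+1%:Z) * tau <= tau / L.
  rewrite mulrC ler_pM2l// -invr_expz lef_pV2 ?posrE ?exprn_gt0//.
  by rewrite ler_eXnr// ltW.
lra.
Qed.

End frequency_orbit.

(** * The Hardy quasi-norm of a band-limited function *)

Section real_distribution.
Context {R : realType} {n : nat}.
Local Notation V := 'cV[R]_n.+1.
Local Notation C := R[i].
Local Notation cabs := (@ComplexField.Normc.normc R).
Implicit Types (phi : V -> C).
Variable f : V -> R.

Definition real_distr : Defs.distribution R n.+1 := distr_of (fun x => (f x)%:C%C).

Lemma real_distrE phi : real_distr phi =
  (vint (fun x => f x * complex.Re (phi x)) +i* vint (fun x => f x * complex.Im (phi x)))%C.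
Proof.
rewrite /real_distr /distr_of /cintegral; congr (_ +i* _)%C; apply: eq_Rintegral => t _.
  by case: (phi _) => a b /=; rewrite mul0r subr0.
by case: (phi _) => a b /=; rewrite mul0r addr0.
Qed.

Lemma real_distr_eq0 phi : vint (fun x => f x * complex.Re (phi x)) = 0 ->
  vint (fun x => f x * complex.Im (phi x)) = 0 -> real_distr phi = 0.
Proof. by rewrite real_distrE => -> ->. Qed.

Lemma schwartz_bounded_meas phi : schwartz phi ->
  bounded_meas (fun x => complex.Re (phi x)) /\ bounded_meas (fun x => complex.Im (phi x)).
Proof.
move=> sphi; have [mR mI] := schwartz_vmeas sphi; have [M _ hM] := schwartz_bounded sphi.
split; split=> //; exists M => x; apply: le_trans (hM x).
  exact: abs_Re_le.
exact: abs_Im_le.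
Qed.

Hypothesis fi : vintegrable f.

(** Pairing with an integrable function is controlled by the sup norm, the only seminorm present
    when the order is 0; the factor 2 accounts for real and imaginary parts. *)
Lemma tempered_real_distr : tempered real_distr.
Proof.
split=> [c phi chi sphi schi|].
  have [bR bI] := schwartz_bounded_meas sphi; have [cR cI] := schwartz_bounded_meas schi.
  have [iR iI] := (vintegrable_mul_bounded fi bR, vintegrable_mul_bounded fi bI).
  have [jR jI] := (vintegrable_mul_bounded fi cR, vintegrable_mul_bounded fi cI).
  case: c => a b; rewrite !real_distrE.
  have E1 : vint (fun x => f x * complex.Re ((a +i* b)%C * phi x + chi x)) =
     a * vint (fun x => f x * complex.Re (phi x)) - b * vint (fun x => f x * complex.Im (phi x))
     + vint (fun x => f x * complex.Re (chi x)).
    rewrite -!vintZ// -vintB ?vintegrableZ// -vintD ?vintegrableB ?vintegrableZ//.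
    by apply: eq_vint => x; case: (phi x) (chi x) => u v [u' v'] /=; ring.
  have E2 : vint (fun x => f x * complex.Im ((a +i* b)%C * phi x + chi x)) =
     a * vint (fun x => f x * complex.Im (phi x)) + b * vint (fun x => f x * complex.Re (phi x))
     + vint (fun x => f x * complex.Im (chi x)).
    rewrite -!vintZ// -vintD ?vintegrableZ// -vintD ?vintegrableD ?vintegrableZ//.
    by apply: eq_vint => x; case: (phi x) (chi x) => u v [u' v'] /=; ring.
  by rewrite E1 E2.
have iaf : vintegrable (fun x => `|f x|) by exact: (integrable_norm fi).
exists (2 * vint (fun x => `|f x|)), 0%N => phi sphi.
have [bR bI] := schwartz_bounded_meas sphi.
pose z : multi_index n.+1 := [ffun=> 0%N].
have [S ES hS] : exists2 S, seminorm z z phi = S%:E & forall x, cabs (phi x) <= S.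
  have ub x : ((cabs (phi x))%:E <= seminorm z z phi)%E.
    apply: ereal_sup_ubound; exists x => //.
    by rewrite cderiv0 /monomial big1 ?mul1r// => i _; rewrite ffunE expr0.
  have fs : seminorm z z phi \is a fin_num.
    rewrite fin_numElt; have [_ _ ->] := sphi.
    by rewrite (lt_le_trans (ltNyr _) (ub 0)).
  exists (fine (seminorm z z phi)); first by rewrite fineK.
  by move=> x; rewrite -lee_fin fineK.
pose a0 : {ffun 'I_n.+1 -> 'I_1} := [ffun=> 0].
have a0E (a : {ffun 'I_n.+1 -> 'I_1}) : a = a0 by apply/ffunP => i; rewrite !ord1.
rewrite (big_pred1 a0) => [|a]; last by rewrite [a]a0E /= eqxx.
rewrite (big_pred1 a0) => [|a]; last by rewrite [a]a0E /= eqxx.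
rewrite (_ : [ffun i => _] = z); last by apply/ffunP => i; rewrite !ffunE.
rewrite ES lee_fin real_distrE (le_trans (normc_le _))//=.
have hV : vint (fun x => S * `|f x|) = S * vint (fun x => `|f x|) by rewrite vintZ.
have key g : bounded_meas g -> (forall x, `|g x| <= S) ->
    `|vint (fun x => f x * g x)| <= S * vint (fun x => `|f x|).
  move=> bg hg; rewrite -hV; apply: vint_le; first exact: vintegrable_mul_bounded.
    exact: vintegrableZ.
  by move=> x; rewrite normrM mulrC ler_wpM2r.
rewrite -mulrA mulr_natl mulr2n mulrC lerD// key// => x; apply: le_trans (hS x).
  exact: abs_Re_le.
exact: abs_Im_le.
Qed.

End real_distribution.

Lemma vint_gt0 {R : realType} {n : nat} (F : 'cV[R]_n -> R) (S : set 'cV[R]_n) :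
  vintegrable F -> (forall x, 0 <= F x) -> measurable (@col_of_tuple R n @^-1` S) ->
  (0 < volume S)%E -> (forall x, S x -> 0 < F x) -> 0 < vint F.
Proof.
move=> iF F0 mS S0 SF; rewrite lt0r vint_ge0// andbT; apply/eqP => F00.
have iF0 : (\int[leb R n]_t `|(F (col_of_tuple t))%:E| = 0)%E.
  under eq_integral do rewrite gee0_abs ?lee_fin//.
  rewrite -[LHS]fineK; last exact: integrable_fin_num iF.
  exact: (congr1 EFin F00).
have mF := measurable_int _ iF.
have /(ae_eq_integral_abs (leb R n) measurableT mF)[Z [mZ Z0 SZ]] := iF0.
have : (volume S <= leb R n Z)%E.
  apply: le_measure; rewrite ?inE// => t St; apply: SZ => /(_ I) /= [Ft0].
  by have := SF _ St; rewrite Ft0 ltxx.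
by rewrite Z0 leNgt S0.
Qed.

Lemma tempered0 {R : realType} {n : nat} : tempered ((fun=> 0) : Defs.distribution R n.+1).
Proof.
split=> [*|]; first by rewrite mulr0 addr0.
by exists 0, 0%N => phi _; rewrite mul0e ComplexField.Normc.normc0.
Qed.

Section band_hardy_norm.
Context {R : realType} {n : nat}.
Local Notation V := 'cV[R]_n.+1.
Local Notation C := R[i].
Local Notation cabs := (@ComplexField.Normc.normc R).
Variables (A P : 'M[R]_n.+1) (t Lam : R).
Hypothesis uP : P \in unitmx.
Hypothesis uA : A \in unitmx.
Local Notation q := (pnorm P).
Hypothesis t1 : 1 < t.
Hypothesis qA : forall x, t * q x <= q (A *m x).
Hypothesis Lam1 : 1 <= Lam.
Hypothesis qAle : forall x, q (A *m x) <= Lam * q x.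
Hypothesis vol1 : volume [set x : V | enorm (P *m x) < 1] = 1%E.
Local Notation b := (bdet A).
Local Notation Dl := [set x : V | enorm (P *m x) < 1].
Let b1 : 1 < b := det_gt1 uA t1 qA vol1.

Variables (L0 L m : nat) (e : R) (xi0 u : V).
Hypothesis L0L : (L0 + 2 * n.+1 <= L)%N.
Hypothesis tm : Lam ^+ L0 <= t ^+ m.
Hypothesis e0 : 0 < e.
Hypothesis oL : ~~ odd L.
Hypothesis u_half : dotv u xi0 = 2^-1.
Local Notation f := (band_function e L m xi0 u).
Local Notation fD := (real_distr f).

Lemma band_function_wt_bounded : wt_bounded P L f.
Proof. exact: wt_bounded_iter_bdiff (wt_bounded_band_kernel L xi0 e0 P). Qed.

Lemma band_function_integrable : vintegrable f.
Proof.
apply: wt_bounded_integrable band_function_wt_bounded => //.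
exact: leq_trans (leq_addl _ _) L0L.
Qed.

Variable N : nat.
Hypothesis mN : (m <= N)%N.
Hypothesis LN : Lam ^+ (L0 + 2 * n.+1) <= b ^+ N.

(** The sign of the scale decides which of the two bounds applies; the factor 2 adds up real and
    imaginary parts. *)
Lemma grand_maximal_band_le : exists2 C1, 0 <= C1 &
  forall x, (grand_maximal A Dl N fD x <= (C1 * wt P L0 x)%:E)%E.
Proof.
have hL := wt_bounded_band_kernel L xi0 e0 P.
have C00 : 0 <= (2 * Lam) ^+ (L0 + 2 * n.+1).
  by rewrite exprn_ge0// mulr_ge0// (le_trans ler01).
have [C1 C10 h1] := maximal_bound_small uP uA t1 qA b1 m u L0L hL C00.
have [C2 C20 h2] := maximal_bound_large uP uA t1 qA Lam1 qAle b1 u L0L hL tm C00.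
exists (2 * (C1 + C2)); first by rewrite mulr_ge0// addr_ge0.
move=> x; apply: ge_ereal_sup => _ [phi [k [y [tphi /(dilateP P uA) qyx ->]]]].
have [dR dI] := test_class_decaying uP uA t1 qA Lam1 qAle erefl b1 mN LN tphi.
rewrite lee_fin /convolve /dilate_fun real_distrE (le_trans (normc_le _))//=.
have w0 : 0 <= wt P L0 x by rewrite ltW// wt_gt0.
have key g : decaying P m (L0 + 2 * n.+1) ((2 * Lam) ^+ (L0 + 2 * n.+1)) g ->
    `|vint (fun z => f z * (b ^ (- k) * g (A ^ (- k) *m (y - z))))| <= (C1 + C2) * wt P L0 x.
  move=> dg; case: k qyx => l qyx.
    by rewrite (le_trans (h2 g l x y dg qyx))// ler_wpM2r// lerDr.
  move: qyx; rewrite NegzE opprK => qyx.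
  by rewrite (le_trans (h1 g l.+1 x y dg qyx))// ler_wpM2r// lerDl.
rewrite -mulrA mulr_natl mulr2n lerD//.
  rewrite (le_trans _ (key _ dR))// le_eqVlt; apply/orP; left; apply/eqP.
  congr `|_|; apply: eq_vint => z; congr (_ * _).
  by case: (phi _) => v w /=; rewrite mul0r subr0.
rewrite (le_trans _ (key _ dI))// le_eqVlt; apply/orP; left; apply/eqP.
congr `|_|; apply: eq_vint => z; congr (_ * _).
by case: (phi _) => v w /=; rewrite mul0r addr0.
Qed.

Lemma normc_ge0 (z : C) : 0 <= cabs z.
Proof. by case: z => a c /=; rewrite sqrtr_ge0. Qed.

(** The supremum of an empty set would be [-oo]; a member of the test class, here the zero function,
    excludes this. *)
Lemma grand_maximal_ge0 (g : Defs.distribution R n.+1) x : (0 <= grand_maximal A Dl N g x)%E.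
Proof.
have [c _ tc] := gaussian_class_test_class N uP uA t1 qA erefl b1 (@gaussian_class0 R n).
apply: (@le_trans _ _ (cabs (convolve g (dilate_fun A 0 (fun x => (c * 0)%:C%C)) x))%:E).
  by rewrite lee_fin normc_ge0.
apply: ereal_sup_ubound; exists (fun x => (c * 0)%:C%C), 0, x; split=> //.
apply/(dilateP P uA); rewrite subrr mulmx0 /pnorm mulmx0.
by rewrite -(scale0r (0 : V)) enormZ normr0 mul0r.
Qed.

(** Modulating the Gaussian at the frequency [xi0] produces the square of a cosine, so the integrand
    is nonnegative, and it is positive near 0. Evenness identifies the pairing with the convolution
    at 0. *)
Lemma band_function_test : exists phi, [/\ test_class A Dl N phi,
  forall x, phi (- x) = phi x & 0 < vint (fun z => f z * complex.Re (phi z))].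
Proof.
pose eta : V := (2 * pi) *: xi0.
have [c c0 tc] := gaussian_class_test_class N uP uA t1 qA erefl b1 (gaussian_cos eta 0).
have phE x : cos (dotv x eta + 0) = cos (phase xi0 x) by rewrite addr0 /eta dotvZr.
exists (fun x => (c * (expR (- dotv x x) * cos (dotv x eta + 0)))%:C%C); split=> //=.
  by move=> x; rewrite !phE /phase !dotvNl dotvNr opprK mulrN cosN.
have FE x : exists2 T, sinc_prod e (full_seq L) x <= T &
    f x * (c * (expR (- dotv x x) * cos (dotv x eta + 0))) =
    c * expR (- dotv x x) * cos (phase xi0 x) ^+ 2 * T.
  have [T hT ->] := band_function_sign e m oL u_half x; exists T => //.
  by rewrite phE; ring.
have [k k0 hk] := norm_le_pnorm uP.
(* [B * |x| < pi] ensures both that the sinc product is positive and that the phase is below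
   [pi / 4]; it holds on the dilate [S] of the ellipsoid of index [- l]. *)
pose B := `|e * (2 * pi)| + n.+1%:R * (2 * pi * enorm xi0) * 4.
have p0 : 0 < pi :> R by exact: pi_gt0.
have n0 := enorm_ge0 xi0.
have h0 : 0 <= 2 * pi * enorm xi0 by rewrite mulr_ge0// mulr_ge0// ltW.
have h1 : 0 <= n.+1%:R * (2 * pi * enorm xi0) by rewrite mulr_ge0.
have B0 : 0 <= B by rewrite addr_ge0// mulr_ge0.
have [l hl] := expr_unbounded (B * k / pi) t1.
pose S : set V := [set x | Dl (A ^ l%:Z *m x + 0)].
have [mS vS] := leb_affine_preimage 0 (unitmx_expz uA l%:Z) (measurable_unit_ellipsoid P).
apply: (@vint_gt0 _ _ _ S) => //.
- apply: vintegrable_mul_bounded; first exact: band_function_integrable.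
  exact: (schwartz_bounded_meas tc.1).1.
- move=> x; have [T hT ->] := FE x.
  rewrite mulr_ge0// ?(le_trans (sinc_prod_full_ge0 _ _ oL) hT)//.
  by rewrite mulr_ge0 ?sqr_ge0// mulr_ge0 ?expR_ge0// ltW.
- rewrite /volume vS -/(volume Dl) vol1 mule1 lte_fin invr_gt0 normr_gt0.
  by rewrite -unitfE -unitmxE unitmx_expz.
move=> x; rewrite /S /= addr0 -/(pnorm P _) => Sx.
have Bx : B * `|x| < pi.
  apply: (@le_lt_trans _ _ (pi * (t ^+ l * q x))).
    rewrite (le_trans (ler_wpM2l B0 (hk x)))// !mulrA.
    by rewrite ler_wpM2r ?pnorm_ge0// [leRHS]mulrC -ler_pdivrMr.
  rewrite gtr_pMr// (le_lt_trans _ Sx)//.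
  exact: (pnorm_expn_ge t1 qA).
have [T hT ->] := FE x.
have T0 : 0 < T.
  apply: lt_le_trans hT; apply: sinc_prod_full_gt0 => //.
  by rewrite (le_lt_trans _ Bx)// ler_wpM2r// lerDl mulr_ge0.
have ph : `|phase xi0 x| * 4 < pi.
  apply: le_lt_trans Bx; rewrite /phase normrM ger0_norm ?mulr_ge0 ?(ltW p0)//.
  have h2 := dotv_le_enorm x xi0; have h3 := enorm_le_norm x.
  rewrite (@le_trans _ _ (n.+1%:R * (2 * pi * enorm xi0) * 4 * `|x|))//; last first.
    by rewrite ler_wpM2r// lerDr.
  have h4 : 2 * pi * `|dotv x xi0| <= 2 * pi * (n.+1%:R * `|x| * enorm xi0).
    by rewrite ler_wpM2l ?mulr_ge0 ?(ltW p0)// (le_trans h2)// ler_wpM2r.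
  rewrite (le_trans (ler_wpM2r _ h4))// le_eqVlt; apply/orP; left; apply/eqP.
  by clear; ring.
have cph : 0 < cos (phase xi0 x).
  apply: cos_gt0_pihalf; rewrite -ltr_norml.
  by rewrite ltr_pdivlMr// (le_lt_trans _ ph)// ler_wpM2l// ler_nat.
by rewrite mulr_gt0// mulr_gt0 ?exprn_gt0// mulr_gt0// expR_gt0.
Qed.

(** When [q x < 1] the point 0 is admissible at scale 0, so a single test function bounds the
    maximal function from below on the whole ellipsoid. *)
Lemma grand_maximal_band_ge : exists2 c0, 0 < c0 &
  forall x, q x < 1 -> (c0%:E <= grand_maximal A Dl N fD x)%E.
Proof.
have [phi [tphi ephi phi0]] := band_function_test.
exists (vint (fun z => f z * complex.Re (phi z))) => // x qx.
apply: (@le_trans _ _ (cabs (convolve fD (dilate_fun A 0 phi) 0))%:E).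
  rewrite lee_fin (le_trans _ (abs_Re_le _))// (le_trans (ler_norm _))//.
  rewrite le_eqVlt; apply/orP; left; apply/eqP; congr `|_|.
  rewrite /convolve real_distrE /=; apply: eq_vint => z; congr (_ * _).
  rewrite /dilate_fun oppr0 !expr0z mul1mx sub0r ephi.
  by case: (phi _) => v w /=; rewrite mul0r subr0 mul1r.
apply: ereal_sup_ubound; exists phi, 0, 0; split=> //.
by apply/(dilateP P uA); rewrite oppr0 expr0z mul1mx sub0r pnormN.
Qed.

Variable p : R.
Hypothesis p0 : 0 < p.

Lemma hardy_norm_band_gt0 : (0 < hardy_norm A Dl N p fD)%E.
Proof.
have [c0 c00 hc] := grand_maximal_band_ge.
rewrite /hardy_norm unlock; apply: poweR_gt0.
apply: (@lt_le_trans _ _ (\int[leb R n.+1]_x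
   ((c0 `^ p)%:E * (\1_(@col_of_tuple R n.+1 @^-1` Dl) x)%:E))%E).
  have mD := measurable_unit_ellipsoid P.
  rewrite ge0_integralZl//; last by rewrite lee_fin powR_ge0.
    rewrite integral_indic// setIT.
    apply: mule_gt0; first by rewrite lte_fin powR_gt0.
    have : (0 < volume Dl)%E by rewrite vol1.
    exact.
  by apply/measurable_EFinP; exact: measurable_indic.
apply: ge0_le_integralT => x; first by rewrite -EFinM lee_fin mulr_ge0 ?powR_ge0.
rewrite indicE; have [|_] := boolP (x \in _); last by rewrite mule0 poweR_ge0.
rewrite inE /= mule1 -poweR_EFin => qx.
have h := hc _ qx; have c0e : (0 <= c0%:E)%E by rewrite lee_fin ltW.
apply: gt0_ler_poweR; rewrite ?(ltW p0)// ?in_itv /= ?andbT ?leey ?c0e ?abse_ge0//.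
by rewrite gee0_abs// (le_trans c0e).
Qed.

Hypothesis L0p : (2 * n.+1)%:R <= L0%:R * p.

(** By [L0p] the [p]-th power of [wt P L0] is at most the weight of order [2 * n.+1], which is
    integrable. *)
Lemma hardy_norm_band_lty : (hardy_norm A Dl N p fD < +oo)%E.
Proof.
have [C1 C10 hC] := grand_maximal_band_le.
rewrite /hardy_norm unlock; apply: poweR_lty.
apply: (@le_lt_trans _ _ (\int[leb R n.+1]_x
   (C1 `^ p * wt P (2 * n.+1) (col_of_tuple x))%:E)%E).
  apply: ge0_le_integralT => x; first exact: poweR_ge0.
  set y := col_of_tuple x.
  have w0 : 0 <= wt P L0 y by rewrite ltW// wt_gt0.
  have q1 := pnorm1_ge1 P y.
  have Cw : 0 <= C1 * wt P L0 y by rewrite mulr_ge0.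
  apply: (@le_trans _ _ ((C1 * wt P L0 y)%:E `^ p)%E).
    apply: gt0_ler_poweR; rewrite ?(ltW p0)// ?in_itv /= ?leey ?lee_fin ?abse_ge0 ?Cw//.
    rewrite gee0_abs; first exact: hC.
    exact: grand_maximal_ge0.
  rewrite poweR_EFin lee_fin powRM// ler_wpM2l ?powR_ge0//.
  rewrite /wt -!powR_invn ?(ltW (pnorm1_gt0 _ _))// -powRrM; apply: ler_powR => //.
  by rewrite mulNr lerN2.
apply: integrable_lty => //.
exact: (vintegrableZ (C1 `^ p) (vintegrable_wt uP (leqnn _))).
Qed.

End band_hardy_norm.

(** * The frame operator *)

Section adapted_geometry.
Context {R : realType} {n : nat}.
Local Notation V := 'cV[R]_n.+1.
Implicit Types (A : 'M[R]_n.+1) (D : set V).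

Lemma expansive_unitmx A : expansive A -> A \in unitmx.
Proof.
move=> eA; rewrite unitmxE unitfE; apply/det0P => -[v v0 vA].
have : complex_eigenvalue A 0.
  apply/eigenvalueP; exists (map_mx (real_complex R) v); last first.
    by rewrite map_mx_eq0.
  by rewrite -map_mxM vA map_mx0 scale0r.
by move=> /eA; rewrite ComplexField.Normc.normc0 ltr10.
Qed.

Lemma adapted_ellipsoid_pnorm A D : expansive A -> adapted_ellipsoid A D ->
  exists P t, [/\ P \in unitmx, D = [set x | enorm (P *m x) < 1], 1 < t &
    forall x, t * pnorm P x <= pnorm P (A *m x)].
Proof.
move=> eA [[P uP ->] _ [t t1 [_ sub]]]; exists P, t; split=> // x.
rewrite leNgt; apply/negP => lt_x.
have s0 : 0 < t * pnorm P x by rewrite (le_lt_trans _ lt_x)// pnorm_ge0.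
(* Divided by [s], [A *m x] enters the unit ball, while [(t / s) *: x] has norm exactly 1; this
   contradicts the inclusion. *)
pose s := t * pnorm P x.
have [|x' /= x'1 E] := sub (t *: (s^-1 *: (A *m x))).
  exists (s^-1 *: (A *m x)) => //=; rewrite -/(pnorm P _) pnormZ gtr0_norm ?invr_gt0//.
  by rewrite ltr_pdivrMl// mulr1.
have {}E : x' = (t / s) *: x.
  apply: (can_inj (mulKmx (expansive_unitmx eA))).
  by rewrite E -scalemxAr scalerA.
have t0 : 0 < t by exact: lt_trans ltr01 t1.
move: x'1; rewrite E -/(pnorm P _) pnormZ gtr0_norm ?divr_gt0//.
by rewrite mulrAC ltr_pdivrMr// mul1r /s ltxx.
Qed.

End adapted_geometry.

Section frame_operator.
Context {R : realType} {n : nat}.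
Local Notation V := 'cV[R]_n.+1.
Variables (A : 'M[R]_n.+1) (psi : V -> R[i]) (r s : R).
Hypothesis uA : A \in unitmx.
Hypothesis spsi : schwartz psi.
Hypothesis psi_rs : fourier_support psi `<=` euclidean_annulus r s.
Variables (e : R) (L m : nat) (xi0 u : V).
Hypothesis e0 : 0 < e.
Local Notation f := (band_function e L m xi0 u).
Hypothesis escape : forall (k : int) (xi : V), `|xi - xi0| <= (L * n.+1)%:R * e ->
  ~~ (r <= enorm ((A ^ k)^T *m xi) <= s).

Lemma null_frequencyZ a (F : V -> R) xi : vintegrable F -> null_frequency F xi ->
  null_frequency (fun x => a * F x) xi.
Proof.
move=> iF nF b; have bc := bounded_meas_cos (vmeasD (vmeas_phase xi) (vmeas_cst b)).
rewrite -[RHS](mulr0 a) -[in RHS](nF b) -vintZ; last exact: vintegrable_mul_bounded.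
by apply: eq_vint => x; rewrite mulrA.
Qed.

Lemma fourier_outside xi : ~~ (r <= enorm xi <= s) -> fourier psi xi = 0.
Proof.
move=> h; apply/eqP; apply: contraNT h => h; apply: psi_rs.
exact: subset_closure.
Qed.

(** The spectrum of [psi (A ^ k *m x + c)] is the image of that of [psi] under [(A ^ k)^T], so
    [escape] is used at [- k]. The Euclidean annulus is symmetric, which covers the opposite
    frequency. *)
Lemma null_frequency_orbit (k : int) c xi : `|xi - xi0| <= (L * n.+1)%:R * e ->
  null_frequency (fun x => complex.Re (psi (A ^ k *m x + c))) xi /\
  null_frequency (fun x => complex.Im (psi (A ^ k *m x + c))) xi.
Proof.
move=> hxi; have uk := unitmx_expz uA k.
have [iR iI] := schwartz_vintegrable spsi.
have Ek : invmx (A ^ k) = A ^ (- k) by rewrite -invr_expz.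
have h := escape (- k) hxi.
rewrite -Ek in h; have f1 := fourier_outside h.
have f2 : fourier psi (- ((invmx (A ^ k))^T *m xi)) = 0.
  by apply: fourier_outside; rewrite enormN.
have [nR nI] := fourier_null_frequency spsi f1 f2.
by split; [exact: (null_frequency_affine c uk iR nR)|exact: (null_frequency_affine c uk iI nI)].
Qed.

Lemma pairing_affine_eq0 jk : pairing (real_distr f) (affine A psi jk) = 0.
Proof.
case: jk => k l; have uk := unitmx_expz uA k.
have [iR iI] := schwartz_vintegrable spsi.
pose c : V := - map_mx intr l; pose a : R := bdet A `^ (k%:~R / 2).
have key a' g : vintegrable g ->
    (forall xi, `|xi - xi0| <= (L * n.+1)%:R * e ->
       null_frequency (fun x => g (A ^ k *m x + c)) xi) ->
    vint (fun x => f x * (a' * g (A ^ k *m x + c))) = 0.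
  move=> ig hg; have ig' := vintegrable_affine c uk ig.
  apply: band_function_orthogonal => //; first exact: vintegrableZ.
  by move=> xi /hg; exact: null_frequencyZ.
rewrite /pairing; apply: real_distr_eq0.
  rewrite -(key a (fun x => complex.Re (psi x)) iR) => [|xi /(null_frequency_orbit k c)[]//].
  apply: eq_vint => x; rewrite /affine /=; congr (_ * _).
  by case: (psi _) => v w /=; rewrite mul0r subr0.
(* The conjugation in the pairing changes the sign of the imaginary part. *)
rewrite -(key (- a) (fun x => complex.Im (psi x)) iI) => [|xi /(null_frequency_orbit k c)[]//].
apply: eq_vint => x; rewrite /affine /=; congr (_ * _).
by case: (psi _) => v w /=; rewrite mul0r addr0 mulNr.
Qed.

(** Every coefficient vanishes, so all finite partial sums are 0 and the empty set already serves as
    threshold. *)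
Lemma frame_op_band : frame_op A psi (real_distr f) (fun=> 0).
Proof.
split; first exact: tempered0.
move=> phi _; rewrite /has_sum.
under eq_fun => F.
  rewrite /partial_sum big1 ?subr0 ?ComplexField.Normc.normc0; last first.
    by move=> i _; rewrite pairing_affine_eq0 mul0r.
  over.
by move=> S /nbhs_singleton S0; exists finmap.fset0.
Qed.

End frame_operator.

(** Since [f] is sent to 0, the deviation sends it to its opposite, and the maximal function sees
    only moduli. *)
Lemma grand_maximal_opp {R : realType} {n : nat} (A : 'M[R]_n.+1) D N
    (g : Defs.distribution R n.+1) :
  grand_maximal A D N (fun phi => 0 - g phi) = grand_maximal A D N g.
Proof.
have E z : ComplexField.Normc.normc (0 - z) = ComplexField.Normc.normc z :> R.
  by rewrite sub0r; case: z => a b /=; rewrite !sqrrN.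
apply/funext => x; rewrite /grand_maximal; congr ereal_sup.
apply/seteqP; split=> _ [phi [k [y [tphi yx ->]]]]; exists phi, k, y; split=> //.
  by rewrite /convolve E.
by rewrite /convolve E.
Qed.

Lemma ler_mul_nat {R : realType} (x p : R) : 0 < p -> exists k : nat, x <= k%:R * p.
Proof.
move=> p0; exists (Num.truncn (x / p)).+1.
by rewrite -ler_pdivrMr// ltW// truncnS_gt.
Qed.

Theorem corollary1 (R : realType) (n : nat) (A : 'M[R]_n.+1)
    (Delta : set 'cV[R]_n.+1)
    (A_expansive : expansive A) (A_Delta : adapted_ellipsoid A Delta)
    (p : R) (p01 : 0 < p <= 1) :
  exists N0 : nat, forall N : nat, (N0 <= N)%N ->
  forall (lambda : R) (v : 'cV[R]_n.+1) (psi : 'cV[R]_n.+1 -> R[i]) (r s : R),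
    v != 0 -> A^T *m v = lambda *: v ->
    radial psi -> standing_hypothesis A Delta psi ->
    0 < r < s -> fourier_support psi `<=` euclidean_annulus r s ->
    s / r < `|lambda| ->
    (exists f g, [/\ hardy A Delta N p f, frame_op A psi f g & ~ distr_eq g f]) /\
    (1 <= hardy_op_norm A Delta N p (frame_deviation A psi))%E.
Proof.
have /andP[p0 _] := p01.
have uA := expansive_unitmx A_expansive.
have [P [t [uP DE t1 qA]]] := adapted_ellipsoid_pnorm A_expansive A_Delta.
have [Lam Lam1 qAle] := pnorm_mulmx_le uP A.
have vol1 : volume [set x | enorm (P *m x) < 1] = 1%E by case: A_Delta => _; rewrite DE.
have b1 := det_gt1 uA t1 qA vol1.
have [L0 L0p] := ler_mul_nat (2 * n.+1)%:R p0.
have [m tm] := expr_unbounded (Lam ^+ L0) t1.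
have [N1 LN1] := expr_unbounded (Lam ^+ (L0 + 2 * n.+1)) b1.
(* [m] counts the derivatives that the differences consume, [N1] secures the decay; both are fixed
   before [psi] and the eigenvector appear. *)
exists (maxn m N1) => N; rewrite geq_max => /andP[mN N1N].
have LN : Lam ^+ (L0 + 2 * n.+1) <= bdet A ^+ N.
  by rewrite (le_trans LN1)// ler_weXn2l// ltW.
move=> lambda v psi r s v0 Av _ [spsi _ _] rs psi_rs lrs.
have [xi0 [d [xi00 d0 escape]]] := frequency_escape uP uA t1 qA Lam1 qAle Av v0 rs lrs.
(* Doubling makes [L] even, hence the sinc product nonnegative. *)
pose L := (2 * (L0 + 2 * n.+1))%N.
have L0L : (L0 + 2 * n.+1 <= L)%N by rewrite leq_pmull.
have oL : ~~ odd L by rewrite oddM.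
have L0' : 0 < (L * n.+1)%:R :> R by rewrite ltr0n !muln_gt0 addn_gt0 orbT.
(* The kernel has [L * n.+1] factors, each spreading the spectrum by [e], which adds up to [d]. *)
pose e := d / (L * n.+1)%:R; have e0 : 0 < e by rewrite divr_gt0.
have Le : (L * n.+1)%:R * e = d by rewrite /e mulrC divfK// gt_eqF.
pose u := (2 * dotv xi0 xi0)^-1 *: xi0.
have dxi : dotv xi0 xi0 != 0 by apply: contra_neq xi00 => /dotvv_eq0.
have u_half : dotv u xi0 = 2^-1 by rewrite /u dotvZl invfM mulfVK.
have escape' k xi : `|xi - xi0| <= (L * n.+1)%:R * e -> ~~ (r <= enorm ((A ^ k)^T *m xi) <= s).
  by rewrite Le; exact: escape.
pose f := real_distr (band_function e L m xi0 u).
have hf0 : (0 < hardy_norm A Delta N p f)%E.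
  by rewrite DE; exact: (hardy_norm_band_gt0 uP uA t1 qA vol1 m L0L e0 oL u_half N p0).
have hfy : (hardy_norm A Delta N p f < +oo)%E.
  by rewrite DE; exact: (hardy_norm_band_lty uP uA t1 qA Lam1 qAle vol1 xi0 u L0L tm e0 mN LN p0 L0p).
have hf : hardy A Delta N p f.
  by split=> //; apply: tempered_real_distr; exact: (band_function_integrable uP m xi0 u L0L e0).
have Uf : frame_op A psi f (fun=> 0) by exact: (frame_op_band uA spsi psi_rs m u e0 escape').
have nf : ~ distr_eq f (fun=> 0).
  have [phi [[sphi _] _ phi0]] := band_function_test uP uA t1 qA vol1 m L0L e0 oL u_half N.
  by move=> /(_ phi sphi); rewrite /f real_distrE => -[E _]; move: phi0; rewrite E ltxx.
split.
  by exists f, (fun=> 0); split=> // E; apply: nf => phi sphi; rewrite (E phi sphi).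
(* On this [f] the quotient of quasi-norms is exactly 1, the norm being positive and finite. *)
apply: ereal_sup_ubound; exists f, (fun phi => 0 - f phi); split=> //.
  by exists (fun=> 0).
rewrite {1}/hardy_norm grand_maximal_opp -/(hardy_norm A Delta N p f) divee//.
  by rewrite ge0_fin_numE// ltW.
by rewrite gt_eqF.
Qed.
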